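(* For $\tau$ large, $$\Phi(\tau)=\frac{\mathbb{E}\left(|L(1,\mathbb{X})|^{2\kappa}\right)(e^\gamma\tau)^{-2\kappa}}{\kappa\sqrt{2\pi\mathcal{L}''(\kappa)}}\left(1+O\left(\sqrt{\frac{\log\kappa}{\kappa}}\right)\right)$$ and $$\Psi(\tau)=\frac{\mathbb{E}\left(|L(1,\mathbb{X})|^{-2\tilde\kappa}\right)\zeta(3)^{\tilde\kappa}}{\tilde\kappa\sqrt{2\pi\widetilde{\mathcal{L}}''(\tilde\kappa)}\,(e^\gamma\tau^2)^{\tilde\kappa}}\left(1+O\left(\sqrt{\frac{\log\tilde\kappa}{\tilde\kappa}}\right)\right),$$ where $\kappa=\kappa(\tau)$ is the unique real solution of $\mathcal{L}'(\kappa)=2(\log\tau+\gamma)$ and $\tilde\kappa=\tilde\kappa(\tau)$ is the unique real solution of $\widetilde{\mathcal{L}}'(\tilde\kappa)=2\log\tau+\gamma-\log\zeta(3)$.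
   Context: The $\mathbb{X}(p)$ ($p$ prime) are independent random variables: for $p\equiv2\pmod3$ or $p=3$, uniform on $\{1,\omega_3,\omega_3^2\}$; for $p\equiv1\pmod3$, equal to $0$ with probability $\frac{2}{p+2}$ and to each of $1,\omega_3,\omega_3^2$ with probability $\frac{p}{3(p+2)}$ ($\omega_3=e^{2\pi i/3}$). $L(1,\mathbb{X})=\prod_p(1-\mathbb{X}(p)/p)^{-1}$. $\Phi(\tau)=\mathbb{P}(|L(1,\mathbb{X})|>e^\gamma\tau)$, $\Psi(\tau)=\mathbb{P}(|L(1,\mathbb{X})|<(\zeta(3)/e^\gamma)^{1/2}\tau^{-1})$. For real $r>0$, $\mathcal{L}(r)=\log\mathbb{E}(|L(1,\mathbb{X})|^{2r})$ and $\widetilde{\mathcal{L}}(r)=\log\mathbb{E}(|L(1,\mathbb{X})|^{-2r})$; derivatives are in $r$. $\gamma$ is Euler's constant. *)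

(* Defs.v *)
From HB Require Import structures.
From mathcomp Require Import all_boot all_order all_algebra.
From mathcomp Require Import all_classical all_reals all_analysis.
From mathcomp Require Import complex.
Set Implicit Arguments. Unset Strict Implicit. Unset Printing Implicit Defensive.
Import Order.TTheory GRing.Theory Num.Theory.
Import numFieldNormedType.Exports.
Local Open Scope ring_scope.
Local Open Scope classical_set_scope.
Local Open Scope complex_scope.

Section Defs.
Variable R : realType.

Definition cabs (z : R[i]) : R := Num.sqrt (complex.Re z ^+ 2 + complex.Im z ^+ 2).

Definition omega3 : R[i] := Complex (cos (2 * pi / 3)) (sin (2 * pi / 3)).

Definition euler_gamma : R :=
  limn (fun n : nat => \sum_(1 <= k < n.+1) (k%:R : R)^-1 - ln (n%:R)).

Definition zeta3 : R := limn (fun n : nat => \sum_(1 <= k < n.+1) ((k%:R : R) ^+ 3)^-1).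

Variables (d : measure_display) (T : measurableType d) (P : probability T R).
Variable X : nat -> T -> R[i].

Definition model_law : Prop :=
  forall p : nat, prime p ->
    (forall z : R[i], measurable (X p @^-1` [set z])) /\
    if (p == 3)%N || (p %% 3 == 2)%N then
      (forall w, X p w \in [:: 1; omega3; omega3 ^+ 2]) /\
      (forall k : nat, (k < 3)%N -> P (X p @^-1` [set omega3 ^+ k]) = (3%:R^-1 : R)%:E)
    else
      (forall w, X p w \in [:: 0; 1; omega3; omega3 ^+ 2]) /\
      P (X p @^-1` [set 0]) = ((2%:R / (p%:R + 2%:R)) : R)%:E /\
      (forall k : nat, (k < 3)%N ->
         P (X p @^-1` [set omega3 ^+ k]) = ((p%:R / (3%:R * (p%:R + 2%:R))) : R)%:E).

Definition model_indep : Prop :=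
  forall (s : seq nat) (z : nat -> R[i]), uniq s -> all prime s ->
    P (\bigcap_(p in [set p | p \in s]) (X p @^-1` [set z p]))
    = (\prod_(p <- s) P (X p @^-1` [set z p]))%E.

Definition Lpart (N : nat) (w : T) : R[i] :=
  \prod_(p < N | prime p) (1 - X p w / (p%:R)%:C)^-1.

Definition absL (w : T) : R := limn (fun N => cabs (Lpart N w)).

Definition Phi (tau : R) : R :=
  fine (P [set w | expR euler_gamma * tau < absL w]).

Definition Psi (tau : R) : R :=
  fine (P [set w | absL w < Num.sqrt (zeta3 / expR euler_gamma) * tau^-1]).

Definition moment (r : R) : R := fine (\int[P]_w ((absL w) `^ (2 * r))%:E)%E.

Definition calL (r : R) : R := ln (moment r).
Definition calLt (r : R) : R := ln (moment (- r)).

End Defs.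

(* Main.v *)
(** The random variable Y = 2 log |L(1,X)| is a sum of independent three-valued terms, one
    for each prime, and so is -Y; both parts of the theorem are the same saddle-point estimate
    for P(Y > m) with m = L'(k), where L(k) = log E e^{kY}.

    Tilt the law of the truncated sum Y_N by e^{ky}.  The tilted variance s is of order
    1/(k log k) by Chebyshev's estimates for primes, and the tilted characteristic function is
    compared with that of a Gaussian: the primes near max(k,u) make it decay like
    exp(-c u^2/(k log k)) for u <= k, and like exp(-c u/log u) beyond.  Smoothing with a
    Poisson kernel of width a gives the tilted mass of an interval [x1,x2] near m as
    (x2 - x1)/sqrt(2 pi s), up to (x2 - x1) O(log k); then N -> oo and a -> 0.  Cutting
    (m, oo) into intervals of length sqrt(log k/k)/k and summing e^{-kx} over them gives
    P(Y > m) with relative error O(sqrt(log k/k)).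

    Y_N converges almost surely along N = n^4 by an L^1 bound from exponential moments, and
    varies by O(1/n) between consecutive fourth powers; bounded second moments of e^{kY_N}
    then identify E e^{kY} with the limit of E e^{kY_N}. *)
Require Import Defs.
From HB Require Import structures.
From mathcomp Require Import all_boot all_order all_algebra.
From mathcomp Require Import all_classical all_reals all_analysis.
From mathcomp Require Import complex measurable_realfun ring lra zify.
Import Order.TTheory GRing.Theory Num.Theory.
Import numFieldNormedType.Exports.
Local Open Scope ring_scope.
Local Open Scope classical_set_scope.
Set Implicit Arguments.
Unset Strict Implicit.
Unset Printing Implicit Defensive.

(** * Sums over primes *)

(** The main term 1/sqrt(2 pi s) is at least of order sqrt(k log k), so an error O(log k) beside it
    is a relative error O(sqrt(log k/k)): the exponent in the theorem is this quotient. Primes p >=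
    16 max(k,u) are used for the decay because the tilt e^{ky} changes their weights only by bounded
    factors, while u times the gap between two values is still in the range where 1 - cos is
    quadratic. Primes p < k behave differently: tilting concentrates their law within O(1/k) of its
    largest value. The two regimes together give the weight 1/max(p,k)^2 seen throughout. Truncation
    at N removes the useful primes once u exceeds about N/(16K). Beyond that only the factor e^{-au}
    of the Poisson kernel helps, which forces the order of the limits: N -> oo at fixed a, and a ->
    0 afterwards. The Poisson kernel is convenient because its cosine transform and its primitive,
    an arctangent, are both elementary, and because the truncated law has finitely many atoms:
    inversion is then a finite sum of explicit integrals. *)

Definition psum {V : nmodType} (N : nat) (f : nat -> V) : V :=
  \sum_(0 <= p < N | prime p) f p.

Section Psum.
Variable R : realType.
Implicit Types (f g : nat -> R) (N M : nat).

Lemma psum0 f : psum 0 f = 0.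
Proof. by rewrite /psum big_geq. Qed.

Lemma psumS N f : psum N.+1 f = psum N f + (if prime N then f N else 0).
Proof. by rewrite /psum !(big_mkcond prime) big_nat_recr. Qed.

Lemma ler_psum N f g : (forall p, prime p -> f p <= g p) -> psum N f <= psum N g.
Proof. by move=> h; apply: ler_sum => p; exact: h. Qed.

Lemma eq_psum N f g : (forall p, prime p -> f p = g p) -> psum N f = psum N g.
Proof. by move=> h; apply: eq_bigr => p; exact: h. Qed.

Lemma psum_ge0 N f : (forall p, prime p -> 0 <= f p) -> 0 <= psum N f.
Proof. by move=> h; apply: sumr_ge0 => p; exact: h. Qed.

Lemma psumZ N (c : R) f : psum N (fun p => c * f p) = c * psum N f.
Proof. by rewrite /psum mulr_sumr. Qed.

Lemma psumD N f g : psum N (fun p => f p + g p) = psum N f + psum N g.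
Proof. by rewrite /psum big_split. Qed.

Lemma psumB N f g : psum N (fun p => f p - g p) = psum N f - psum N g.
Proof. by rewrite /psum sumrB. Qed.

Lemma ler_norm_psum N f : `|psum N f| <= psum N (fun p => `|f p|).
Proof. exact: ler_norm_sum. Qed.

Lemma psum_le N M f : (N <= M)%N -> (forall p, prime p -> 0 <= f p) ->
  psum N f <= psum M f.
Proof.
move=> NM h; rewrite -(subnK NM); elim: (M - N)%N => [//|k IH].
rewrite addSn psumS; apply: (le_trans IH); rewrite lerDl.
by case: ifP => // /h.
Qed.

Lemma psum_diff N M f : (N <= M)%N ->
  psum M f - psum N f = psum M (fun p => if (N <= p)%N then f p else 0).
Proof.
move=> NM; rewrite -(subnK NM); elim: (M - N)%N => [|k IH].
  rewrite add0n subrr /psum big_nat_cond big1 // => p /andP[/andP[_ pN] _].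
  by rewrite leqNgt pN.
by rewrite addSn !psumS -IH leq_addl; ring.
Qed.

Lemma psum_le_sum N f : (forall n, 0 <= f n) -> psum N f <= \sum_(0 <= n < N) f n.
Proof.
move=> h; elim: N => [|N IH]; first by rewrite psum0 big_geq.
by rewrite psumS big_nat_recr //= lerD //; case: ifP.
Qed.

End Psum.

Lemma prime_prod_dvd (N m : nat) (Q : pred nat) :
  (forall p, prime p -> Q p -> p %| m)%N ->
  (\prod_(0 <= p < N | prime p && Q p) p %| m)%N.
Proof.
move=> h; elim: N => [|N IH]; first by rewrite big_geq.
rewrite big_mkcond big_nat_recr //= -big_mkcond.
case: ifP => [/andP[pN QN]|_]; last by rewrite muln1.
rewrite Gauss_dvd; first by rewrite IH h.
rewrite big_nat_cond.
apply: (big_ind (fun x => coprime x N)); first exact: coprime1n.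
  by move=> x y hx hy; rewrite coprimeMl hx.
move=> p /andP[/andP[_ ltpN] /andP[pp _]].
by rewrite prime_coprime // dvdn_prime2 // neq_ltn ltpN.
Qed.

Lemma central_bin_le n : ('C(n.*2, n) <= 4 ^ n)%N.
Proof.
have -> : (4 ^ n = (1 + 1) ^ n.*2)%N by rewrite -mul2n expnM.
rewrite expnDn.
have hn : (n < (n.*2).+1)%N by rewrite ltnS -addnn leq_addr.
by rewrite (bigD1 (Ordinal hn)) //= !exp1n !muln1 leq_addr.
Qed.

(** By Pascal's rule and symmetry, the coefficient for n + 1 is twice ['C(n.*2.+1, n)], which is at
    least ['C(n.*2, n)]. *)
Lemma central_bin_ge n : (2 ^ n <= 'C(n.*2, n))%N.
Proof.
elim: n => [//|n IH]; rewrite expnS doubleS binS.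
have e : ('C(n.*2.+1, n.+1) = 'C(n.*2.+1, n))%N.
  by rewrite -[in RHS](@bin_sub n.*2.+1 n); [congr binomial|]; lia.
rewrite e addnn -muln2 mulnC leq_mul2r /=; apply: (leq_trans IH).
exact: leq_bin2l.
Qed.

(** By Legendre's formula the exponent of p is the sum over k of floor(2n/p^k) - 2 floor(n/p^k).
    Each term is 0 or 1, and it is 0 once p^k > 2n, so at most log_p(2n) terms count. *)
Lemma logn_central_bin p n : prime p -> (0 < n)%N ->
  (p ^ logn p 'C(n.*2, n) <= n.*2)%N.
Proof.
move=> pp n0.
have p1 := prime_gt1 pp.
have n20 : (0 < n.*2)%N by rewrite double_gt0.
apply: leq_trans (trunc_logP p1 n20).
rewrite leq_exp2l //.
have := bin_fact (_ : n <= n.*2)%N.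
rewrite -{1 3}addnn leq_addr => /(_ isT); rewrite -addnn addnK addnn.
move/(congr1 (logn p)); rewrite !lognM ?fact_gt0 ?muln_gt0 ?fact_gt0 ?bin_gt0 -?addnn ?leq_addr //.
rewrite !logn_fact // addnn.
have -> : (\sum_(1 <= k < n.+1) n %/ p ^ k = \sum_(1 <= k < n.*2.+1) n %/ p ^ k)%N.
  rewrite [RHS](@big_cat_nat _ _ _ n.+1) //=; last by rewrite ltnS -addnn leq_addr.
  rewrite [X in (_ + X)%N]big_nat_cond [X in (_ + X)%N]big1 ?addn0 //.
  move=> k /andP[/andP[nk _] _]; rewrite divn_small //.
  by apply: leq_trans nk _; apply: ltnW; apply: ltn_expl.
set A := (\sum_(_ <= k < _) n %/ _)%N; set B := (\sum_(_ <= k < _) n.*2 %/ _)%N.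
move=> e.
suff : (B <= trunc_log p n.*2 + (A + A))%N by rewrite -e leq_add2r.
(* The logarithm is written as a sum of indicators so that the two sides can be compared term by
   term. *)
have -> : trunc_log p n.*2 = (\sum_(1 <= k < n.*2.+1) (k <= trunc_log p n.*2))%N.
  rewrite (@big_cat_nat _ _ _ (trunc_log p n.*2).+1) //=; last first.
    rewrite ltnS; apply: ltnW; apply: leq_trans (trunc_logP p1 n20).
    exact: ltn_expl.
  rewrite [X in (_ + X)%N]big_nat_cond [X in (_ + X)%N]big1 ?addn0; last first.
    by move=> k /andP[/andP[nk _] _]; rewrite leqNgt nk.
  rewrite big_nat_cond (eq_bigr (fun=> 1%N)); last first.
    by move=> k /andP[/andP[_ nk] _]; rewrite -ltnS nk.
  by rewrite -big_nat_cond sum_nat_const_nat muln1 subSS subn0.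
rewrite /A /B -!big_split /=; rewrite leq_sum // => k _.
have pk0 : (0 < p ^ k)%N by rewrite expn_gt0 prime_gt0.
case: (leqP k (trunc_log p n.*2)) => hk /=.
  rewrite -ltnS ltn_divLR //.
  have := ltn_ceil n pk0; move: (n %/ p ^ k)%N (p ^ k)%N pk0 => a b b0 h.
  nia.
rewrite divn_small //; apply: leq_trans (trunc_log_ltn n.*2 p1) _.
by rewrite leq_exp2l.
Qed.

(** * Chebyshev's estimates for primes *)

Section Chebyshev.
Variable R : realType.

Definition theta (N : nat) : R := psum N (fun p => ln p%:R).

Lemma ln_prime_ge0 p : prime p -> 0 <= ln (p%:R : R).
Proof. by move=> /prime_gt0 p0; apply: ln_ge0; rewrite ler1n. Qed.

(** Every prime in (n, 2n] divides the central binomial coefficient, which is at most 4^n. *)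
Lemma theta_double n : theta n.*2.+1 <= theta n.+1 + n%:R * ln 4.
Proof.
have nn : (n <= n.*2)%N by rewrite -addnn leq_addr.
rewrite -lerBlDl /theta psum_diff; last by rewrite ltnS.
pose Q p := (n < p <= n.*2)%N.
have dvd : (\prod_(0 <= p < n.*2.+1 | prime p && Q p) p %| 'C(n.*2, n))%N.
  apply: prime_prod_dvd => p pp /andP[np p2].
  have : (p %| n.*2`!)%N by rewrite dvdn_fact // prime_gt0.
  rewrite -(bin_fact nn) !Euclid_dvdM //.
  have h : (p %| n`!)%N = false.
    apply/negP; rewrite fact_prod => h.
    suff : coprime p (\prod_(1 <= i < n.+1) i) by rewrite prime_coprime // h.
    rewrite big_nat_cond; apply: (big_ind (fun x => coprime p x)); first exact: coprimen1.
      by move=> x y hx hy; rewrite coprimeMr hx.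
    move=> i /andP[/andP[i1 i2] _]; rewrite prime_coprime // gtnNdvd //.
    by apply: leq_ltn_trans np; rewrite -ltnS.
  by rewrite (_ : n.*2 - n = n)%N ?h ?orbF // -addnn addnK.
have c0 : (0 < 'C(n.*2, n))%N by rewrite bin_gt0.
have := leq_trans (dvdn_leq c0 dvd) (central_bin_le n).
have pr0 N : (0 < \prod_(0 <= p < N | prime p && Q p) p)%N.
  by apply: prodn_cond_gt0 => p /andP[/prime_gt0].
have -> : psum n.*2.+1 (fun p : nat => if (n < p)%N then ln (p%:R : R) else 0) =
    ln (\prod_(0 <= p < n.*2.+1 | prime p && Q p) p)%:R.
  have : forall N, (N <= n.*2.+1)%N -> psum N (fun p : nat => if (n < p)%N then ln (p%:R : R) else 0) =
    ln (\prod_(0 <= p < N | prime p && Q p) p)%:R.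
    elim=> [|N IH] hN; first by rewrite psum0 big_geq // ln1.
    rewrite psumS IH ?(ltnW hN) // [in RHS]big_mkcond big_nat_recr //= -big_mkcond /=.
    rewrite /Q; case: (boolP (prime N)) => pN /=; last by rewrite muln1 addr0.
    have -> : (N <= n.*2)%N by rewrite -ltnS.
    rewrite andbT; case: ifP => nN; last by rewrite muln1 addr0.
    rewrite natrM lnM // posrE ltr0n; [exact: pr0|exact: prime_gt0].
  by apply.
rewrite -(ler_nat R) natrX => h.
have -> : n%:R * ln 4 = ln (4%:R ^+ n) :> R by rewrite lnXn ?ltr0n // mulr_natl.
by rewrite ler_ln ?posrE ?ltr0n ?exprn_gt0 ?ltr0n.
Qed.

(** Doubling gives 3 * 2^k at the powers of two, with the crude [ln 4 <= 3]; rounding up to the next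
    power of two costs the remaining factor 2. *)
Lemma theta_le N : theta N <= 6 * N%:R.
Proof.
have ln4 : ln 4 <= 3 :> R.
  by have := @le_ln1Dx R 3; rewrite (_ : 1 + 3 = 4); [apply; lra|lra].
have pow2 k : theta (2 ^ k).+1 <= (2 ^ k)%:R * 3.
  elim: k => [|k IH].
    rewrite /theta !psumS psum0 /=; lra.
  rewrite expnS mul2n; apply: (le_trans (theta_double _)).
  rewrite -muln2 natrM.
  have h : (2 ^ k)%:R * ln 4 <= (2 ^ k)%:R * 3 :> R by rewrite ler_wpM2l // ler0n.
  lra.
case: N => [|N]; first by rewrite /theta psum0; lra.
case: N => [|N]; first by rewrite /theta psumS psum0 /=; lra.
have h2 : (N.+1 <= 2 ^ (trunc_log 2 N.+1).+1)%N by rewrite ltnW // trunc_log_ltn.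
have h3 : (2 ^ (trunc_log 2 N.+1).+1 <= 2 * N.+1)%N.
  by rewrite expnS leq_mul2l /= trunc_logP.
have h4 : theta N.+2 <= theta (2 ^ (trunc_log 2 N.+1).+1).+1.
  by apply: psum_le => //; exact: ln_prime_ge0.
apply: (le_trans h4); apply: (le_trans (pow2 _)).
have : (2 ^ (trunc_log 2 N.+1).+1)%:R <= (2 * N.+1)%:R :> R by rewrite ler_nat.
rewrite natrM -(natr1 N.+1); have := ler0n R N.+1; lra.
Qed.

Lemma abel_sum_le (K : R) (g f : nat -> R) N :
  (forall n, \sum_(0 <= i < n) g i <= K * n%:R) ->
  (forall n, 0 <= f n) -> (forall n, f n.+1 <= f n) ->
  \sum_(0 <= i < N) g i * f i <= K * \sum_(0 <= i < N) f i.
Proof.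
move=> hG f0 fd.
(* Abel summation: the boundary term is nonnegative by the bound on the partial sums of g, and
   keeping it makes the induction close. *)
suff : \sum_(0 <= i < N) g i * f i + (K * N%:R - \sum_(0 <= i < N) g i) * f N
    <= K * \sum_(0 <= i < N) f i.
  apply: le_trans; rewrite lerDl mulr_ge0 //.
  by have := hG N; lra.
elim: N => [|N IH]; first by rewrite !big_geq // subr0 !mulr0 mul0r addr0.
have := hG N.+1; rewrite !big_nat_recr //= -natr1.
move: IH; set A := \sum_(0 <= i < N) _; set G := \sum_(0 <= i < N) _;
  set F := \sum_(0 <= i < N) _ => IH h.
have := fd N; have := f0 N => fN fN1.
have : (K * (N%:R + 1) - (G + g N)) * f N.+1 <= (K * (N%:R + 1) - (G + g N)) * f N.
  by apply: ler_wpM2l => //; lra.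
lra.
Qed.

Lemma sum_inv_sqr_shift (y : R) N : 1 < y ->
  \sum_(0 <= n < N) ((y + n%:R) ^+ 2)^-1 <= (y - 1)^-1.
Proof.
move=> y1.
suff : \sum_(0 <= n < N) ((y + n%:R) ^+ 2)^-1 <= (y - 1)^-1 - (y + N%:R - 1)^-1.
  move=> h; apply: (le_trans h); rewrite gerBl invr_ge0.
  have := ler0n R N; lra.
elim: N => [|N IH]; first by rewrite big_geq // addr0 subrr.
rewrite big_nat_recr //= -natr1.
move: IH; set A := \sum_(_ <= _ < _) _ => IH.
have N0 := ler0n R N.
suff : ((y + N%:R) ^+ 2)^-1 <= (y + N%:R - 1)^-1 - (y + (N%:R + 1) - 1)^-1 by lra.
have -> : (y + N%:R - 1)^-1 - (y + (N%:R + 1) - 1)^-1 = ((y + N%:R - 1) * (y + N%:R))^-1.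
  by field; apply/andP; split; lra.
by rewrite lef_pV2 ?posrE; nra.
Qed.

Lemma invr_le_div (a b c : R) : 0 < a -> 0 < b -> b <= c * a -> a^-1 <= c / b.
Proof. by move=> a0 b0 h; rewrite ler_pdivlMr // mulrC ler_pdivrMr. Qed.

Lemma ln_le_2sqrt (x : R) : 0 < x -> ln x <= 2 * Num.sqrt x.
Proof.
move=> x0; rewrite -[X in ln X](sqr_sqrtr (ltW x0)) lnXn ?sqrtr_gt0 //.
rewrite mulr2n mulrDl mul1r.
suff h' : ln (Num.sqrt x) <= Num.sqrt x by apply: lerD.
have := @le_ln1Dx R (Num.sqrt x - 1).
have h := sqrtr_gt0 x; rewrite x0 in h.
rewrite (_ : 1 + (Num.sqrt x - 1) = Num.sqrt x); last by ring.
by move=> /(_ _) H; apply: (le_trans (H _)); lra.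
Qed.

(** Split at y = sqrt x. The integers up to y contribute only O(x^(-3/2)). A prime p > y has ln p >=
    (ln x)/2, so that 1 may be replaced by 2 ln p / ln x and the bound for [theta] applies by Abel
    summation. The constant is 112 = 16 + 96. *)
Lemma prime_sum_max_sqr (x : R) N : 4 <= x ->
  psum N (fun p => (Num.max p%:R x ^+ 2)^-1) <= 112 / (x * ln x).
Proof.
move=> x4.
have lx : 0 < ln x by rewrite ln_gt0 //; lra.
pose y := Num.sqrt x.
have y2 : 2 <= y.
  rewrite /y -(@ler_sqr R) ?nnegrE ?sqrtr_ge0 // sqr_sqrtr; lra.
have yy : y ^+ 2 = x by rewrite /y sqr_sqrtr //; lra.
have lny : ln x = 2 * ln y by rewrite -yy lnXn; [rewrite mulr_natl|lra].
pose f (n : nat) : R := (Num.max n%:R x ^+ 2)^-1.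
have m0 (n : nat) : 0 < Num.max n%:R x by rewrite lt_max (_ : 0 < x) ?orbT //; lra.
have f0 n : 0 <= f n by rewrite /f invr_ge0 exprn_ge0 // ltW.
have fd n : f n.+1 <= f n.
  rewrite /f lef_pV2 ?posrE ?exprn_gt0 // ler_sqr ?nnegrE; [|exact: ltW..].
  by rewrite ge_max !le_max ler_nat leqnSn lexx orbT.
pose g (n : nat) : R := if prime n then ln n%:R else 0.
have hg n : \sum_(0 <= i < n) g i <= 6 * n%:R.
  by rewrite /g -big_mkcond; exact: theta_le.
have A := @abel_sum_le 6 g f N hg f0 fd.
have F : \sum_(0 <= i < N) f i <= 8 / x.
  have : \sum_(0 <= i < N) f i <= \sum_(0 <= i < N) 4 * ((x + i%:R) ^+ 2)^-1.
    apply: ler_sum => n _; rewrite /f.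
    have n0 := ler0n R n.
    apply: invr_le_div; [by rewrite exprn_gt0|by rewrite exprn_gt0//; lra|].
    have h1 : x <= Num.max n%:R x by rewrite le_max lexx orbT.
    have h2 : n%:R <= Num.max n%:R x by rewrite le_max lexx.
    have := m0 n; move: (Num.max _ _) h1 h2 => M h1 h2 h3; nra.
  rewrite -mulr_sumr => /le_trans; apply.
  have := @sum_inv_sqr_shift x N; move=> /(_ _) h.
  have {}h := h ltac:(lra).
  have : (x - 1)^-1 <= 2 / x.
    by apply: invr_le_div; lra.
  lra.
(* Here [x / y ^+ 4] is 1/x, and 4/(y + i)^2 >= 1/x for i <= y. The summand thus majorizes 1/x^2 on
   the short range and remains summable over all i. *)
have S : \sum_(0 <= i < N) (x / y ^+ 4) * (4 * ((y + i%:R) ^+ 2)^-1)  <= 16 / (x * ln x).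
  rewrite -!mulr_sumr.
  have h := @sum_inv_sqr_shift y N ltac:(lra).
  have h1 : (y - 1)^-1 <= 2 / y by apply: invr_le_div; lra.
  have h2 : y^-1 <= 2 / ln x.
    apply: invr_le_div; [lra..|].
    have := @ln_le_2sqrt x ltac:(lra); rewrite -/y; lra.
  have -> : x / y ^+ 4 = x^-1 by rewrite -yy; field; lra.
  have -> : 16 / (x * ln x) = x^-1 * (4 * (2 * (2 / ln x))).
    by field; apply/andP; split; lra.
  apply: ler_wpM2l; first by rewrite invr_ge0; lra.
  by apply: ler_wpM2l; lra.
have : psum N f <= \sum_(0 <= i < N) (x / y ^+ 4) * (4 * ((y + i%:R) ^+ 2)^-1)
    + (2 / ln x) * \sum_(0 <= i < N) g i * f i.
  rewrite /psum big_mkcond mulr_sumr -big_split /=; apply: ler_sum => p _.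
  have p0 := ler0n R p.
  have t1 : 0 <= x / y ^+ 4 * (4 / (y + p%:R) ^+ 2).
    by rewrite !mulr_ge0 ?invr_ge0 ?exprn_ge0; lra.
  have t2 : 0 <= 2 / ln x * (g p * f p).
    apply: mulr_ge0; first by apply: divr_ge0 => //; exact: ltW.
    by apply: mulr_ge0 => //; rewrite /g; case: ifP => // ?; exact: ln_prime_ge0.
  case: ifP => pp; last by rewrite addr_ge0.
  have [py|yp] := leP p%:R y.
    rewrite -[X in X <= _]addr0; apply: lerD => //.
    rewrite /f (_ : Num.max p%:R x = x); last by apply/max_idPr; nra.
    have -> : x / y ^+ 4 = x^-1 by rewrite -yy; field; lra.
    rewrite expr2 invfM; apply: ler_wpM2l; first by rewrite invr_ge0; lra.
    apply: invr_le_div; [lra|by rewrite exprn_gt0//; lra|].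
    nra.
  rewrite -[X in X <= _]add0r; apply: lerD => //.
  rewrite /g pp mulrA -[X in X <= _]mul1r; apply: ler_wpM2r => //.
  rewrite mulrAC ler_pdivlMr // mul1r lny ler_pM2l //.
  by rewrite ler_ln ?posrE ?ltW //; lra.
move/le_trans; apply.
have : 2 / ln x * \sum_(0 <= i < N) g i * f i <= 2 / ln x * (6 * (8 / x)).
  apply: ler_wpM2l; first by rewrite divr_ge0 // ltW.
  by apply: (le_trans A); lra.
have -> : 2 / ln x * (6 * (8 / x)) = 96 / (x * ln x).
  by field; apply/andP; split; lra.
lra.
Qed.

(** The coefficient [C], at least 2^n, is a product of prime powers, each at most 2n; taking
    logarithms bounds the number of primes up to 2n from below. *)
Lemma prime_count_ge n : (0 < n)%N ->
  n%:R * ln 2 <= psum n.*2.+1 (fun=> 1) * ln (n.*2%:R : R).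
Proof.
move=> n0; set C := 'C(n.*2, n).
have nn : (n <= n.*2)%N by rewrite -addnn leq_addr.
have c0 : (0 < C)%N by rewrite bin_gt0.
(* The cut-off at 2n lets the product run over all primes up to [C], as its factorization does:
   primes above 2n have exponent 0. *)
pose h (p : nat) : R := if (p <= n.*2)%N then 1 else 0.
have h01 p : 0 <= h p <= 1 by rewrite /h; case: ifP => _; rewrite ler01 lexx.
have n20 : (0 < n.*2)%N by rewrite double_gt0.
have ln2n : 0 <= ln (n.*2%:R : R) by rewrite ln_ge0 // ler1n.
have pg0 N : (0 < \prod_(0 <= p < N) p ^ logn p C)%N.
  rewrite big_nat_cond; apply: prodn_cond_gt0 => p _.
  by case: p => [|p]; rewrite ?logn0 // expn_gt0.
have lnprod N : ln (\prod_(0 <= p < N) p ^ logn p C)%:R <= psum N h * ln (n.*2%:R : R).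
  elim: N => [|N IH]; first by rewrite big_geq // ln1 psum0 mul0r.
  have pN0 : (0 < N ^ logn N C)%N by case: (N) => [|p]; rewrite ?logn0 // expn_gt0.
  rewrite big_nat_recr //= natrM lnM ?posrE ?ltr0n // psumS mulrDl lerD //.
  case: ifP => pN; last by rewrite lognE pN /= expn0 ln1 mul0r.
  have le2 := logn_central_bin pN n0; rewrite -/C in le2.
  rewrite /h; case: ifP => hN.
    by rewrite mul1r ler_ln ?posrE ?ltr0n // ler_nat.
  have -> : logn N C = 0%N.
    case: (logn N C) le2 => // k; rewrite expnS => le2.
    suff : (N <= n.*2)%N by rewrite hN.
    apply: leq_trans le2; rewrite leq_pmulr // expn_gt0 prime_gt0 //.
  by rewrite expn0 ln1 mul0r.
have := lnprod C.+1.
have := @widen_partn C predT C (leqnn _); rewrite partnT // => <- hC.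
have h2 : n%:R * ln 2 <= ln (C%:R : R).
  rewrite mulr_natl -lnXn ?ltr0n // ler_ln ?posrE ?ltr0n ?exprn_gt0 //.
  by rewrite -natrX ler_nat central_bin_ge.
apply: (le_trans h2); apply: (le_trans hC); apply: ler_wpM2r => //.
apply: (@le_trans _ _ (psum (maxn C.+1 n.*2.+1) h)).
  by apply: psum_le; [exact: leq_maxl|move=> p _; case/andP: (h01 p)].
rewrite -[X in X <= _](subrK (psum n.*2.+1 h)) psum_diff ?leq_maxr //.
rewrite [X in X + _](_ : _ = 0) ?add0r.
  by apply: ler_psum => p _; case/andP: (h01 p).
rewrite /psum big1 // => p _; case: ifP => // hp.
by rewrite /h leqNgt hp.
Qed.

(** The lower bound for the number of primes up to Kx beats the upper bound for the number up to x,
    so at least 88 x/ln x primes lie in (x, Kx], and each of them contributes at least 1/(Kx)^2. *)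
Lemma prime_window : exists K c : R, [/\ 4 <= K, 0 < c &
  forall (x : R) (N : nat), K <= x -> K * x < N%:R ->
   c / (x * ln x) <=
   psum N (fun p => if (x < p%:R) && (p%:R <= K * x) then (p%:R ^+ 2)^-1 else 0)].
Proof.
(* The count up to Kx is at least (K/8) x / (2 ln x) = 200 x/ln x. It has to exceed 112 x/ln x, the
   bound for the primes up to x; the difference is the 88. *)
have [K hK] : exists K : R, K = 40 * 80 by eexists.
exists K, (88 / K ^+ 2); split; [lra|by rewrite divr_gt0 ?exprn_gt0//; lra|].
move=> x N Kx KxN.
have lx : 0 < ln x by rewrite ln_gt0 //; lra.
have x0 : 0 < x by lra.
have ln2 : 1 / 2 <= ln 2 :> R.
  have := @le_ln1Dx R (- (1 / 2)); rewrite (_ : 1 + - (1 / 2) = 2^-1); last by field.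
  rewrite lnV ?posrE //; move=> /(_ _) h; have {}h := h ltac:(lra); lra.
pose n := Num.truncn (K * x / 2).
have Kx0 : 0 <= K * x / 2 by nra.
have [n1 n2] := andP (truncn_itv Kx0); rewrite -/n -(natr1 n) in n1 n2.
have nn : n%:R >= K * x / 4 by nra.
have n0 : (0 < n)%N by rewrite -(ltr0n R); nra.
have n2E : n.*2%:R = 2 * n%:R :> R by rewrite -mul2n natrM.
have hpi := prime_count_ge n0.
set M := n.*2.+1 in hpi *.
have MN : (M <= N)%N by rewrite /M -(ltr_nat R) n2E; apply: le_lt_trans KxN; lra.
have lnn : ln (n.*2%:R : R) <= 2 * ln x.
  have -> : 2 * ln x = ln (x ^+ 2) by rewrite lnXn // mulr_natl.
  rewrite ler_ln ?posrE ?exprn_gt0 // n2E; nra.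
(* For p <= x the quotient x^2/max(p,x)^2 is 1, so the sum bounded in [prime_sum_max_sqr] counts
   these primes. *)
have split1 : psum M (fun=> 1) <= x ^+ 2 * psum M (fun p => (Num.max p%:R x ^+ 2)^-1)
   + psum M (fun p => if (x < p%:R) && (p%:R <= K * x) then 1 else 0).
  rewrite -psumZ -psumD /psum big_nat_cond [X in _ <= X]big_nat_cond.
  apply: ler_sum => p /andP[/andP[_ pM] pp].
  have pK : p%:R <= K * x.
    rewrite ltnS -(ler_nat R) n2E in pM; lra.
  rewrite pK andbT; case: (ltP x p%:R) => xp.
    rewrite lerDr mulr_ge0 ?invr_ge0 ?exprn_ge0 //; lra.
  by rewrite addr0 divff // expf_neq0 // gt_eqF.
have h112 : x ^+ 2 * psum M (fun p => (Num.max p%:R x ^+ 2)^-1) <= 112 * (x / ln x).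
  have -> : 112 * (x / ln x) = x ^+ 2 * (112 / (x * ln x)).
    by field; rewrite !gt_eqF.
  by apply: ler_wpM2l; [rewrite exprn_ge0 // ltW|apply: prime_sum_max_sqr; lra].
have h200 : 200 * (x / ln x) <= psum M (fun=> 1).
  have h1 : n%:R * ln 2 <= psum M (fun=> 1) * (2 * ln x).
    by apply: (le_trans hpi); apply: ler_wpM2l => //; apply: psum_ge0.
  have h2 : K * x / 8 <= n%:R * ln 2 by have := ler0n R n; nra.
  have : 400 * x <= psum M (fun=> 1) * (2 * ln x) by apply: le_trans h1; apply: le_trans h2; rewrite hK; lra.
  by move=> h3; rewrite mulrA ler_pdivrMr //; lra.
have h88 : 88 * (x / ln x) <= psum M (fun p => if (x < p%:R) && (p%:R <= K * x) then 1 else 0) by lra.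
have t0 p : 0 <= (if (x < p%:R) && (p%:R <= K * x) then (p%:R ^+ 2)^-1 else 0 : R).
  by case: ifP => // _; rewrite invr_ge0 exprn_ge0.
apply: (@le_trans _ _ (psum M (fun p => if (x < p%:R) && (p%:R <= K * x) then (p%:R ^+ 2)^-1 else 0 : R))); last first.
  by apply: psum_le => // p _; exact: t0.
have -> : 88 / K ^+ 2 / (x * ln x) = ((K * x) ^+ 2)^-1 * (88 * (x / ln x)).
  by field; rewrite !gt_eqF //; lra.
apply: (@le_trans _ _ (psum M (fun p => ((K * x) ^+ 2)^-1 * (if (x < p%:R) && (p%:R <= K * x) then 1 else 0)))).
  by rewrite psumZ ler_wpM2l // invr_ge0 exprn_ge0 // mulr_ge0; lra.
apply: ler_psum => p pp; case: ifP => [/andP[h1 h2]|_]; last by rewrite mulr0.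
have p0 : 0 < p%:R :> R by rewrite ltr0n prime_gt0.
rewrite mulr1 lef_pV2 ?posrE ?exprn_gt0 ?mulr_gt0 //; last lra.
by rewrite ler_sqr ?nnegrE //; nra.
Qed.

Lemma harmonic_unbounded (B : R) : exists n, B <= \sum_(0 <= k < n) (k.+1%:R)^-1.
Proof.
apply: contrapT => h; apply: (@dvg_harmonic R); apply: nondecreasing_is_cvgn.
  by apply/nondecreasing_seqP => n; rewrite /series /= big_nat_recr //= lerDl harmonic_ge0.
exists B => _ [n _ <-]; rewrite leNgt; apply/negP => hn; apply: h; exists n.
exact: ltW.
Qed.

(** The window (K^j, K^(j+1)] contributes at least c/(j ln K), and the harmonic series diverges. *)
Lemma prime_inv_sum_unbounded (B : R) : exists N, B <= psum N (fun p => (p%:R)^-1).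
Proof.
have [K [c [K4 c0 hw]]] := prime_window.
have lK : 0 < ln K by rewrite ln_gt0 //; lra.
pose N j := (Num.truncn (K ^+ j)).+1.
have Kj0 j : 0 <= K ^+ j by rewrite exprn_ge0 //; lra.
have key J : (c / ln K) * \sum_(0 <= k < J) (k.+1%:R)^-1 <= psum (N J.+1) (fun p => (p%:R)^-1).
  elim: J => [|J IH]; first by rewrite big_geq // mulr0 psum_ge0 // => p _; rewrite invr_ge0.
  rewrite big_nat_recr //= mulrDr.
  have KJ : K <= K ^+ J.+1.
    by rewrite exprS ler_peMr ?exprn_ege1 //; lra.
  have KN : K * K ^+ J.+1 < (N J.+2)%:R.
    by rewrite -exprS /N; case/andP: (truncn_itv (Kj0 J.+2)).
  have NN : (N J.+1 <= N J.+2)%N.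
    rewrite /N ltnS le_truncn // [in X in _ <= X]exprS ler_peMl //; lra.
  have := hw _ _ KJ KN; rewrite lnXn ?(lt_le_trans _ K4) // -(mulr_natr (ln K)) => h.
  rewrite -[X in _ <= X](subrK (psum (N J.+1) (fun p => (p%:R)^-1))) addrC.
  apply: lerD => //; rewrite psum_diff //.
  have KJ0 : 0 < K ^+ J.+1 by lra.
  have -> : c / ln K / J.+1%:R = K ^+ J.+1 * (c / (K ^+ J.+1 * (ln K * J.+1%:R))).
    by field; rewrite !gt_eqF //= ?ltr0n //; lra.
  apply: (@le_trans _ _ (K ^+ J.+1 * _)); first by apply: ler_wpM2l; [exact: ltW|exact: h].
  rewrite -psumZ; apply: ler_psum => p pp; case: ifP => [/andP[h1 _]|_]; last first.
    by rewrite mulr0; case: ifP; rewrite // invr_ge0.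
  have p0 : 0 < p%:R :> R by rewrite ltr0n prime_gt0.
  have -> : (N J.+1 <= p)%N.
    by rewrite /N truncn_lt_nat.
  rewrite expr2 invfM mulrA -[X in _ <= X]mul1r ler_wpM2r ?invr_ge0 ?ltW //.
  by rewrite ltr_pdivrMr // mul1r.
have [n hn] := harmonic_unbounded (B / (c / ln K)).
exists (N n.+1); apply: le_trans (key n).
by rewrite mulrC -ler_pdivrMr // divr_gt0.
Qed.

End Chebyshev.

(** * Calculus *)

Section RealCalculus.
Variable R : realType.
Implicit Types (f g : R -> R) (x a b c : R).

Lemma der_add f g x a b : is_derive x (1 : R) f a -> is_derive x (1 : R) g b ->
  is_derive x (1 : R) (fun y => f y + g y) (a + b).
Proof. by move=> hf hg; exact: is_deriveD. Qed.

Lemma der_mul f g x a b : is_derive x (1 : R) f a -> is_derive x (1 : R) g b ->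
  is_derive x (1 : R) (fun y => f y * g y) (a * g x + f x * b).
Proof.
move=> hf hg; have h := @is_deriveM R R f g x 1 a b hf hg.
by apply: is_derive_eq h _; rewrite /GRing.scale /= addrC [g x * a]mulrC.
Qed.

Lemma der_cst c x : is_derive x (1 : R) (fun=> c) 0.
Proof. exact: is_derive_cst. Qed.

Lemma der_id x : is_derive x (1 : R) (fun y => y) 1.
Proof. exact: is_derive_id. Qed.

Lemma der_scale c f x a : is_derive x (1 : R) f a ->
  is_derive x (1 : R) (fun y => c * f y) (c * a).
Proof.
move=> hf; have h := der_mul (der_cst c x) hf.
by apply: is_derive_eq h _; rewrite mul0r add0r.
Qed.

Lemma der_comp f g x a b : is_derive (g x) (1 : R) f a -> is_derive x (1 : R) g b ->
  is_derive x (1 : R) (fun y => f (g y)) (a * b).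
Proof. by move=> hf hg; exact: is_derive1_comp. Qed.

Lemma der_inv f x a : f x != 0 -> is_derive x (1 : R) f a ->
  is_derive x (1 : R) (fun y => (f y)^-1) (- a / f x ^+ 2).
Proof.
move=> h hf; have k := is_deriveV h hf.
by apply: is_derive_eq k _; rewrite /GRing.scale /= mulrC mulrN mulNr.
Qed.

Lemma der_div f g x a b : g x != 0 -> is_derive x (1 : R) f a ->
  is_derive x (1 : R) g b ->
  is_derive x (1 : R) (fun y => f y / g y) (a / g x - f x * b / g x ^+ 2).
Proof.
move=> h hf hg; have k := der_mul hf (der_inv h hg).
by apply: is_derive_eq k _; rewrite mulNr mulrN mulrA.
Qed.

Lemma der_continuous f df : (forall x, is_derive x (1 : R) f (df x)) -> continuous f.
Proof.
move=> h x; apply: differentiable_continuous; apply/derivable1_diffP.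
by have [] := h x.
Qed.

Lemma mvt_any f df a b : (forall x, is_derive x (1 : R) f (df x)) ->
  exists2 c, (a <= c <= b) || (b <= c <= a) & f b - f a = df c * (b - a).
Proof.
move=> h.
have hc := der_continuous h.
have main a' b' : a' <= b' ->
    exists2 c, (a' <= c <= b') & f b' - f a' = df c * (b' - a').
  move=> ab.
  have [c] := @MVT_segment R f df a' b' ab (fun x _ => h x)
    (continuous_subspaceT hc).
  by rewrite in_itv /= => hc1 e; exists c.
have [ab|ba] := leP a b.
  by have [c h1 h2] := main _ _ ab; exists c => //; rewrite h1.
have [c h1 h2] := main _ _ (ltW ba); exists c; first by rewrite h1 orbT.
by rewrite -[LHS]opprB h2; ring.
Qed.

Lemma normr_between a b c : (a <= c <= b) || (b <= c <= a) -> `|c - a| <= `|b - a|.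
Proof.
case/orP => /andP[h1 h2].
  by rewrite !ger0_norm; lra.
by rewrite !ler0_norm; lra.
Qed.

Lemma normr_sin_le x : `|sin x| <= `|x|.
Proof.
have [c hc] := @mvt_any sin cos 0 x (@is_derive_sin R).
rewrite sin0 !subr0 => ->; rewrite normrM ler_piMl //.
exact: cos_max.
Qed.

(** This and the next two bounds each follow from the preceding one by the mean value theorem, which
    is why the Taylor constants are 1 instead of reciprocals of factorials. *)
Lemma normr_1subcos_le x : `|1 - cos x| <= x ^+ 2.
Proof.
have [c hc] := @mvt_any cos (fun y => - sin y) 0 x (@is_derive_cos R).
rewrite cos0 subr0 -normrN opprB => ->; rewrite normrM normrN.
have := normr_between hc; rewrite !subr0 => h.
rewrite -(real_normK (num_real x)) expr2; apply: ler_pM => //.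
exact: le_trans (normr_sin_le c) h.
Qed.

Lemma normr_sinB_le x : `|sin x - x| <= `|x| ^+ 3.
Proof.
have [c hc] := @mvt_any (fun y => sin y + (-1) * y) (fun y => cos y + (-1) * 1) 0 x
  (fun y => der_add (is_derive_sin y) (der_scale (-1) (der_id y))).
rewrite sin0 mulr0 addr0 !subr0 mulN1r => ->; rewrite normrM.
have := normr_between hc; rewrite !subr0 => h.
rewrite exprSr ler_wpM2r // mulr1 -normrN opprB.
apply: (le_trans (normr_1subcos_le c)).
by rewrite -(real_normK (num_real c)) ler_sqr ?nnegrE.
Qed.

Lemma normr_cosB2_le4 x : `|cos x - 1 + x ^+ 2 / 2| <= x ^+ 4.
Proof.
have hd y : is_derive y (1 : R) (fun y => cos y + 2^-1 * (y * y)) (- sin y + 2^-1 * (1 * y + y * 1)).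
  exact: der_add (is_derive_cos y) (der_scale _ (der_mul (der_id y) (der_id y))).
have [c hc] := mvt_any 0 x hd.
rewrite cos0 !mulr0 addr0 subr0.
have -> : cos x + 2^-1 * (x * x) - 1 = cos x - 1 + x ^+ 2 / 2 by field.
move=> ->; have -> : - sin c + 2^-1 * (1 * c + c * 1) = - (sin c - c) by field.
have := normr_between hc; rewrite !subr0 => h.
rewrite normrM normrN (_ : x ^+ 4 = `|x| ^+ 3 * `|x|).
  apply: ler_wpM2r => //; apply: (le_trans (normr_sinB_le c)).
  by rewrite lerXn2r ?nnegrE.
by rewrite -exprSr -normrX ger0_norm // (exprM x 2 2) sqr_ge0.
Qed.

(** The quartic bound is better near 0 but cannot be summed against third moments; for |x| > 1 the
    cubic one follows from the crude size of each term. *)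
Lemma normr_cosB2_le3 x : `|cos x - 1 + x ^+ 2 / 2| <= 2 * `|x| ^+ 3.
Proof.
have h3 : 0 <= `|x| ^+ 3 by rewrite exprn_ge0.
have [x1|x1] := leP `|x| 1.
  apply: (le_trans (normr_cosB2_le4 x)).
  have -> : x ^+ 4 = `|x| ^+ 3 * `|x|.
    by rewrite -exprSr -normrX ger0_norm // (exprM x 2 2) sqr_ge0.
  by nra.
apply: (le_trans (ler_normD _ _)).
have := normr_1subcos_le x; rewrite -normrN opprB => h.
rewrite [X in _ + X]ger0_norm; last by rewrite divr_ge0 ?sqr_ge0.
move: h; rewrite -(real_normK (num_real x)).
move: (`|x|) x1 h3 => y y1 h3 h; nra.
Qed.

Lemma cos_le_quad x : `|x| <= 1 / 2 -> x ^+ 2 / 4 <= 1 - cos x.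
Proof.
move=> h; have := normr_cosB2_le4 x; rewrite ler_norml => /andP[h1 h2].
have : x ^+ 2 <= 1 / 4.
  rewrite -(real_normK (num_real x)); move: (`|x|) (normr_ge0 x) h => y *; nra.
have := sqr_ge0 x; rewrite (exprM x 2 2) in h1 h2.
move: (x ^+ 2) h1 h2 => z h1 h2 z0 z4.
have : z ^+ 2 <= z / 4 by nra.
lra.
Qed.

Lemma expRN_quad (y : R) : 0 <= y -> `|expR (- y) - 1 + y| <= y ^+ 2.
Proof.
move=> y0.
have h1 := expR_ge1Dx (- y).
have h2 : expR (- y) <= (1 + y)^-1.
  by rewrite expRN lef_pV2 ?posrE ?expR_gt0 ?expR_ge1Dx //; lra.
have h3 : (1 + y)^-1 <= 1 - y + y ^+ 2.
  have -> : 1 - y + y ^+ 2 = (1 - y + y ^+ 2) * (1 + y) / (1 + y) by field; lra.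
  rewrite -[X in X <= _]mul1r ler_wpM2r ?invr_ge0; [|lra|]; nra.
by rewrite ler_norml; apply/andP; split; nra.
Qed.

Lemma pow_expRN_le k (x : R) : 0 <= x -> x ^+ k * expR (- x) <= k`!%:R.
Proof.
move=> x0; rewrite expRN ler_pdivrMr ?expR_gt0 //.
case: k => [|k]; first by rewrite expr0 fact0 mul1r -expR0 ler_expR.
have := expR_ge1Dxn k x0 => h.
rewrite mulrC -ler_pdivrMr ?ltr0n ?fact_gt0 //; lra.
Qed.

End RealCalculus.

Section Complex.
Import Normc.
Variable R : realType.
Implicit Types z : R[i].
Local Open Scope complex_scope.

Definition cis (t : R) : R[i] := cos t +i* sin t.

Lemma normc_cis t : normc (cis t) = 1.
Proof. by rewrite /cis /= cos2Dsin2 sqrtr1. Qed.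

Lemma normc_ge0 z : 0 <= normc z.
Proof. by case: z => a b; exact: sqrtr_ge0. Qed.

Lemma normc_real (x : R) : normc x%:C = `|x|.
Proof. by rewrite /= expr0n addr0 sqrtr_sqr. Qed.

Lemma normc_le_ReIm z : normc z <= `|complex.Re z| + `|complex.Im z|.
Proof.
case: z => a b /=.
rewrite -(@ler_sqr R) ?nnegrE ?sqrtr_ge0 ?addr_ge0 // sqr_sqrtr ?addr_ge0 ?sqr_ge0 //.
rewrite -(real_normK (num_real a)) -(real_normK (num_real b)).
have := normr_ge0 a; have := normr_ge0 b; nra.
Qed.

Lemma Re_le_normc z : `|complex.Re z| <= normc z.
Proof.
case: z => a b /=; rewrite -sqrtr_sqr ler_sqrt ?lerDl ?sqr_ge0 //.
by rewrite addr_ge0 ?sqr_ge0.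
Qed.

End Complex.

(** * Tilted three-point laws *)

Section TiltedLaw.
Import Normc.
Variables (R : realType) (w v : nat -> R) (V : R).
Hypotheses (w_ge0 : forall i, 0 <= w i) (w_le1 : forall i, w i <= 1) (w_sum : w 0%N + w 1%N + w 2%N = 1).
Hypothesis v_le : forall i, `|v i| <= V.
Implicit Types (r u h : R) (i k : nat).

(** The k-th derivative at r of the moment generating function [emom 0]. Accordingly [tmean] and
    [tvar] are the first two derivatives of its logarithm, and [tw] gives the tilted
    probabilities. *)
Definition emom k r : R := \sum_(0 <= i < 3) w i * v i ^+ k * expR (r * v i).
Definition tmean r : R := emom 1 r / emom 0 r.
Definition tvar r : R := emom 2 r / emom 0 r - tmean r ^+ 2.
Definition tw r i : R := w i * expR (r * v i) / emom 0 r.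

Lemma sum3 (F : nat -> R) : \sum_(0 <= i < 3) F i = F 0%N + F 1%N + F 2%N.
Proof. by rewrite !big_nat_recr //= big_geq // add0r. Qed.

Lemma V_ge0 : 0 <= V. Proof. exact: le_trans (normr_ge0 _) (v_le 0). Qed.

Lemma emom0_gt0 r : 0 < emom 0 r.
Proof.
apply: (@lt_le_trans _ _ (expR (- (`|r| * V)))); first exact: expR_gt0.
have h i : w i * expR (- (`|r| * V)) <= w i * v i ^+ 0 * expR (r * v i).
  rewrite expr0 mulr1; apply: ler_wpM2l => //; rewrite ler_expR.
  rewrite lerNl; apply: (le_trans (ler_norm _)); rewrite normrN normrM.
  by apply: ler_wpM2l.
rewrite /emom sum3; have := h 0%N; have := h 1%N; have := h 2%N.
set e := expR (- _); move=> h2 h1 h0.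
have : w 0%N * e + w 1%N * e + w 2%N * e = e by rewrite -!mulrDl w_sum mul1r.
lra.
Qed.
Hint Resolve emom0_gt0 : core.

Lemma emom0_neq0 r : emom 0 r != 0. Proof. by rewrite gt_eqF. Qed.
Hint Resolve emom0_neq0 : core.

Lemma tw_ge0 r i : 0 <= tw r i.
Proof. by rewrite divr_ge0 ?mulr_ge0 ?expR_ge0 // ltW. Qed.

Lemma tw_sum r : tw r 0 + tw r 1 + tw r 2 = 1.
Proof.
rewrite /tw -!mulrDl (_ : _ + _ + _ = emom 0 r) ?divff //.
by rewrite /emom sum3 !expr0 !mulr1.
Qed.

Lemma emomE k r : emom k r / emom 0 r =
  tw r 0 * v 0%N ^+ k + tw r 1 * v 1%N ^+ k + tw r 2 * v 2%N ^+ k.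
Proof. by rewrite {1}/emom sum3 !mulrDl /tw; congr (_ + _ + _); ring. Qed.

Lemma tmeanE r : tmean r = tw r 0 * v 0%N + tw r 1 * v 1%N + tw r 2 * v 2%N.
Proof. by rewrite /tmean emomE !expr1. Qed.

Lemma tvarE r : tvar r = tw r 0 * (v 0%N - tmean r) ^+ 2 +
   tw r 1 * (v 1%N - tmean r) ^+ 2 + tw r 2 * (v 2%N - tmean r) ^+ 2.
Proof.
rewrite /tvar emomE tmeanE; have := tw_sum r.
move: (tw r 0) (tw r 1) (tw r 2) => a b c.
by move=> /(canRL (addrK _)) /(canRL (addrK _)) ->; ring.
Qed.

(** Half the mean square of the difference of two independent copies. All terms are nonnegative, so
    the pair (0,1) alone bounds the variance from below. *)
Lemma tvar_pairs r : tvar r = tw r 0 * tw r 1 * (v 0%N - v 1%N) ^+ 2 +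
   tw r 0 * tw r 2 * (v 0%N - v 2%N) ^+ 2 + tw r 1 * tw r 2 * (v 1%N - v 2%N) ^+ 2.
Proof.
rewrite /tvar emomE tmeanE; have := tw_sum r.
move: (tw r 0) (tw r 1) (tw r 2) => a b c.
by move=> /(canRL (addrK _)) /(canRL (addrK _)) ->; ring.
Qed.

Lemma tw_avg_le r (F : nat -> R) C : (forall i, F i <= C) ->
  tw r 0 * F 0%N + tw r 1 * F 1%N + tw r 2 * F 2%N <= C.
Proof.
move=> h; have e := tw_sum r.
have h' i : tw r i * F i <= tw r i * C by rewrite ler_wpM2l ?tw_ge0.
have := h' 0%N; have := h' 1%N; have := h' 2%N.
have : tw r 0 * C + tw r 1 * C + tw r 2 * C = C.
  by rewrite -mulrDl -mulrDl e mul1r.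
lra.
Qed.

Lemma normr_twM r i x : `|tw r i * x| = tw r i * `|x|.
Proof. by rewrite normrM ger0_norm // tw_ge0. Qed.

Lemma tww_cos_ge0 r i j x : 0 <= tw r i * tw r j * (1 - cos x).
Proof.
apply: mulr_ge0; last by rewrite subr_ge0; exact: cos_le1.
by apply: mulr_ge0; exact: tw_ge0.
Qed.

Lemma normr_tw_avg r (F : nat -> R) :
  `|tw r 0 * F 0%N + tw r 1 * F 1%N + tw r 2 * F 2%N| <=
  tw r 0 * `|F 0%N| + tw r 1 * `|F 1%N| + tw r 2 * `|F 2%N|.
Proof.
apply: (le_trans (ler_normD _ _)); apply: lerD.
  apply: (le_trans (ler_normD _ _)).
  by rewrite !normr_twM.
by rewrite normr_twM.
Qed.

Lemma emom_ratio_le k r : `|emom k r / emom 0 r| <= V ^+ k.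
Proof.
rewrite emomE; apply: (le_trans (normr_tw_avg _ (fun i => v i ^+ k))).
apply: (@tw_avg_le r (fun i => `|v i ^+ k|)) => i.
by rewrite normrX lerXn2r ?nnegrE ?V_ge0.
Qed.

Lemma tmean_le r : `|tmean r| <= V.
Proof. by have := emom_ratio_le 1 r; rewrite expr1. Qed.

Lemma tvar_ge0 r : 0 <= tvar r.
Proof. by rewrite tvarE !addr_ge0 // mulr_ge0 ?tw_ge0 ?sqr_ge0. Qed.

Lemma tvar_le r : tvar r <= V ^+ 2.
Proof.
have := emom_ratio_le 2 r; rewrite /tvar ler_norml => /andP[_ h].
have := sqr_ge0 (tmean r); lra.
Qed.

Lemma der_emom k r : is_derive r (1 : R) (emom k) (emom k.+1 r).
Proof.
have ht i : is_derive r (1 : R) (fun y => w i * v i ^+ k * expR (y * v i))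
    (w i * v i ^+ k.+1 * expR (r * v i)).
  have h := der_scale (w i * v i ^+ k)
    (der_comp (g := fun y => y * v i) (is_derive_expR (r * v i))
       (der_mul (der_id r) (der_cst (v i) r))).
  by apply: is_derive_eq h _; rewrite exprS; ring.
have -> : emom k = fun y => w 0%N * v 0%N ^+ k * expR (y * v 0%N) +
    w 1%N * v 1%N ^+ k * expR (y * v 1%N) + w 2%N * v 2%N ^+ k * expR (y * v 2%N).
  by apply/funext => y; rewrite /emom sum3.
by rewrite /emom sum3; exact: (der_add (der_add (ht 0%N) (ht 1%N)) (ht 2%N)).
Qed.

Lemma der_ln_emom r : is_derive r (1 : R) (fun y => ln (emom 0 y)) (tmean r).
Proof.
have h := der_comp (is_derive1_ln (emom0_gt0 r)) (der_emom 0 r).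
by apply: is_derive_eq h _; rewrite mulrC.
Qed.

Lemma der_tmean r : is_derive r (1 : R) tmean (tvar r).
Proof.
have h := der_div (emom0_neq0 r) (der_emom 1 r) (der_emom 0 r).
by apply: is_derive_eq h _; rewrite /tvar /tmean expr2; field.
Qed.

(** The third cumulant of the tilted law. *)
Definition tskew r : R := emom 3 r / emom 0 r - 3 * (emom 2 r / emom 0 r) * tmean r
  + 2 * tmean r ^+ 3.

Lemma der_tvar r : is_derive r (1 : R) tvar (tskew r).
Proof.
have h := der_add (der_div (emom0_neq0 r) (der_emom 2 r) (der_emom 0 r))
  (der_scale (-1) (der_mul (der_tmean r) (der_tmean r))).
have -> : tvar = fun y => emom 2 y / emom 0 y + -1 * (tmean y * tmean y).
  by apply/funext => y; rewrite /tvar mulN1r expr2.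
by apply: is_derive_eq h _; rewrite /tskew /tvar /tmean; field.
Qed.

Lemma tskew_le r : `|tskew r| <= 6 * V ^+ 3.
Proof.
have V0 := V_ge0.
have h3 := emom_ratio_le 3 r; have h2 := emom_ratio_le 2 r; have h1 := tmean_le r.
apply: (le_trans (ler_normD _ _)).
apply: (@le_trans _ _ ((V ^+ 3 + 3 * (V ^+ 2 * V)) + 2 * V ^+ 3)); last first.
  by rewrite -exprSr; lra.
apply: lerD.
  apply: (le_trans (ler_normB _ _)); apply: lerD => //.
  rewrite -mulrA normrM ger0_norm // ler_wpM2l // normrM.
  by apply: ler_pM.
rewrite normrM ger0_norm // ler_wpM2l // normrX.
by rewrite lerXn2r ?nnegrE.
Qed.

Lemma tmean_lip r s : `|tmean s - tmean r| <= V ^+ 2 * `|s - r|.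
Proof.
have [c _ ->] := mvt_any r s der_tmean.
by rewrite normrM ler_wpM2r // ger0_norm ?tvar_ge0 ?tvar_le.
Qed.

Lemma tmean_homo r s : r <= s -> tmean r <= tmean s.
Proof.
move=> rs; have [c _] := mvt_any r s der_tmean => e.
by rewrite -subr_ge0 e mulr_ge0 ?tvar_ge0 // subr_ge0.
Qed.

Lemma tvar_lip r s : `|tvar s - tvar r| <= 6 * V ^+ 3 * `|s - r|.
Proof.
have [c _ ->] := mvt_any r s der_tvar.
by rewrite normrM ler_wpM2r // tskew_le.
Qed.

Lemma ln_emom_taylor r h :
  `|ln (emom 0 (r + h)) - ln (emom 0 r) - h * tmean r| <= V ^+ 2 * h ^+ 2.
Proof.
have [c hc ->] := mvt_any r (r + h) der_ln_emom.
rewrite [r + h]addrC addrK [h * _]mulrC -mulrBl normrM.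
rewrite -(real_normK (num_real h)) expr2 mulrA ler_wpM2r //.
apply: (le_trans (tmean_lip _ _)); rewrite ler_wpM2l ?exprn_ge0 ?V_ge0 //.
by have := normr_between hc; rewrite [r + h]addrC addrK.
Qed.

Lemma tmean_taylor r h : `|tmean (r + h) - tmean r - h * tvar r| <= 6 * V ^+ 3 * h ^+ 2.
Proof.
have [c hc ->] := mvt_any r (r + h) der_tmean.
rewrite [r + h]addrC addrK [h * _]mulrC -mulrBl normrM.
rewrite -(real_normK (num_real h)) expr2 mulrA ler_wpM2r //.
apply: (le_trans (tvar_lip _ _)); rewrite ler_wpM2l ?mulr_ge0 ?exprn_ge0 ?V_ge0 //.
by have := normr_between hc; rewrite [r + h]addrC addrK.
Qed.

Lemma emom00 : emom 0 0 = 1.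
Proof. by rewrite /emom sum3 !mul0r expR0 !expr0 !mulr1 w_sum. Qed.

Lemma tmean0 : tmean 0 = w 0%N * v 0%N + w 1%N * v 1%N + w 2%N * v 2%N.
Proof. by rewrite /tmean emom00 divr1 /emom sum3 !mul0r expR0 !expr1 !mulr1. Qed.

Lemma tmean_bound r : `|tmean r| <= `|tmean 0| + V ^+ 2 * `|r|.
Proof.
have := tmean_lip 0 r; rewrite subr0 => h.
rewrite -[tmean r](subrK (tmean 0)); apply: (le_trans (ler_normD _ _)); lra.
Qed.

Lemma ln_emom_bound r : `|ln (emom 0 r)| <= `|r| * `|tmean 0| + V ^+ 2 * r ^+ 2.
Proof.
have := ln_emom_taylor 0 r; rewrite add0r emom00 ln1 subr0 => h.
rewrite -[ln _](subrK (r * tmean 0)) -normrM; apply: (le_trans (ler_normD _ _)); lra.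
Qed.

Definition tabs3 r : R := tw r 0 * `|v 0%N - tmean r| ^+ 3 +
  tw r 1 * `|v 1%N - tmean r| ^+ 3 + tw r 2 * `|v 2%N - tmean r| ^+ 3.

Lemma tabs3_le r : tabs3 r <= 8 * V ^+ 3.
Proof.
apply: (@tw_avg_le r (fun i => `|v i - tmean r| ^+ 3)) => i.
have -> : 8 * V ^+ 3 = (2 * V) ^+ 3 by rewrite exprMn; ring.
rewrite lerXn2r ?nnegrE ?mulr_ge0 ?V_ge0 //.
apply: (le_trans (ler_normB _ _)); have := v_le i; have := tmean_le r; lra.
Qed.

Section Maximum.
Hypotheses (v_max : forall i, v i <= v 0%N) (w0_ge : 1 / 4 <= w 0%N).

(** Since the largest value keeps weight at least 1/4 before tilting, the tilted weight of value i
    is at most 4 e^{-r(v 0 - v i)}, and x^k e^{-x} <= k!. A strong tilt thus concentrates the law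
    within O(1/r) of its maximum, however large the values are. *)
Lemma tw_gap k r i : 0 < r -> tw r i * (v 0%N - v i) ^+ k <= 4 * k`!%:R / r ^+ k.
Proof.
move=> r0; have d0 : 0 <= v 0%N - v i by rewrite subr_ge0.
have rk : 0 < r ^+ k by rewrite exprn_gt0.
rewrite ler_pdivlMr //.
have h1 : tw r i <= 4 * expR (- (r * (v 0%N - v i))).
  rewrite /tw ler_pdivrMr //.
  have -> : expR (- (r * (v 0%N - v i))) = expR (r * v i) * expR (- (r * v 0%N)).
    by rewrite -expRD; congr expR; ring.
  have e0 : w 0%N * expR (r * v 0%N) <= emom 0 r.
    rewrite /emom sum3 !expr0 !mulr1 -addrA lerDl addr_ge0 // mulr_ge0 ?expR_ge0 //.
  have hE : 1 / 4 * expR (r * v 0%N) <= emom 0 r.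
    by apply: le_trans e0; rewrite ler_wpM2r ?expR_ge0.
  have e1 : 1 <= 4 * (expR (- (r * v 0%N)) * emom 0 r).
    have : expR (- (r * v 0%N)) * (1 / 4 * expR (r * v 0%N)) <= expR (- (r * v 0%N)) * emom 0 r.
      by rewrite ler_wpM2l ?expR_ge0.
    rewrite mulrCA -expRD addNr expR0; lra.
  have -> : 4 * (expR (r * v i) * expR (- (r * v 0%N))) * emom 0 r =
    (4 * (expR (- (r * v 0%N)) * emom 0 r)) * expR (r * v i) by ring.
  by rewrite ler_wpM2r ?expR_ge0 //; apply: le_trans e1.
have := @pow_expRN_le R k (r * (v 0%N - v i)) (mulr_ge0 (ltW r0) d0).
rewrite exprMn => h2.
have : tw r i * (v 0%N - v i) ^+ k * r ^+ k <= 4 * expR (- (r * (v 0%N - v i))) * (v 0%N - v i) ^+ k * r ^+ k.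
  rewrite ler_wpM2r ?(ltW rk) // ler_wpM2r ?exprn_ge0 //.
move/le_trans; apply.
have -> : 4 * expR (- (r * (v 0%N - v i))) * (v 0%N - v i) ^+ k * r ^+ k =
  4 * (r ^+ k * (v 0%N - v i) ^+ k * expR (- (r * (v 0%N - v i)))) by ring.
by rewrite ler_wpM2l.
Qed.

Lemma tmean_gap r : 0 < r -> 0 <= v 0%N - tmean r <= 12 / r.
Proof.
move=> r0; have e := tw_sum r.
have -> : v 0%N - tmean r = tw r 0 * (v 0%N - v 0%N) ^+ 1 + tw r 1 * (v 0%N - v 1%N) ^+ 1 + tw r 2 * (v 0%N - v 2%N) ^+ 1.
  rewrite tmeanE !expr1.
  rewrite -{1}[v 0%N]mul1r -{1}e; ring.
apply/andP; split.
  by rewrite !addr_ge0 // mulr_ge0 ?tw_ge0 // exprn_ge0 // subr_ge0.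
have := tw_gap 1 0 r0; have := tw_gap 1 1 r0; have := tw_gap 1 2 r0.
rewrite factS fact0 muln1 mulr1 expr1; lra.
Qed.

Lemma tvar_gap r : 0 < r -> tvar r <= 24 / r ^+ 2.
Proof.
move=> r0; have e := tw_sum r.
have h : tvar r + (v 0%N - tmean r) ^+ 2 = tw r 0 * (v 0%N - v 0%N) ^+ 2 + tw r 1 * (v 0%N - v 1%N) ^+ 2 + tw r 2 * (v 0%N - v 2%N) ^+ 2.
  rewrite tvarE tmeanE; move: e; move: (tw r 0) (tw r 1) (tw r 2) => a b c.
  by move=> /(canRL (addrK _)) /(canRL (addrK _)) ->; ring.
have := tw_gap 2 0 r0; have := tw_gap 2 1 r0; have := tw_gap 2 2 r0.
have := sqr_ge0 (v 0%N - tmean r).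
have -> : 2`!%:R = 2 :> R by [].
rewrite subrr in h *; lra.
Qed.

(** Distances to the mean are compared with distances to the maximum by (a + b)^3 <= 4 a^3 + 4 b^3.
    The constant is 4 * 3 * 24 + 4 * 12^3. *)
Lemma tabs3_gap r : 0 < r -> tabs3 r <= 7200 / r ^+ 3.
Proof.
move=> r0; have [m0 m1] := andP (tmean_gap r0).
have r3 : 0 < r ^+ 3 by rewrite exprn_gt0.
have m3 : (v 0%N - tmean r) ^+ 3 <= 1728 / r ^+ 3.
  apply: (@le_trans _ _ ((12 / r) ^+ 3)); first by rewrite lerXn2r ?nnegrE // (le_trans m0).
  by rewrite exprMn exprVn ler_wpM2r ?invr_ge0 ?(ltW r3) //; lra.
have h i : tw r i * `|v i - tmean r| ^+ 3 <= 4 * (tw r i * (v 0%N - v i) ^+ 3) + 4 * (tw r i * (1728 / r ^+ 3)).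
  have d0 : 0 <= v 0%N - v i by rewrite subr_ge0.
  have -> : 4 * (tw r i * (v 0%N - v i) ^+ 3) + 4 * (tw r i * (1728 / r ^+ 3)) =
     tw r i * (4 * (v 0%N - v i) ^+ 3 + 4 * (1728 / r ^+ 3)) by ring.
  apply: ler_wpM2l; first exact: tw_ge0.
  apply: (@le_trans _ _ (((v 0%N - v i) + (v 0%N - tmean r)) ^+ 3)).
    apply: lerXn2r; rewrite ?nnegrE //; first by lra.
    by rewrite ler_norml; apply/andP; split; lra.
  move: (v 0%N - v i) (v 0%N - tmean r) d0 m0 m3 => a b a0 b0 m3.
  apply: (@le_trans _ _ (4 * a ^+ 3 + 4 * b ^+ 3)); last by rewrite lerD2l ler_wpM2l.
  have : 0 <= (a + b) * (a - b) ^+ 2 by rewrite mulr_ge0 ?sqr_ge0 ?addr_ge0.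
  nra.
have := h 0%N; have := h 1%N; have := h 2%N.
have := tw_gap 3 0 r0; have := tw_gap 3 1 r0; have := tw_gap 3 2 r0.
have -> : 3`!%:R = 6 :> R by [].
have : tw r 0 * (1728 / r ^+ 3) + tw r 1 * (1728 / r ^+ 3) + tw r 2 * (1728 / r ^+ 3) = 1728 / r ^+ 3.
  by rewrite -mulrDl -mulrDl tw_sum mul1r.
rewrite /tabs3.
move: (tw r 0 * (1728 / _)) (tw r 1 * (1728 / _)) (tw r 2 * (1728 / _)) => A B C.
move: (r ^+ 3)^-1 => Z; lra.
Qed.

End Maximum.

(** The regime opposite to [tw_gap]: while r V stays bounded, numerator and denominator of the
    tilted weight each change by a factor at most e^B. *)
Lemma tw_lower r i B : 1 / 4 <= w i -> `|r| * V <= B -> expR (- (2 * B)) / 4 <= tw r i.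
Proof.
move=> wi rB.
have hE : emom 0 r <= expR B.
  have h j : w j * v j ^+ 0 * expR (r * v j) <= w j * expR B.
    rewrite expr0 mulr1 ler_wpM2l // ler_expR.
    apply: (le_trans (ler_norm _)); rewrite normrM; apply: le_trans rB.
    by rewrite ler_wpM2l.
  rewrite /emom sum3; have := h 0%N; have := h 1%N; have := h 2%N.
  have : w 0%N * expR B + w 1%N * expR B + w 2%N * expR B = expR B by rewrite -!mulrDl w_sum mul1r.
  lra.
have hi : expR (- B) <= expR (r * v i).
  rewrite ler_expR lerNl; apply: (le_trans (ler_norm _)).
  by rewrite normrN normrM; apply: le_trans rB; rewrite ler_wpM2l.
rewrite /tw ler_pdivlMr //.
have -> : expR (- (2 * B)) = expR (- B) / expR B by rewrite -expRN -expRD; congr expR; ring.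
apply: (@le_trans _ _ (expR (- B) / expR B / 4 * expR B)).
  by rewrite ler_wpM2l // !mulr_ge0 ?invr_ge0 ?expR_ge0.
rewrite (_ : _ / 4 * _ = 1 / 4 * expR (- B)); last by field; rewrite gt_eqF ?expR_gt0.
by apply: ler_pM => //; exact: expR_ge0.
Qed.

(** Characteristic function of the tilted law, centred at its mean so that the expansion at u = 0
    has no linear term. *)
Definition tchar r u : R[i] :=
  Complex (tw r 0 * cos (u * (v 0%N - tmean r)) + tw r 1 * cos (u * (v 1%N - tmean r))
           + tw r 2 * cos (u * (v 2%N - tmean r)))
          (tw r 0 * sin (u * (v 0%N - tmean r)) + tw r 1 * sin (u * (v 1%N - tmean r))
           + tw r 2 * sin (u * (v 2%N - tmean r))).

(** The squared modulus is the characteristic function of the difference of two independent copies,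
    hence involves only differences of values. *)
Lemma tchar_sqr r u : normc (tchar r u) ^+ 2 =
  1 - 2 * tw r 0 * tw r 1 * (1 - cos (u * (v 0%N - v 1%N)))
    - 2 * tw r 0 * tw r 2 * (1 - cos (u * (v 0%N - v 2%N)))
    - 2 * tw r 1 * tw r 2 * (1 - cos (u * (v 1%N - v 2%N))).
Proof.
have hc i j : cos (u * (v i - v j)) = cos (u * (v i - tmean r)) * cos (u * (v j - tmean r))
    + sin (u * (v i - tmean r)) * sin (u * (v j - tmean r)).
  by rewrite -cosB; congr cos; ring.
rewrite !hc /tchar /= sqr_sqrtr ?addr_ge0 ?sqr_ge0 //.
have e := tw_sum r.
have h0 := cos2Dsin2 (u * (v 0%N - tmean r)).
have h1 := cos2Dsin2 (u * (v 1%N - tmean r)).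
have h2 := cos2Dsin2 (u * (v 2%N - tmean r)).
move: h0 h1 h2 e; move: (cos _) (sin _) (cos _) (sin _) (cos _) (sin _) => c2 s2 c1 s1 c0 s0.
move: (tw r 0) (tw r 1) (tw r 2) => a b c h0 h1 h2 e.
have -> : (a * c0 + b * c1 + c * c2) ^+ 2 + (a * s0 + b * s1 + c * s2) ^+ 2 =
  a ^+ 2 * (c0 ^+ 2 + s0 ^+ 2) + b ^+ 2 * (c1 ^+ 2 + s1 ^+ 2) + c ^+ 2 * (c2 ^+ 2 + s2 ^+ 2)
  + 2 * a * b * (c0 * c1 + s0 * s1) + 2 * a * c * (c0 * c2 + s0 * s2)
  + 2 * b * c * (c1 * c2 + s1 * s2) by ring.
rewrite h0 h1 h2.
have -> : 1 = (a + b + c) ^+ 2 :> R by rewrite e expr1n.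
move: e => /(canRL (addrK _)) /(canRL (addrK _)) ->; ring.
Qed.

Lemma tchar_le_pair r u : normc (tchar r u) <= expR (- (tw r 0 * tw r 1 * (1 - cos (u * (v 0%N - v 1%N))))).
Proof.
rewrite -(@ler_sqr R) ?nnegrE ?expR_ge0 ?normc_ge0 //.
rewrite -expRM_natl tchar_sqr.
apply: le_trans (expR_ge1Dx _).
have h i j : 0 <= tw r i * tw r j * (1 - cos (u * (v i - v j))).
  exact: tww_cos_ge0.
have := h 0%N 2%N; have := h 1%N 2%N; lra.
Qed.

Lemma tchar_le1 r u : normc (tchar r u) <= 1.
Proof.
apply: (le_trans (tchar_le_pair _ _)); rewrite -[X in _ <= X]expR0 ler_expR oppr_le0.
exact: tww_cos_ge0.
Qed.

Lemma tchar_decay r u : `|u * (v 0%N - v 1%N)| <= 1 / 2 ->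
  normc (tchar r u) <= expR (- (tw r 0 * tw r 1 * ((u * (v 0%N - v 1%N)) ^+ 2 / 4))).
Proof.
move=> h; apply: (le_trans (tchar_le_pair _ _)); rewrite ler_expR lerN2.
apply: ler_wpM2l; last exact: cos_le_quad.
by apply: mulr_ge0; exact: tw_ge0.
Qed.

(** Both functions are compared with 1 - [tvar r] u^2/2. The real part costs 2 third absolute
    moments, the imaginary part one, and the Gaussian the square of its exponent. *)
Lemma tchar_gauss r u :
  normc (tchar r u - (expR (- (tvar r * u ^+ 2 / 2)))%:C%C) <=
  3 * tabs3 r * `|u| ^+ 3 + (tvar r * u ^+ 2 / 2) ^+ 2.
Proof.
apply: (le_trans (normc_le_ReIm _)); rewrite /tchar /= subr0.
have y0 : 0 <= tvar r * u ^+ 2 / 2.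
  by rewrite divr_ge0 // mulr_ge0 ?sqr_ge0 ?tvar_ge0.
have hy := expRN_quad y0.
have e := tw_sum r.
have b3 i : `|u * (v i - tmean r)| ^+ 3 = `|v i - tmean r| ^+ 3 * `|u| ^+ 3.
  by rewrite normrM exprMn mulrC.
have hre : `|tw r 0 * cos (u * (v 0%N - tmean r)) + tw r 1 * cos (u * (v 1%N - tmean r))
           + tw r 2 * cos (u * (v 2%N - tmean r)) - 1 + tvar r * u ^+ 2 / 2| <= 2 * (tabs3 r * `|u| ^+ 3).
  have -> : tw r 0 * cos (u * (v 0%N - tmean r)) + tw r 1 * cos (u * (v 1%N - tmean r))
           + tw r 2 * cos (u * (v 2%N - tmean r)) - 1 + tvar r * u ^+ 2 / 2 =
    tw r 0 * (cos (u * (v 0%N - tmean r)) - 1 + (u * (v 0%N - tmean r)) ^+ 2 / 2) +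
    tw r 1 * (cos (u * (v 1%N - tmean r)) - 1 + (u * (v 1%N - tmean r)) ^+ 2 / 2) +
    tw r 2 * (cos (u * (v 2%N - tmean r)) - 1 + (u * (v 2%N - tmean r)) ^+ 2 / 2).
    rewrite tvarE -{1}e; move: (tmean r) (cos _) (cos _) (cos _) => m c0 c1 c2; by field.
  apply: (le_trans (normr_tw_avg _ (fun i => cos (u * (v i - tmean r)) - 1 + (u * (v i - tmean r)) ^+ 2 / 2))).
  have h i : tw r i * `|cos (u * (v i - tmean r)) - 1 + (u * (v i - tmean r)) ^+ 2 / 2| <=
     tw r i * (2 * (`|v i - tmean r| ^+ 3 * `|u| ^+ 3)).
    by rewrite ler_wpM2l ?tw_ge0 // -b3 normr_cosB2_le3.
  have := h 0%N; have := h 1%N; have := h 2%N; rewrite /tabs3; lra.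
have him : `|tw r 0 * sin (u * (v 0%N - tmean r)) + tw r 1 * sin (u * (v 1%N - tmean r))
           + tw r 2 * sin (u * (v 2%N - tmean r))| <= tabs3 r * `|u| ^+ 3.
  have -> : tw r 0 * sin (u * (v 0%N - tmean r)) + tw r 1 * sin (u * (v 1%N - tmean r))
           + tw r 2 * sin (u * (v 2%N - tmean r)) =
    tw r 0 * (sin (u * (v 0%N - tmean r)) - (u * (v 0%N - tmean r))) +
    tw r 1 * (sin (u * (v 1%N - tmean r)) - (u * (v 1%N - tmean r))) +
    tw r 2 * (sin (u * (v 2%N - tmean r)) - (u * (v 2%N - tmean r))).
    (* The linear terms of the sines cancel because the law is centred. *)
    have h : tw r 0 * (v 0%N - tmean r) + tw r 1 * (v 1%N - tmean r) + tw r 2 * (v 2%N - tmean r) = 0.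
      have -> : tw r 0 * (v 0%N - tmean r) + tw r 1 * (v 1%N - tmean r) + tw r 2 * (v 2%N - tmean r) =
         (tw r 0 * v 0%N + tw r 1 * v 1%N + tw r 2 * v 2%N) - (tw r 0 + tw r 1 + tw r 2) * tmean r by ring.
      by rewrite e mul1r -tmeanE subrr.
    rewrite -[LHS]subr0 -(mulr0 u) -h; ring.
  apply: (le_trans (normr_tw_avg _ (fun i => sin (u * (v i - tmean r)) - u * (v i - tmean r)))).
  have h i : tw r i * `|sin (u * (v i - tmean r)) - u * (v i - tmean r)| <=
     tw r i * (`|v i - tmean r| ^+ 3 * `|u| ^+ 3).
    by rewrite ler_wpM2l ?tw_ge0 // -b3 normr_sinB_le.
  have := h 0%N; have := h 1%N; have := h 2%N; rewrite /tabs3; lra.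
move: hre him hy; set A := tw r 0 * cos _ + _ + _; set B := tw r 0 * sin _ + _ + _.
set y := tvar r * _ / 2; set E := expR _ => hre him hy.
have : `|A - E| <= `|A - 1 + y| + `|E - 1 + y|.
  have -> : A - E = (A - 1 + y) - (E - 1 + y) by ring.
  exact: ler_normB.
lra.
Qed.

End TiltedLaw.

(* The common shape of the law, at the prime p, of 2 log |1 - X(p)/p|^-1 and of its negative:
   value [v i] with probability [w i], i < 3.  The largest value is [v 0]. *)
Record three_point (R : realType) (p : nat) (w v : nat -> R) : Prop := ThreePoint {
  tp_w_ge0 : forall i, 0 <= w i;
  tp_w_le1 : forall i, w i <= 1;
  tp_w_sum : w 0%N + w 1%N + w 2%N = 1;
  tp_v_le : forall i, `|v i| <= 4 / p%:R;
  tp_v_max : forall i, v i <= v 0%N;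
  tp_w0_ge : 1 / 4 <= w 0%N;
  tp_w1_ge : 1 / 4 <= w 1%N;
  tp_gap : 1 / p%:R <= v 0%N - v 1%N;
  tp_pos : 1 / (2 * p%:R) <= v 0%N;
  tp_mean : `|w 0%N * v 0%N + w 1%N * v 1%N + w 2%N * v 2%N| <= 8 / p%:R ^+ 2 }.

(** * Limits over N of the log-moment, the tilted mean and the tilted variance *)

Section SumLimits.
Variable R : realType.

Lemma psum_inv_sqr_le N : psum N (fun p => (p%:R ^+ 2)^-1 : R) <= 9.
Proof.
apply: (@le_trans _ _ (psum N (fun p => 9 * ((2 + p%:R) ^+ 2)^-1))).
  apply: ler_psum => p pp; have : (1 : R) <= p%:R by rewrite ler1n prime_gt0.
  move=> p1; apply: invr_le_div; [by rewrite exprn_gt0 //; lra..|nra].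
rewrite psumZ; have : psum N (fun p => ((2 + p%:R : R) ^+ 2)^-1) <= 1.
  apply: (le_trans (psum_le_sum _ _)); first by move=> n; rewrite invr_ge0 sqr_ge0.
  apply: (le_trans (sum_inv_sqr_shift _ _)); first lra.
  by rewrite (_ : 2 - 1 = 1) ?invr1 //; ring.
lra.
Qed.

Lemma psum_cvg (f : nat -> R) C : (forall p, prime p -> `|f p| <= C / p%:R ^+ 2) ->
  cvgn (fun N => psum N f).
Proof.
move=> h; pose g p := if prime p then f p else 0.
have -> : (fun N => psum N f) = series g.
  by apply/funext => N; rewrite /psum big_mkcond.
apply: normed_cvg; apply: nondecreasing_is_cvgn.
  apply/nondecreasing_seqP => n.
  by rewrite /series /= [leRHS]big_nat_recr //= lerDl.
exists (C * 9) => _ [N _ <-].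
have C0 : 0 <= C.
  have := h 2%N isT; have := normr_ge0 (f 2%N); have -> : (2%:R ^+ 2 : R) = 4 by ring.
  lra.
have -> : [normed series g] N = psum N (fun p => `|f p|).
  rewrite /series /= /psum [RHS]big_mkcond; apply: eq_bigr => p _.
  by rewrite /g; case: ifP => // _; rewrite normr0.
apply: (@le_trans _ _ (psum N (fun p => C * (p%:R ^+ 2)^-1))); first exact: ler_psum.
by rewrite psumZ ler_wpM2l // psum_inv_sqr_le.
Qed.

Lemma limn_norm_le (u : nat -> R) (l C : R) : u n @[n --> \oo] --> l ->
  (forall n, `|u n| <= C) -> `|l| <= C.
Proof.
move=> ul h; have hl : `|u n| @[n --> \oo] --> `|l| by exact: cvg_norm.
rewrite -(cvg_lim _ hl) //; apply: limr_le; first by apply/cvg_ex; exists `|l|.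
by apply: nearW.
Qed.

(** A Taylor estimate with quadratic remainder passes to pointwise limits. This is how the
    derivatives of [Linf] and [Minf] are obtained from uniform estimates on the partial sums. *)
Lemma der_of_taylor (f : R -> R) r d K :
  (forall h, `|f (r + h) - f r - h * d| <= K * h ^+ 2) -> is_derive r (1 : R) f d.
Proof.
move=> hT.
have K0 : 0 <= K by have := hT 1; rewrite expr1n mulr1; apply: le_trans.
have hc : h^-1 *: ((f \o shift r) (h *: (1 : R)) - f r) @[h --> 0^'] --> d.
  apply/cvgrPdist_le => eps e0.
  near=> h.
  have h0 : h != 0 by near: h; exact: nbhs_dnbhs_neq.
  rewrite /= /GRing.scale /= mulr1 [h + r]addrC.
  have -> : d - h^-1 * (f (r + h) - f r) = - (h^-1 * (f (r + h) - f r - h * d)).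
    by field.
  rewrite normrN normrM normfV ler_pdivrMl ?normr_gt0 //.
  apply: (le_trans (hT h)); rewrite -(real_normK (num_real h)) expr2 mulrA mulrC ler_wpM2l //.
  have : `|h| <= eps / (K + 1).
    near: h; apply: dnbhs0_le; rewrite divr_gt0 //; lra.
  rewrite ler_pdivlMr; last lra.
  have := normr_ge0 h; nra.
by split; [apply/cvg_ex; exists d|exact: cvg_lim hc].
Unshelve. all: by end_near.
Qed.

End SumLimits.

Section Model.
Variables (R : realType) (w v : nat -> nat -> R).
Hypothesis model : forall p, prime p -> three_point p (w p) (v p).
Implicit Types (p N : nat) (r u : R).

(* Log-moment, tilted mean and tilted variance of the sum over the primes below N, and their
   limits, which are L, L' and L''. *)
Definition logE p r : R := ln (emom (w p) (v p) 0 r).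
Definition meanE p r : R := tmean (w p) (v p) r.
Definition varE p r : R := tvar (w p) (v p) r.

Definition LN N r : R := psum N (logE ^~ r).
Definition mN N r : R := psum N (meanE ^~ r).
Definition sN N r : R := psum N (varE ^~ r).

Definition Linf r : R := limn (fun N => LN N r).
Definition Minf r : R := limn (fun N => mN N r).
Definition Sinf r : R := limn (fun N => sN N r).

Lemma primeR_gt0 p : prime p -> 0 < p%:R :> R.
Proof. by move=> pp; rewrite ltr0n prime_gt0. Qed.

Lemma meanE0_le p : prime p -> `|meanE p 0| <= 8 / p%:R ^+ 2.
Proof.
move=> pp; have M := model pp.
rewrite /meanE (tmean0 (v p) (tp_w_sum M)); exact: tp_mean M.
Qed.

(** The values have size 1/p, which is not summable over primes. The summable 1/p^2 comes from the
    cancellation in the untilted mean recorded in [tp_mean]. *)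
Lemma logE_le p r : prime p -> `|logE p r| <= (8 * `|r| + 16 * r ^+ 2) / p%:R ^+ 2.
Proof.
move=> pp; have M := model pp; have p0 := primeR_gt0 pp.
have := ln_emom_bound (tp_w_ge0 M) (tp_w_sum M) (tp_v_le M) r.
have := meanE0_le pp; rewrite -/(meanE p 0) -/(logE p r) => h0 h.
apply: (le_trans h).
have : `|r| * `|meanE p 0| <= `|r| * (8 / p%:R ^+ 2) by rewrite ler_wpM2l.
rewrite exprMn exprVn; move: (p%:R ^+ 2)^-1 => z; lra.
Qed.

Lemma meanE_le p r : prime p -> `|meanE p r| <= (8 + 16 * `|r|) / p%:R ^+ 2.
Proof.
move=> pp; have M := model pp.
have := tmean_bound (tp_w_ge0 M) (tp_w_sum M) (tp_v_le M) r.
have := meanE0_le pp; rewrite -/(meanE p 0) -/(meanE p r) exprMn exprVn.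
move: (p%:R ^+ 2)^-1 => z; lra.
Qed.

Lemma varE_ge0 p r : prime p -> 0 <= varE p r.
Proof.
by move=> /model M; exact: (tvar_ge0 (tp_w_ge0 M) (tp_w_sum M) (tp_v_le M)).
Qed.

Lemma varE_le p r : prime p -> varE p r <= 16 / p%:R ^+ 2.
Proof.
move=> /model M; have := tvar_le (tp_w_ge0 M) (tp_w_sum M) (tp_v_le M) r.
rewrite exprMn exprVn /varE; move: (p%:R ^+ 2)^-1 => z; lra.
Qed.

Lemma LN_cvg r : LN N r @[N --> \oo] --> Linf r.
Proof. by apply: (psum_cvg (C := 8 * `|r| + 16 * r ^+ 2)) => p pp; exact: logE_le. Qed.

Lemma mN_cvg r : mN N r @[N --> \oo] --> Minf r.
Proof. by apply: (psum_cvg (C := 8 + 16 * `|r|)) => p pp; exact: meanE_le. Qed.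

Lemma sN_cvg r : sN N r @[N --> \oo] --> Sinf r.
Proof.
apply: (psum_cvg (C := 16)) => p pp.
by rewrite ger0_norm ?varE_ge0 ?varE_le.
Qed.

Lemma der_Linf r : is_derive r (1 : R) Linf (Minf r).
Proof.
apply: (@der_of_taylor _ _ _ _ (16 * 9)) => h.
apply: (@limn_norm_le _ (fun N => LN N (r + h) - LN N r - h * mN N r)).
  apply: cvgB; first by apply: cvgB; exact: LN_cvg.
  by apply: cvgM; [exact: cvg_cst|exact: mN_cvg].
move=> N; rewrite /LN /mN -psumZ -!psumB.
apply: (le_trans (ler_norm_psum _ _)).
apply: (@le_trans _ _ (psum N (fun p => (16 * h ^+ 2) * (p%:R ^+ 2)^-1))).
  apply: ler_psum => p pp; have M := model pp.
  have := ln_emom_taylor (tp_w_ge0 M) (tp_w_sum M) (tp_v_le M) r h.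
  rewrite exprMn exprVn /logE /meanE; move: (p%:R ^+ 2)^-1 => z; lra.
rewrite psumZ [leRHS]mulrAC; apply: ler_wpM2l; last exact: psum_inv_sqr_le.
by rewrite mulr_ge0 ?sqr_ge0.
Qed.

Lemma der_Minf r : is_derive r (1 : R) Minf (Sinf r).
Proof.
apply: (@der_of_taylor _ _ _ _ (384 * 9)) => h.
apply: (@limn_norm_le _ (fun N => mN N (r + h) - mN N r - h * sN N r)).
  apply: cvgB; first by apply: cvgB; exact: mN_cvg.
  by apply: cvgM; [exact: cvg_cst|exact: sN_cvg].
move=> N; rewrite /sN /mN -psumZ -!psumB.
apply: (le_trans (ler_norm_psum _ _)).
apply: (@le_trans _ _ (psum N (fun p => (384 * h ^+ 2) * (p%:R ^+ 2)^-1))).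
  apply: ler_psum => p pp; have M := model pp.
  have := tmean_taylor (tp_w_ge0 M) (tp_w_sum M) (tp_v_le M) r h.
  rewrite exprMn exprVn /meanE /varE => /le_trans; apply.
  have p1 : 1 <= p%:R :> R by rewrite ler1n prime_gt0.
  have e : (p%:R ^+ 3)^-1 <= (p%:R ^+ 2)^-1 :> R.
    by rewrite lef_pV2 ?posrE ?exprn_gt0 ?(lt_le_trans _ p1) // ler_weXn2l.
  have : (p%:R ^+ 3)^-1 * h ^+ 2 <= (p%:R ^+ 2)^-1 * h ^+ 2 by rewrite ler_wpM2r ?sqr_ge0.
  move: (_^-1) (_^-1) => y z; have -> : 4 ^+ 3 = 64 :> R by ring.
  lra.
rewrite psumZ [leRHS]mulrAC; apply: ler_wpM2l; last exact: psum_inv_sqr_le.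
by apply: mulr_ge0; [exact: ler0n|exact: sqr_ge0].
Qed.

(** Every prime contributes a nondecreasing mean. Keeping the prime 2 alone leaves a gap independent
    of N, so strict monotonicity survives the limit. *)
Lemma mN_diff_ge r s N : (2 < N)%N -> r <= s -> meanE 2 s - meanE 2 r <= mN N s - mN N r.
Proof.
move=> N3 rs; rewrite /mN -psumB.
have h p : prime p -> 0 <= meanE p s - meanE p r.
  move=> /model M; rewrite subr_ge0.
  exact: (tmean_homo (tp_w_ge0 M) (tp_w_sum M) (tp_v_le M)).
apply: (@le_trans _ _ (psum 3 (fun p => meanE p s - meanE p r))); last exact: psum_le.
by rewrite !psumS psum0 /= !addr0 add0r.
Qed.

Lemma tvar2_gt0 r : 0 < tvar (w 2%N) (v 2%N) r.
Proof.
have M := model (isT : prime 2).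
have a : forall i, 1 / 4 <= w 2%N i -> 0 < tw (w 2%N) (v 2%N) r i.
  move=> i wi; apply: lt_le_trans (tw_lower (tp_w_ge0 M) (tp_w_sum M) (tp_v_le M) wi (lexx _)).
  by rewrite divr_gt0 ?expR_gt0.
rewrite (tvar_pairs (tp_w_ge0 M) (tp_w_sum M) (tp_v_le M)).
have tg i := tw_ge0 (tp_w_ge0 M) (tp_w_sum M) (tp_v_le M) r i.
have g := tp_gap M.
rewrite -addrA; apply: ltr_pwDl; last by rewrite addr_ge0 // mulr_ge0 ?sqr_ge0 // mulr_ge0.
apply: mulr_gt0.
  by apply: mulr_gt0; apply: a; [exact: tp_w0_ge M|exact: tp_w1_ge M].
by apply: exprn_gt0; apply: lt_le_trans g; rewrite divr_gt0.
Qed.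

Lemma Minf_increasing r s : r < s -> Minf r < Minf s.
Proof.
move=> rs; have M := model (isT : prime 2).
apply: (@lt_le_trans _ _ (Minf r + (meanE 2 s - meanE 2 r))).
  rewrite ltrDl subr_gt0.
  have [c _] := mvt_any r s (der_tmean (tp_w_ge0 M) (tp_w_sum M) (tp_v_le M)).
  by move=> e; rewrite -subr_gt0 /meanE e; apply: mulr_gt0; [exact: tvar2_gt0|rewrite subr_gt0].
have hc : mN N s - mN N r @[N --> \oo] --> Minf s - Minf r by apply: cvgB; exact: mN_cvg.
rewrite addrC -lerBrDr -(cvg_lim _ hc) //; apply: limr_ge; first by apply/cvg_ex; eexists; exact: hc.
by exists 3%N => // n /= hn; apply: mN_diff_ge => //; exact: ltW.
Qed.

(** As r grows the tilted mean at p approaches the maximum, at least 1/(2p), and the sum of 1/p over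
    primes diverges. *)
Lemma Minf_unbounded (B : R) : exists2 r, 0 < r & B <= Minf r.
Proof.
have [n hn] := prime_inv_sum_unbounded (2 * (B + 1 + 72)).
(* With this r the distance 12/r to the maximum is 1/(n+1), which adds up to at most 1 over the
   primes below n. The primes from n on lose at most 8 * 9 = 72, their means being at least those at
   r = 0. *)
pose r : R := 12 * n.+1%:R.
have r0 : 0 < r by rewrite mulr_gt0.
exists r => //.
have hN N : (n <= N)%N -> B <= mN N r.
  move=> nN; rewrite /mN -(subrK (psum n (meanE ^~ r)) (psum N _)) psum_diff //.
  have h1 : psum n (meanE ^~ r) >= B + 1 + 72 - 1.
    have : psum n (fun p => (1 / 2) * (p%:R)^-1) - psum n (fun=> n.+1%:R^-1) <= psum n (meanE ^~ r).
      rewrite -psumB; apply: ler_psum => p pp; have M := model pp.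
      have /andP[_] := tmean_gap (tp_w_ge0 M) (tp_w_le1 M) (tp_w_sum M) (tp_v_le M)
        (tp_v_max M) (tp_w0_ge M) r0.
      have -> : 12 / r = n.+1%:R^-1 by rewrite /r; field.
      have := tp_pos M; rewrite -/(meanE p r).
      have -> : 1 / (2 * p%:R) = 1 / 2 * (p%:R)^-1 :> R.
        by field; rewrite gt_eqF // primeR_gt0.
      by move=> h1 h2; rewrite lerBlDr; apply: (le_trans h1); rewrite -lerBlDl.
    rewrite psumZ.
    have : psum n (fun=> n.+1%:R^-1) <= 1 :> R.
      apply: (le_trans (psum_le_sum _ _)) => //.
      rewrite sumr_const_nat subn0 -(mulr_natl (_^-1)) ler_pdivrMr ?ltr0n // mul1r ler_nat //.
    lra.
  have h2 : psum N (fun p => if (n <= p)%N then meanE p r else 0) >= - 72.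
    apply: (@le_trans _ _ (psum N (fun p => (- 8) * (p%:R ^+ 2)^-1))).
      rewrite psumZ; have := @psum_inv_sqr_le R N; lra.
    apply: ler_psum => p pp; have := primeR_gt0 pp => p0.
    have pi0 : 0 <= (p%:R ^+ 2)^-1 :> R by rewrite invr_ge0 sqr_ge0.
    case: ifP => _; last by rewrite mulNr oppr_le0 mulr_ge0.
    have M := model pp.
    have := tmean_homo (tp_w_ge0 M) (tp_w_sum M) (tp_v_le M) (ltW r0).
    have := meanE0_le pp; rewrite /meanE ler_norml => /andP[h _]; lra.
  lra.
have hc := @mN_cvg r.
rewrite -(cvg_lim _ hc) //; apply: limr_ge; first by apply/cvg_ex; eexists; exact: hc.
by exists n.
Qed.

End Model.

(** * Products over primes *)

Section PrimeProduct.
Import Normc.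
Variable R : realType.

Definition pprod (N : nat) (a : nat -> R[i]) : R[i] := \prod_(0 <= p < N | prime p) a p.

Lemma pprod0 a : pprod 0 a = 1.
Proof. by rewrite /pprod big_geq. Qed.

Lemma pprodS N a : pprod N.+1 a = pprod N a * (if prime N then a N else 1).
Proof. by rewrite /pprod !(big_mkcond prime) big_nat_recr. Qed.

Lemma normc_one : normc (1 : R[i]) = 1.
Proof. exact: normc1. Qed.

Lemma pprod_norm_le (a : nat -> R[i]) (h : nat -> R) N :
  (forall p, prime p -> normc (a p) <= expR (- h p)) ->
  normc (pprod N a) <= expR (- psum N h).
Proof.
move=> ha; elim: N => [|N IH]; first by rewrite pprod0 psum0 oppr0 expR0 normc_one.
rewrite pprodS psumS opprD expRD normcM; apply: ler_pM; rewrite ?normc_ge0 //.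
by case: ifP => [/ha//|_]; rewrite oppr0 expR0 normc_one.
Qed.

Lemma normcD_le (x y : R[i]) : normc (x + y) <= normc x + normc y.
Proof. exact: le_normcD. Qed.

(** The factors are exchanged one at a time. The exchanged factor is missing from the decaying bound
    of the product, and since h p <= 1 this costs at most the factor e. *)
Lemma pprod_tele (a b : nat -> R[i]) (h : nat -> R) N :
  (forall p, prime p -> [/\ normc (a p) <= expR (- h p),
     normc (b p) <= expR (- h p) & 0 <= h p <= 1]) ->
  normc (pprod N a - pprod N b) <=
  expR 1 * expR (- psum N h) * psum N (fun p => normc (a p - b p)).
Proof.
move=> H.
elim: N => [|N IH].
  by rewrite !pprod0 !psum0 subrr mulr0 normc0.
have A : normc (pprod N a) <= expR (- psum N h).
  by apply: pprod_norm_le => p pp; have [] := H p pp.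
rewrite !pprodS !psumS; case: ifP => pN; last by rewrite !mulr1 !addr0.
have [h1 h2 /andP[h3 h4]] := H N pN.
have -> : pprod N a * a N - pprod N b * b N =
   pprod N a * (a N - b N) + (pprod N a - pprod N b) * b N by ring.
apply: (le_trans (normcD_le _ _)); rewrite !normcM opprD expRD.
set D := psum N (fun p => normc _); set E := expR (- psum N h); set e := expR (- h N).
have e1 : 1 <= expR 1 * e.
  by rewrite /e -expRD -[leLHS]expR0 ler_expR; lra.
have E0 : 0 <= E by exact: expR_ge0.
have e0 : 0 <= e by exact: expR_ge0.
have d0 := normc_ge0 (a N - b N).
have t1 : normc (pprod N a) * normc (a N - b N) <= expR 1 * (E * e) * normc (a N - b N).
  apply: ler_wpM2r => //; apply: (le_trans A).
  by rewrite mulrCA ler_peMr.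
have t2 : normc (pprod N a - pprod N b) * normc (b N) <= expR 1 * E * D * e.
  by apply: ler_pM; rewrite ?normc_ge0.
rewrite mulrDr addrC; apply: lerD => //.
by apply: (le_trans t2); rewrite le_eqVlt; apply/orP; left; apply/eqP; ring.
Qed.

End PrimeProduct.

(** * The sum over primes below N *)

Section FiniteLaw.
Import Normc.
Variables (R : realType) (w v : nat -> nat -> R).

(* (weight, value) pairs of the law of the sum over the primes below N. *)
Fixpoint atoms N : seq (R * R) :=
  if N is n.+1 then
    if prime n then
      [seq (w n 0%N * x.1, x.2 + v n 0%N) | x <- atoms n] ++
      [seq (w n 1%N * x.1, x.2 + v n 1%N) | x <- atoms n] ++
      [seq (w n 2%N * x.1, x.2 + v n 2%N) | x <- atoms n]
    else atoms n
  else [:: (1, 0)].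

Definition En N (h : R -> R) : R := \sum_(x <- atoms N) x.1 * h x.2.

Lemma En0 h : En 0 h = h 0.
Proof. by rewrite /En /= big_seq1 mul1r. Qed.

Lemma EnS N h : En N.+1 h = if prime N then
   w N 0%N * En N (fun y => h (y + v N 0%N)) + w N 1%N * En N (fun y => h (y + v N 1%N))
   + w N 2%N * En N (fun y => h (y + v N 2%N)) else En N h.
Proof.
rewrite /En /=; case: ifP => // _.
rewrite !big_cat !big_map /= !mulr_sumr addrA; congr (_ + _ + _);
  by apply: eq_bigr => x _; rewrite mulrA.
Qed.

Lemma eq_En N h g : h =1 g -> En N h = En N g.
Proof. by move=> e; apply: eq_bigr => x _; rewrite e. Qed.

Lemma EnZ N c h : En N (fun y => c * h y) = c * En N h.
Proof. by rewrite /En mulr_sumr; apply: eq_bigr => x _; rewrite mulrCA. Qed.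

Hypothesis model : forall p, prime p -> three_point p (w p) (v p).

Lemma emomE_gt0 p r : prime p -> 0 < emom (w p) (v p) 0 r.
Proof. by move=> /model M; exact: (emom0_gt0 (tp_w_ge0 M) (tp_w_sum M) (tp_v_le M)). Qed.

Lemma En_exp N r : En N (fun y => expR (r * y)) = expR (LN w v N r).
Proof.
elim: N => [|N IH]; first by rewrite En0 /LN psum0 mulr0.
rewrite EnS /LN psumS; case: ifP => pN; last by rewrite addr0 -/(LN _ _ _ _).
have h i : En N (fun y => expR (r * (y + v N i))) = expR (r * v N i) * expR (LN w v N r).
  by rewrite -IH -EnZ; apply: eq_En => y; rewrite mulrDr expRD mulrC.
rewrite !h !mulrA -!mulrDl expRD mulrC /logE lnK ?posrE ?emomE_gt0 //.
by rewrite /emom sum3 !expr0 !mulr1.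
Qed.

Definition pchar N r u : R[i] := pprod N (fun p => tchar (w p) (v p) r u).

Lemma ReM (x y : R[i]) : complex.Re (x * y) =
  complex.Re x * complex.Re y - complex.Im x * complex.Im y.
Proof. by case: x y => a b [c d]. Qed.

Lemma cis_tchar p r u A : prime p ->
  cis (A + u * meanE w v p r) * tchar (w p) (v p) r u =
  Complex (tw (w p) (v p) r 0 * cos (A + u * v p 0%N) + tw (w p) (v p) r 1 * cos (A + u * v p 1%N)
     + tw (w p) (v p) r 2 * cos (A + u * v p 2%N))
   (tw (w p) (v p) r 0 * sin (A + u * v p 0%N) + tw (w p) (v p) r 1 * sin (A + u * v p 1%N)
     + tw (w p) (v p) r 2 * sin (A + u * v p 2%N)).
Proof.
move=> pp; rewrite -/(meanE w v p r).
have e i : A + u * v p i = (A + u * meanE w v p r) + u * (v p i - meanE w v p r) by ring.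
rewrite !e /cis /tchar -/(meanE w v p r).
by move: (A + _) => B; rewrite !(cosD B) !(sinD B); simpc; congr Complex; ring.
Qed.

(** The phase t is arbitrary because each new prime shifts it by u times a value. *)
Lemma En_fourier N r u t :
  En N (fun y => expR (r * y) * cos (u * y - t)) =
  expR (LN w v N r) * complex.Re (cis (u * mN w v N r - t) * pchar N r u).
Proof.
elim: N t => [|N IH] t.
  by rewrite En0 /LN /mN /pchar !psum0 pprod0 !mulr0 expR0 !mul1r mulr1.
rewrite EnS /LN /mN /pchar psumS pprodS.
rewrite [psum N.+1 _]psumS.
case: ifP => pN; last by rewrite !addr0 mulr1 IH.
have h i : En N (fun y => expR (r * (y + v N i)) * cos (u * (y + v N i) - t)) =
   expR (r * v N i) * (expR (LN w v N r) *
     complex.Re (cis (u * mN w v N r - t + u * v N i) * pchar N r u)).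
  have -> : u * mN w v N r - t + u * v N i = u * mN w v N r - (t - u * v N i) by ring.
  rewrite -IH -EnZ; apply: eq_En => y; rewrite mulrDr expRD.
  have -> : u * (y + v N i) - t = u * y - (t - u * v N i) by ring.
  by ring.
rewrite !h -/(LN w v N r) -/(mN w v N r) -/(pchar N r u).
have -> : u * (mN w v N r + meanE w v N r) - t = (u * mN w v N r - t) + u * meanE w v N r by ring.
rewrite [pchar N r u * tchar _ _ _ _]mulrC [cis _ * (tchar _ _ _ _ * _)]mulrA cis_tchar //.
rewrite expRD /logE lnK ?posrE ?emomE_gt0 //.
rewrite !ReM /=.
have E0 := emomE_gt0 r pN.
rewrite /tw.
set E := emom _ _ _ _; field.
by rewrite gt_eqF.
Qed.

Lemma pchar_le1 N r u : normc (pchar N r u) <= 1.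
Proof.
rewrite -[leRHS]expR0 -oppr0 -(mul0r (psum N (fun=> 1))) -psumZ.
apply: pprod_norm_le => p /model M; rewrite mul0r oppr0 expR0.
exact: (tchar_le1 (tp_w_ge0 M) (tp_w_sum M) (tp_v_le M)).
Qed.

Definition gaussN N r u : R := expR (- (sN w v N r * u ^+ 2 / 2)).

Lemma gaussN_prod N r u :
  pprod N (fun p => (expR (- (varE w v p r * u ^+ 2 / 2)))%:C%C) = (gaussN N r u)%:C%C.
Proof.
rewrite /gaussN /sN; elim: N => [|N IH].
  by rewrite pprod0 psum0 !mul0r oppr0 expR0.
rewrite pprodS psumS IH; case: ifP => _; last by rewrite mulr1 addr0.
by rewrite -rmorphM /= -expRD; congr (_%:C)%C; congr expR; field.
Qed.

Lemma Fourier_gauss N r u t :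
  `|En N (fun y => expR (r * y) * cos (u * y - t)) / expR (LN w v N r)
    - cos (u * mN w v N r - t) * gaussN N r u| <=
  normc (pchar N r u - (gaussN N r u)%:C%C).
Proof.
rewrite En_fourier mulrAC divff ?mul1r ?gt_eqF ?expR_gt0 //.
have -> : complex.Re (cis (u * mN w v N r - t) * pchar N r u) -
    cos (u * mN w v N r - t) * gaussN N r u =
  complex.Re (cis (u * mN w v N r - t) * (pchar N r u - (gaussN N r u)%:C%C)).
  by rewrite !ReM; case: (pchar N r u) => a b /=; ring.
apply: (le_trans (Re_le_normc _)).
by rewrite normcM normc_cis mul1r.
Qed.

(** Two tilted weights of at least e^{-2}/4 each give e^{-4}/16; the remaining 4 is the one in 1 -
    cos x >= x^2/4. *)
Definition decay_const : R := expR (- 4) / 64.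

Lemma decay_const_gt0 : 0 < decay_const. Proof. by rewrite divr_gt0 ?expR_gt0. Qed.

Lemma decay_const_le1 : decay_const <= 1 / 64.
Proof. by rewrite ler_pM2r // expR_le1; lra. Qed.

Lemma tw01_ge p k : prime p -> 0 <= k -> 16 * k <= p%:R ->
  expR (- 4) / 16 <= tw (w p) (v p) k 0 * tw (w p) (v p) k 1.
Proof.
move=> pp k0 kp; have M := model pp; have p0 := primeR_gt0 R pp.
have hB : `|k| * (4 / p%:R) <= 1.
  by rewrite ger0_norm // mulrA ler_pdivrMr //; lra.
have := tw_lower (tp_w_ge0 M) (tp_w_sum M) (tp_v_le M) (tp_w0_ge M) hB.
have := tw_lower (tp_w_ge0 M) (tp_w_sum M) (tp_v_le M) (tp_w1_ge M) hB.
rewrite mulr1.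
have -> : expR (- 4) = expR (- 2) * expR (- 2) :> R by rewrite -expRD; congr expR; ring.
have := expR_gt0 (- 2 : R); move: (expR (- 2)) => e e0 h1 h0.
have -> : e * e / 16 = (e / 4) * (e / 4) by field.
by apply: ler_pM => //; rewrite divr_ge0 // ltW.
Qed.

Lemma varE_ge p k : prime p -> 0 <= k -> 16 * k <= p%:R ->
  expR (- 4) / 16 / p%:R ^+ 2 <= varE w v p k.
Proof.
move=> pp k0 kp; have M := model pp; have p0 := primeR_gt0 R pp.
have tg i := tw_ge0 (tp_w_ge0 M) (tp_w_sum M) (tp_v_le M) k i.
rewrite /varE (tvar_pairs (tp_w_ge0 M) (tp_w_sum M) (tp_v_le M)).
rewrite -addrA -[leLHS]addr0; apply: lerD; last first.
  by rewrite addr_ge0 // mulr_ge0 ?sqr_ge0 // mulr_ge0.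
apply: ler_pM; [by rewrite divr_ge0 ?expR_ge0|by rewrite invr_ge0 sqr_ge0|exact: tw01_ge|].
have g := tp_gap M; rewrite div1r in g.
by rewrite -exprVn lerXn2r ?nnegrE ?invr_ge0 // ?(ltW p0) // (le_trans _ g) // invr_ge0 ltW.
Qed.

(** The 16 keeps u (v 0 - v 1) <= 8u/p at most 1/2, where 1 - cos is quadratic, and it keeps the
    tilt bounded. One exponent serves both functions, as [pprod_tele] requires. *)
Lemma local_decay p k u : prime p -> 0 <= k -> 0 <= u -> 16 * k <= p%:R -> 16 * u <= p%:R ->
  normc (tchar (w p) (v p) k u) <= expR (- (decay_const * u ^+ 2 * (p%:R ^+ 2)^-1)) /\
  expR (- (varE w v p k * u ^+ 2 / 2)) <= expR (- (decay_const * u ^+ 2 * (p%:R ^+ 2)^-1)).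
Proof.
move=> pp k0 u0 kp up; have M := model pp; have p0 := primeR_gt0 R pp.
have g := tp_gap M; rewrite div1r in g.
have pi0 : 0 < (p%:R)^-1 :> R by rewrite invr_gt0.
have g8 : v p 0%N - v p 1%N <= 8 / p%:R.
  have := tp_v_le M 0; have := tp_v_le M 1; rewrite !ler_norml => /andP[h1 _] /andP[_ h2].
  by move: (_^-1) h1 h2 => z; lra.
split.
  apply: (le_trans (tchar_decay (tp_w_ge0 M) (tp_w_sum M) (tp_v_le M) k _)).
    rewrite ger0_norm; last by rewrite mulr_ge0 // (le_trans _ g) // ltW.
    apply: (@le_trans _ _ (u * (8 / p%:R))); first by rewrite ler_wpM2l.
    by rewrite mulrA ler_pdivrMr //; lra.
  rewrite ler_expR lerN2 exprMn.
  have h := tw01_ge pp k0 kp.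
  have -> : decay_const * u ^+ 2 * (p%:R ^+ 2)^-1 = expR (- 4) / 16 * (u ^+ 2 * ((p%:R)^-1 ^+ 2) / 4).
    by rewrite /decay_const exprVn; field; rewrite gt_eqF.
  apply: ler_pM; [by rewrite divr_ge0 ?expR_ge0|by rewrite divr_ge0 // mulr_ge0 ?sqr_ge0|exact: h|].
  rewrite ler_pM2r ?invr_gt0 //; apply: ler_wpM2l; first exact: sqr_ge0.
  by rewrite lerXn2r ?nnegrE ?(ltW pi0) // (le_trans _ g) // ltW.
rewrite ler_expR lerN2; have h := varE_ge pp k0 kp.
have : expR (-4) / 16 / p%:R ^+ 2 * (u ^+ 2 / 2) <= varE w v p k * (u ^+ 2 / 2).
  by rewrite ler_wpM2r // divr_ge0 ?sqr_ge0.
move=> h4; rewrite -[leRHS]mulrA; apply: le_trans h4.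
have -> : decay_const * u ^+ 2 * (p%:R ^+ 2)^-1 = expR (- 4) * (u ^+ 2 * (p%:R ^+ 2)^-1) / 64.
  by rewrite /decay_const; field; rewrite gt_eqF.
have -> : expR (- 4) / 16 / p%:R ^+ 2 * (u ^+ 2 / 2) = expR (- 4) * (u ^+ 2 * (p%:R ^+ 2)^-1) / 32.
  by field; rewrite gt_eqF.
have : 0 <= expR (- 4) * (u ^+ 2 * (p%:R ^+ 2)^-1).
  by rewrite mulr_ge0 ?expR_ge0 // mulr_ge0 ?sqr_ge0 // invr_ge0 sqr_ge0.
move: (expR _ * _) => z; lra.
Qed.

(** For p <= k the tilt concentrates the law at distance O(1/k) from its maximum; for p > k the
    values themselves are O(1/p). *)
Lemma varE_max p k : prime p -> 0 < k -> varE w v p k <= 24 / Num.max p%:R k ^+ 2.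
Proof.
move=> pp k0; have M := model pp; have p0 := primeR_gt0 R pp.
rewrite maxEle; case: ifP => _.
  exact: (tvar_gap (tp_w_ge0 M) (tp_w_le1 M) (tp_w_sum M) (tp_v_le M) (tp_v_max M) (tp_w0_ge M)).
apply: (le_trans (varE_le model _ pp)); rewrite ler_pM2r ?invr_gt0 ?exprn_gt0 //; lra.
Qed.

Definition skew_const : R := 7200.

Lemma skew_const_ge0 : 0 <= skew_const. Proof. exact: ler0n. Qed.

Lemma tabs3_max p k : prime p -> 0 < k -> tabs3 (w p) (v p) k <= skew_const / Num.max p%:R k ^+ 3.
Proof.
rewrite /skew_const.
move=> pp k0; have M := model pp; have p0 := primeR_gt0 R pp.
rewrite maxEle; case: ifP => _.
  exact: (tabs3_gap (tp_w_ge0 M) (tp_w_le1 M) (tp_w_sum M) (tp_v_le M) (tp_v_max M) (tp_w0_ge M)).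
apply: (le_trans (tabs3_le (tp_w_ge0 M) (tp_w_sum M) (tp_v_le M) _)).
rewrite exprMn exprVn mulrA ler_pM2r ?invr_gt0 ?exprn_gt0 //.
by have -> : 8 * 4 ^+ 3 = 512 :> R by [ring]; lra.
Qed.

(** With u <= k <= m, one factor 1/m of the third moment and one of the u's in the squared exponent
    are traded for 1/k, so that both errors carry the weight 1/m^2 that is summed over primes. *)
Lemma gauss_error_le (A b s u k m : R) : 0 <= A -> 0 < k -> k <= m -> 0 <= u <= k ->
  b <= A / m ^+ 3 -> 0 <= s <= 24 / m ^+ 2 ->
  3 * b * u ^+ 3 + (s * u ^+ 2 / 2) ^+ 2 <= ((3 * A + 144) * u ^+ 3 / k) * (m ^+ 2)^-1.
Proof.
move=> A0 k0 km /andP[u0 uk] h1 /andP[h3 h2].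
have m0 : 0 < m by lra.
have t1 : 3 * b * u ^+ 3 <= 3 * A * u ^+ 3 / k * (m ^+ 2)^-1.
  have -> : 3 * A * u ^+ 3 / k * (m ^+ 2)^-1 = 3 * (A / (k * m ^+ 2)) * u ^+ 3.
    by field; rewrite !gt_eqF.
  rewrite ler_wpM2r ?exprn_ge0 // ler_wpM2l //; apply: (le_trans h1).
  rewrite ler_wpM2l // lef_pV2 ?posrE ?mulr_gt0 ?exprn_gt0 //.
  by rewrite [m ^+ 3]exprS ler_wpM2r ?exprn_ge0 // ltW.
have t2 : (s * u ^+ 2 / 2) ^+ 2 <= 144 * u ^+ 3 / k * (m ^+ 2)^-1.
  apply: (@le_trans _ _ ((12 / m ^+ 2 * u ^+ 2) ^+ 2)).
    apply: lerXn2r; rewrite ?nnegrE.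
    - by rewrite divr_ge0 // mulr_ge0 ?sqr_ge0.
    - by rewrite mulr_ge0 ?sqr_ge0 // divr_ge0 // sqr_ge0.
    - have -> : 12 / m ^+ 2 * u ^+ 2 = (24 / m ^+ 2) * u ^+ 2 / 2 by field; rewrite gt_eqF.
      by rewrite ler_pM2r ?invr_gt0 // ler_wpM2r ?sqr_ge0.
  have -> : (12 / m ^+ 2 * u ^+ 2) ^+ 2 = 144 * u ^+ 3 * (m ^+ 2)^-1 * (u / m ^+ 2).
    by field; rewrite gt_eqF.
  have -> : 144 * u ^+ 3 / k * (m ^+ 2)^-1 = 144 * u ^+ 3 * (m ^+ 2)^-1 * k^-1.
    by field; rewrite !gt_eqF.
  apply: ler_wpM2l.
    by rewrite mulr_ge0 ?invr_ge0 ?sqr_ge0 // mulr_ge0 // exprn_ge0.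
  rewrite ler_pdivrMr ?exprn_gt0 // mulrC ler_pdivlMr // expr2.
  by nra.
have -> : (3 * A + 144) * u ^+ 3 / k / m ^+ 2 = 3 * A * u ^+ 3 / k / m ^+ 2 + 144 * u ^+ 3 / k / m ^+ 2.
  by field; rewrite !gt_eqF.
exact: lerD.
Qed.


Lemma local_gauss : exists2 C : R, 0 <= C & forall p k u, prime p -> 0 < k -> 0 <= u <= k ->
  normc (tchar (w p) (v p) k u - (expR (- (varE w v p k * u ^+ 2 / 2)))%:C%C) <=
  (C * u ^+ 3 / k) * (Num.max p%:R k ^+ 2)^-1.
Proof.
exists (3 * skew_const + 144); first by rewrite addr_ge0 // mulr_ge0 // skew_const_ge0.
move=> p k u pp k0 uk; have M := model pp.
apply: (le_trans (tchar_gauss (tp_w_ge0 M) (tp_w_sum M) (tp_v_le M) _ _)).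
have /andP[u0 _] := uk.
rewrite -/(varE w v p k) (ger0_norm u0).
apply: (@gauss_error_le skew_const); [exact: skew_const_ge0|exact: k0| |exact: uk| |].
- by rewrite le_max lexx orbT.
- exact: tabs3_max.
- by rewrite varE_ge0 // varE_max.
Qed.

Lemma sN_upper N k : 4 <= k -> sN w v N k <= 2688 / (k * ln k).
Proof.
move=> k4; apply: (@le_trans _ _ (psum N (fun p => 24 * (Num.max p%:R k ^+ 2)^-1))).
  by apply: ler_psum => p pp; apply: varE_max => //; lra.
rewrite psumZ; have := prime_sum_max_sqr N k4.
by move: (_^-1) => z; lra.
Qed.

End FiniteLaw.

(** * Decay of the tilted characteristic function and its distance to the Gaussian *)

Section CharacteristicFunction.
Import Normc.
Variables (R : realType) (w v : nat -> nat -> R).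
Hypothesis model : forall p, prime p -> three_point p (w p) (v p).

(** Applied with y = k when u <= k and with y = u beyond. The lower end 16 y is the threshold of
    [local_decay] for both k and u. *)
Definition window (K y : R) (p : nat) : bool := (16 * y < p%:R) && (p%:R <= K * (16 * y)).

Definition window_sum (K y : R) N : R := psum N (fun p => if window K y p then (p%:R ^+ 2)^-1 else 0).

Lemma window_sum_ge : exists K c : R, [/\ 16 <= K, 0 < c &
  forall (y : R) N, K <= y -> 16 * K * y < N%:R -> c / (y * ln y) <= window_sum K y N].
Proof.
have [K0 [c [K04 c0 h]]] := @prime_window R.
pose K : R := Num.max K0 16.
have K16 : 16 <= K by rewrite le_max lexx orbT.
have KK0 : K0 <= K by rewrite le_max lexx.
exists K, (c / 32); split => //; first by rewrite divr_gt0.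
move=> y N Ky KN.
have y16 : 16 <= y by lra.
have lny : 0 < ln y by rewrite ln_gt0 //; lra.
have l16 : ln (16 * y) <= 2 * ln y.
  rewrite lnM ?posrE; [|lra..].
  have : ln 16 <= ln y by rewrite ler_ln ?posrE; lra.
  lra.
have l16p : 0 < ln (16 * y) by rewrite ln_gt0 //; lra.
have := h (16 * y) N ltac:(lra) ltac:(nra).
move=> h1; apply: (@le_trans _ _ (c / (16 * y * ln (16 * y)))).
  rewrite -mulrA -invfM ler_pM2l // lef_pV2 ?posrE ?mulr_gt0 //; nra.
apply: (le_trans h1); apply: ler_psum => p pp; rewrite /window.
case: ifP => [/andP[h2 h3]|_]; last by case: ifP => // _; rewrite invr_ge0 sqr_ge0.
by rewrite h2 /= (le_trans h3) // ler_wpM2r //; lra.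
Qed.

Definition window_weight (K y u : R) (p : nat) : R :=
  if window K y p then decay_const R * u ^+ 2 * (p%:R ^+ 2)^-1 else 0.

Lemma psum_window_weight K y u N : psum N (window_weight K y u) = decay_const R * u ^+ 2 * window_sum K y N.
Proof.
rewrite /window_sum -psumZ; apply: eq_psum => p _; rewrite /window_weight.
by case: ifP => // _; rewrite mulr0.
Qed.

Lemma window_weight_spec K y k u p : prime p -> 0 <= k <= y -> 0 <= u <= y -> 1 <= y ->
  [/\ normc (tchar (w p) (v p) k u) <= expR (- window_weight K y u p),
     normc (expR (- (varE w v p k * u ^+ 2 / 2)))%:C%C <= expR (- window_weight K y u p)
     & 0 <= window_weight K y u p <= 1].
Proof.
move=> pp /andP[k0 ky] /andP[u0 uy] y1; have M := model pp.
rewrite normc_real (ger0_norm (expR_ge0 _)) /window_weight; case: ifP => [/andP[h1 _]|_].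
  have kp : 16 * k <= p%:R by lra.
  have up : 16 * u <= p%:R by lra.
  have [d1 d2] := local_decay model pp k0 u0 kp up.
  split => //.
  have p0 := primeR_gt0 R pp.
  rewrite mulr_ge0 ?invr_ge0 ?sqr_ge0 ?mulr_ge0 ?sqr_ge0 ?(ltW (decay_const_gt0 R)) //=.
  rewrite ler_pdivrMr ?exprn_gt0 // mul1r.
  have := decay_const_le1 R; have := decay_const_gt0 R; nra.
rewrite oppr0 expR0 ler01 lexx; split => //.
  exact: (tchar_le1 (tp_w_ge0 M) (tp_w_sum M) (tp_v_le M)).
by rewrite -[leRHS]expR0 ler_expR oppr_le0 divr_ge0 // mulr_ge0 ?sqr_ge0 // varE_ge0.
Qed.

Lemma pow3_gauss_le (c t : R) : 0 < c -> 0 <= t ->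
  t ^+ 3 * expR (- (c * t ^+ 2)) <= (1 + 8 / c ^+ 2) * expR (- (c / 2 * t ^+ 2)).
Proof.
move=> c0 t0; pose z := c / 2 * t ^+ 2.
have z0 : 0 <= z by rewrite mulr_ge0 ?sqr_ge0 // divr_ge0 // ltW.
have -> : - (c * t ^+ 2) = - z - z by rewrite /z; field.
rewrite -/z expRD mulrA; apply: ler_wpM2r; first exact: expR_ge0.
have h := pow_expRN_le 2 z0.
rewrite (_ : 2`!%:R = 2 :> R) // in h.
have e1 : expR (- z) <= 1 by rewrite expR_le1 oppr_le0.
have t34 : t ^+ 3 <= 1 + t ^+ 4.
  have [t1|t1] := leP t 1.
    have : t ^+ 3 <= 1 by rewrite exprn_ile1.
    have : 0 <= t ^+ 4 by rewrite exprn_ge0.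
    lra.
  have : t ^+ 3 <= t ^+ 4 by rewrite ler_weXn2l // ltW.
  lra.
have : t ^+ 3 * expR (- z) <= (1 + t ^+ 4) * expR (- z) by rewrite ler_wpM2r ?expR_ge0.
move/le_trans; apply; rewrite mulrDl mul1r; apply: lerD => //.
have -> : t ^+ 4 = (4 / c ^+ 2) * z ^+ 2 by rewrite /z; field; rewrite gt_eqF.
rewrite -[leLHS]mulrA; have -> : 8 / c ^+ 2 = 4 / c ^+ 2 * 2 by ring.
by apply: ler_wpM2l => //; rewrite divr_ge0 ?sqr_ge0.
Qed.

(** As ln u <= 2 sqrt u, the exponent is at least z = c sqrt u / 2 in size, and z^4 e^{-z} <= 24
    yields decay like 1/u^2. The majorant 1/(1 + u^2) is chosen for its explicit integral. *)
Lemma expR_u_ln_le (c u : R) : 0 < c -> 3 <= u ->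
  expR (- (c * u ^+ 2 / (u * ln u))) <= 768 / c ^+ 4 / (1 + u ^+ 2).
Proof.
move=> c0 u3; have lu : 0 < ln u by rewrite ln_gt0 //; lra.
have su : 0 < Num.sqrt u by rewrite sqrtr_gt0; lra.
have suu : Num.sqrt u ^+ 2 = u by rewrite sqr_sqrtr //; lra.
pose z := c * Num.sqrt u / 2.
have z0 : 0 < z by rewrite divr_gt0 // mulr_gt0.
apply: (@le_trans _ _ (expR (- z))).
  rewrite ler_expR lerN2.
  have -> : c * u ^+ 2 / (u * ln u) = c * u / ln u by field; rewrite !gt_eqF //; lra.
  rewrite ler_pdivlMr // /z.
  have := @ln_le_2sqrt R u ltac:(lra) => h.
  have : c * Num.sqrt u / 2 * ln u <= c * Num.sqrt u / 2 * (2 * Num.sqrt u).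
    by rewrite ler_wpM2l // ltW.
  move/le_trans; apply; rewrite -{3}suu; rewrite le_eqVlt; apply/orP; left; apply/eqP; by field.
have h := pow_expRN_le 4 (ltW z0).
rewrite (_ : 4`!%:R = 24 :> R) // in h.
have z4 : z ^+ 4 = c ^+ 4 * u ^+ 2 / 16 by rewrite /z -[in RHS]suu; field.
rewrite z4 in h.
have c4 : 0 < c ^+ 4 by rewrite exprn_gt0.
rewrite -mulrA -invfM ler_pdivlMr ?mulr_gt0 //; last by nra.
have e0 := expR_ge0 (- z).
have u2 : 1 <= u ^+ 2 by nra.
have : expR (- z) * (c ^+ 4 * (1 + u ^+ 2)) <= expR (- z) * (c ^+ 4 * (2 * u ^+ 2)).
  by rewrite ler_wpM2l // ler_wpM2l ?(ltW c4) //; lra.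
move: (expR _) (c ^+ 4) (u ^+ 2) h => e d q h h2.
have : e * (d * (2 * q)) = 32 * (d * q / 16 * e) by field.
lra.
Qed.

Section Constants.
Variables (K cw : R).
Hypotheses (K16 : 16 <= K) (cw0 : 0 < cw).
Hypothesis hW : forall (y : R) N, K <= y -> 16 * K * y < N%:R ->
  cw / (y * ln y) <= window_sum K y N.
Let c1 := decay_const R * cw.

Lemma c1_gt0 : 0 < c1. Proof. by apply: mulr_gt0 => //; exact: decay_const_gt0. Qed.

Lemma decay_exponent y u N : K <= y -> 16 * K * y < N%:R ->
  expR (- psum N (window_weight K y u)) <= expR (- (c1 * (u ^+ 2 / (y * ln y)))).
Proof.
move=> Ky KN; rewrite psum_window_weight ler_expR lerN2.
have : decay_const R * u ^+ 2 * (cw / (y * ln y)) <= decay_const R * u ^+ 2 * window_sum K y N.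
  apply: ler_wpM2l; last exact: hW.
  by apply: mulr_ge0; [apply: ltW; exact: decay_const_gt0|exact: sqr_ge0].
apply: le_trans; rewrite /c1.
have -> : decay_const R * u ^+ 2 * (cw / (y * ln y)) = decay_const R * cw * (u ^+ 2 / (y * ln y)) by ring.
exact: lexx.
Qed.

Lemma sN_lower k N : K <= k -> 16 * K * k < N%:R -> c1 / (k * ln k) <= sN w v N k.
Proof.
move=> Kk KN; have hWk := hW Kk KN; have k16 := le_trans K16 Kk.
have lk : 0 < ln k by rewrite ln_gt0 //; lra.
have B0 : 0 < k * ln k by apply: mulr_gt0 => //; lra.
have W0 : 0 <= window_sum K k N.
  by apply: le_trans hWk; apply: divr_ge0; exact: ltW.
have h1 : expR (- 4) / 16 * window_sum K k N <= sN w v N k.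
  rewrite /window_sum -psumZ; apply: ler_psum => p pp; case: ifP => [/andP[h1 _]|_].
    by apply: varE_ge => //; lra.
  by rewrite mulr0; apply: varE_ge0.
apply: le_trans h1.
have h2 : decay_const R * window_sum K k N <= expR (- 4) / 16 * window_sum K k N.
  by apply: ler_wpM2r => //; rewrite /decay_const ler_pM2l ?expR_gt0 //; lra.
apply: le_trans h2; rewrite /c1 -mulrA; apply: ler_wpM2l => //.
by apply: ltW; exact: decay_const_gt0.
Qed.

Lemma char_large k N u : K <= k -> k <= u -> 16 * K * u < N%:R ->
  normc (pchar w v N k u - (gaussN w v N k u)%:C%C) <= 2 * (768 / c1 ^+ 4) / (1 + u ^+ 2).
Proof.
move=> Kk ku KuN; have k16 := le_trans K16 Kk.
have u3 : 3 <= u by lra.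
have Ku : K <= u by lra.
have kk : 0 <= k <= u by rewrite ku andbT; lra.
have uu : 0 <= u <= u by rewrite lexx andbT; lra.
have u1 : 1 <= u by lra.
have sp p (pp : prime p) := @window_weight_spec K u k u p pp kk uu u1.
have he : expR (- psum N (window_weight K u u)) <= 768 / c1 ^+ 4 / (1 + u ^+ 2).
  apply: le_trans (expR_u_ln_le c1_gt0 u3); rewrite -mulrA.
  exact: decay_exponent.
have h1 : normc (pchar w v N k u) <= expR (- psum N (window_weight K u u)).
  by apply: pprod_norm_le => p pp; have [] := sp p pp.
have h2 : normc (gaussN w v N k u)%:C%C <= expR (- psum N (window_weight K u u)).
  by rewrite -gaussN_prod; apply: pprod_norm_le => p pp; have [] := sp p pp.
apply: (le_trans (normcD_le _ _)); rewrite normcN -mulrA.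
move: (expR _) (768 / _ / _) he h1 h2 => e x; lra.
Qed.

Variable C3 : R.
Hypothesis C30 : 0 <= C3.
Hypothesis hloc : forall p k u, prime p -> 0 < k -> 0 <= u <= k ->
  normc (tchar (w p) (v p) k u - (expR (- (varE w v p k * u ^+ 2 / 2)))%:C%C) <=
  (C3 * u ^+ 3 / k) * (Num.max p%:R k ^+ 2)^-1.

(** Telescoping over the primes gives an error of order u^3/(k B) e^{-c u^2/B} with B = k ln k. In
    terms of t = u/sqrt B this is (sqrt B/k) t^3 e^{-c t^2}, and half of the exponent absorbs
    t^3. *)
Lemma char_small k N u : K <= k -> 16 * K * k < N%:R -> 0 <= u <= k ->
  normc (pchar w v N k u - (gaussN w v N k u)%:C%C) <=
  expR 1 * (C3 * 112) * (1 + 8 / c1 ^+ 2) * (Num.sqrt (k * ln k) / k) *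
  expR (- (c1 / 2 * (u ^+ 2 / (k * ln k)))).
Proof.
move=> Kk KN /andP[u0 uk]; have k16 := le_trans K16 Kk.
have k0 : 0 < k by lra.
have lk : 0 < ln k by rewrite ln_gt0 //; lra.
have B0 : 0 < k * ln k by exact: mulr_gt0.
have he := decay_exponent u Kk KN.
have := @pprod_tele R (fun p => tchar (w p) (v p) k u)
   (fun p => (expR (- (varE w v p k * u ^+ 2 / 2)))%:C%C) (window_weight K k u) N.
rewrite gaussN_prod -/(pchar w v N k u) => h.
have kk : 0 <= k <= k by rewrite lexx andbT ltW.
have uuk : 0 <= u <= k by rewrite u0.
have k1 : 1 <= k by lra.
have {}h := h (fun p pp => @window_weight_spec K k k u p pp kk uuk k1).
apply: (le_trans h).
have hd : psum N (fun p => normc (tchar (w p) (v p) k u - (expR (- (varE w v p k * u ^+ 2 / 2)))%:C%C))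
   <= (C3 * u ^+ 3 / k) * (112 / (k * ln k)).
  apply: (@le_trans _ _ (psum N (fun p => (C3 * u ^+ 3 / k) * (Num.max p%:R k ^+ 2)^-1))).
    by apply: ler_psum => p pp; apply: hloc.
  rewrite psumZ; apply: ler_wpM2l; last by apply: prime_sum_max_sqr; lra.
  by apply: divr_ge0; [apply: mulr_ge0 => //; apply: exprn_ge0|exact: ltW].
move: hd he; set s := Num.sqrt (k * ln k).
set D := psum N (fun p => normc _); set E := expR (- psum _ _).
have s0 : 0 < s by rewrite sqrtr_gt0.
have ss : s ^+ 2 = k * ln k by rewrite sqr_sqrtr // ltW.
rewrite -ss; set Q := (112 : R).
have Q0 : 0 <= Q by exact: ler0n.
move: Q Q0 => Q Q0.
pose t := u / s.
have t0 : 0 <= t by apply: divr_ge0 => //; exact: ltW.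
have ut : u = t * s by rewrite /t divfK // gt_eqF.
have utt : u ^+ 2 / s ^+ 2 = t ^+ 2 by rewrite /t exprMn exprVn.
rewrite utt => hd he.
have e10 : 0 <= expR 1 :> R by exact: expR_ge0.
apply: (@le_trans _ _ (expR 1 * expR (- (c1 * t ^+ 2)) * (C3 * u ^+ 3 / k * (Q / s ^+ 2)))).
  apply: ler_pM; [by apply: mulr_ge0; [|exact: expR_ge0]| |by apply: ler_wpM2l|exact: hd].
  by apply: psum_ge0 => p _; exact: normc_ge0.
have -> : expR 1 * expR (- (c1 * t ^+ 2)) * (C3 * u ^+ 3 / k * (Q / s ^+ 2)) =
   (expR 1 * (C3 * Q)) * (s / k) * (t ^+ 3 * expR (- (c1 * t ^+ 2))).
  by rewrite ut; field; rewrite !gt_eqF.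
have h3 := pow3_gauss_le c1_gt0 t0.
have a0 : 0 <= expR 1 * (C3 * Q) * (s / k).
  apply: mulr_ge0; last by apply: divr_ge0; exact: ltW.
  by apply: mulr_ge0 => //; apply: mulr_ge0.
apply: (le_trans (ler_wpM2l a0 h3)).
rewrite [leLHS]mulrA; apply: ler_wpM2r; first exact: expR_ge0.
have -> : expR 1 * (C3 * Q) * (s / k) * (1 + 8 / c1 ^+ 2) =
  expR 1 * (C3 * Q) * (1 + 8 / c1 ^+ 2) * (s / k) by ring.
exact: lexx.
Qed.

End Constants.

Lemma char_bounds : exists C c K : R, [/\ 0 < C, 0 < c, 16 <= K &
  forall k N, K <= k -> 16 * K * k < N%:R ->
  [/\ c / (k * ln k) <= sN w v N k,
   forall u, 0 <= u <= k -> normc (pchar w v N k u - (gaussN w v N k u)%:C%C) <=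
      C * (Num.sqrt (k * ln k) / k) * expR (- (c * (u ^+ 2 / (k * ln k)))) &
   forall u, k <= u -> 16 * K * u < N%:R ->
      normc (pchar w v N k u - (gaussN w v N k u)%:C%C) <= C / (1 + u ^+ 2)]].
Proof.
have [K [cw [K16 cw0 hW]]] := window_sum_ge.
have [C3 C30 hloc] := local_gauss model.
have c10 := c1_gt0 cw0.
have sl := sN_lower K16 cw0 hW.
have cs := char_small K16 cw0 hW C30 hloc.
have cl := char_large K16 cw0 hW.
move: (decay_const R * cw) c10 sl cs cl => c1 c10 sl cs cl.
move: (expR 1 * (C3 * 112) * _) cs => C1 cs.
move: (2 * (768 / c1 ^+ 4)) cl => C2 cl.
have C0 : 0 < `|C1| + `|C2| + 1 by rewrite ltr_pwDr // addr_ge0.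
exists (`|C1| + `|C2| + 1), (c1 / 2), K; split => //; first by rewrite divr_gt0.
move=> k N Kk KN.
have k0 : 0 < k by lra.
have lk : 0 < ln k by rewrite ln_gt0 //; lra.
have B0 : 0 < k * ln k by exact: mulr_gt0.
split.
- apply: le_trans (sl _ _ Kk KN); apply: ler_wpM2r; first by rewrite invr_ge0 ltW.
  lra.
- move=> u hu; apply: (le_trans (cs _ _ _ Kk KN hu)); apply: ler_wpM2r; first exact: expR_ge0.
  apply: ler_wpM2r; first by apply: divr_ge0; [exact: sqrtr_ge0|exact: ltW].
  by have := ler_norm C1; have := normr_ge0 C2; lra.
move=> u ku KuN; apply: (le_trans (cl _ _ _ Kk ku KuN)); apply: ler_wpM2r.
  by rewrite invr_ge0 addr_ge0 // sqr_ge0.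
by have := ler_norm C2; have := normr_ge0 C1; lra.
Qed.

End CharacteristicFunction.

(** * Fourier inversion with a Poisson kernel *)

Section HalfLineIntegrals.
Variable R : realType.
Notation mu := (@lebesgue_measure R).
Let D : set (measurableTypeR R) := `[0%R, +oo[%classic.

(** Half-line integral: integrability and value travel together, so that linear combinations need no
    side conditions. *)
Definition hint (f : R -> R) (I : R) : Prop :=
  mu.-integrable D (EFin \o f) /\ (\int[mu]_(x in D) f x)%R = I.

Let mD : measurable D. Proof. exact: measurable_itv. Qed.

Lemma hint_of_ereal (f : R -> R) I : (forall x, 0 <= x -> 0 <= f x) -> continuous f ->
  (\int[mu]_(x in D) (f x)%:E)%E = I%:E -> hint f I.
Proof.
move=> f0 cf e; split; last by rewrite /Rintegral e.
have fD x : D x -> (0 <= (f x)%:E)%E.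
  by rewrite /D /= in_itv /= andbT lee_fin => /f0.
apply/integrableP; split.
  by apply/measurable_EFinP; apply: measurable_funTS; exact: continuous_measurable_fun.
have -> : (\int[mu]_(x in D) `|(EFin \o f) x|)%E = (\int[mu]_(x in D) (f x)%:E)%E.
  by apply: eq_integral => x; rewrite inE => /fD h; rewrite gee0_abs.
by rewrite e ltry.
Qed.

Lemma hintD f g I J : hint f I -> hint g J -> hint (fun x => f x + g x) (I + J).
Proof.
move=> [f1 f2] [g1 g2]; split.
  by apply: eq_integrable (integrableD mD f1 g1) => //= x _; rewrite EFinD.
by rewrite RintegralD // f2 g2.
Qed.

Lemma hintZ c f I : hint f I -> hint (fun x => c * f x) (c * I).
Proof.
move=> [f1 f2]; split.
  by apply: eq_integrable (integrableZl mD c f1) => //= x _; rewrite EFinM.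
by rewrite RintegralZl // f2.
Qed.

Lemma hint0 : hint (fun=> 0) 0.
Proof.
split; first exact: integrable0.
by rewrite /Rintegral integral0.
Qed.

Lemma hint_ext f g I : (forall x, f x = g x) -> hint f I -> hint g I.
Proof. by move=> /funext ->. Qed.

Lemma hint_sum (s : seq (R * R)) (F : R -> R -> R) (G : R -> R) :
  (forall y, hint (F y) (G y)) ->
  hint (fun u => \sum_(x <- s) x.1 * F x.2 u) (\sum_(x <- s) x.1 * G x.2).
Proof.
move=> h; elim: s => [|x s IH].
  by apply: (hint_ext (f := fun=> 0)); [move=> u|]; rewrite big_nil //; exact: hint0.
rewrite big_cons; apply: (hint_ext (f := fun u => x.1 * F x.2 u + \sum_(x <- s) x.1 * F x.2 u)).
  by move=> u; rewrite big_cons.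
by apply: hintD => //; exact: hintZ.
Qed.

Lemma hint_dist f g psi I J K : hint f I -> hint g J -> hint psi K ->
  (forall u, 0 <= u -> `|f u - g u| <= psi u) -> `|I - J| <= K.
Proof.
move=> [f1 f2] [g1 g2] [p1 p2] h.
rewrite -f2 -g2 -p2 -RintegralB //.
have fg : mu.-integrable D (EFin \o (fun x => f x - g x)).
  by apply: eq_integrable (integrableB mD f1 g1) => //= x _; rewrite EFinB.
apply: (le_trans (le_normr_Rintegral _ fg)) => //.
apply: le_Rintegral => //; first exact: (integrable_norm fg).
by move=> x; rewrite /D /= in_itv /= andbT => /h.
Qed.

Lemma cvg_expRN_scale (a : R) : 0 < a -> expR (- (a * u)) @[u --> +oo%R] --> (0 : R).
Proof.
move=> a0; apply: (@cvg_comp _ _ _ (fun u => a * u) (fun x => expR (- x)) _ +oo%R); last exact: cvgr_expR.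
by apply: gt0_cvgMry => //; exact: cvg_id.
Qed.

Lemma der_expRN (a u : R) : is_derive u (1 : R) (fun x => expR (- (a * x))) (- a * expR (- (a * u))).
Proof.
have h := der_comp (g := fun x => - a * x) (is_derive_expR (- a * u)) (der_scale (- a) (der_id u)).
have -> : (fun x => expR (- (a * x))) = (fun x => expR (- a * x)).
  by apply/funext => x; rewrite mulNr.
by apply: is_derive_eq h _; rewrite mulr1 mulrC !mulNr.
Qed.

Lemma hint_FTC (f F : R -> R) l : (forall x, 0 <= x -> 0 <= f x) -> continuous f ->
  (forall x, is_derive x (1 : R) F (f x)) -> F x @[x --> +oo%R] --> l -> hint f (l - F 0).
Proof.
move=> f0 cf dF Fl; apply: hint_of_ereal => //.
rewrite (@ge0_continuous_FTC2y R f F 0 l) //.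
- exact: continuous_subspaceT.
- apply: cvg_at_right_filter; exact: (der_continuous dF).
- by move=> x _; rewrite derive1E; have [_ ->] := dF x.
Qed.

Lemma continuous_expRN (a : R) : continuous (fun x : R => expR (- (a * x))).
Proof. exact: der_continuous (der_expRN a). Qed.

Lemma hint_exp (a : R) : 0 < a -> hint (fun u => expR (- (a * u))) a^-1.
Proof.
move=> a0.
have := @hint_FTC (fun u => expR (- (a * u))) (fun u => - a^-1 * expR (- (a * u))) 0.
rewrite mulr0 oppr0 expR0 mulr1 sub0r opprK; apply.
- by move=> x _; exact: expR_ge0.
- exact: continuous_expRN.
- move=> x; apply: is_derive_eq (der_scale _ (der_expRN a x)) _.
  by field; rewrite gt_eqF.
- have := cvgM (cvg_cst (- a^-1)) (cvg_expRN_scale a0); rewrite mulr0; apply.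
Qed.

Lemma hint_poisson (a z : R) : 0 < a ->
  hint (fun u => expR (- (a * u)) * cos (u * z)) (a / (a ^+ 2 + z ^+ 2)).
Proof.
move=> a0; set q := a ^+ 2 + z ^+ 2.
have q0 : 0 < q by rewrite ltr_pwDl ?exprn_gt0 ?sqr_ge0.
pose E u := expR (- (a * u)).
(* A primitive of e^{-au}(1 + cos(uz)), because [hint_FTC] wants a nonnegative integrand; the
   integral of e^{-au} is subtracted at the end. *)
pose F u := - a^-1 * E u + q^-1 * (E u * (z * sin (u * z) + (- a) * cos (u * z))).
have dsin u : is_derive u (1 : R) (fun x => sin (x * z)) (cos (u * z) * z).
  have h := der_comp (g := fun x => x * z) (is_derive_sin (u * z)) (der_mul (der_id u) (der_cst z u)).
  by apply: is_derive_eq h _; rewrite mul1r mulr0 addr0.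
have dcos u : is_derive u (1 : R) (fun x => cos (x * z)) (- sin (u * z) * z).
  have h := der_comp (g := fun x => x * z) (is_derive_cos (u * z)) (der_mul (der_id u) (der_cst z u)).
  by apply: is_derive_eq h _; rewrite mul1r mulr0 addr0.
have dF u : is_derive u (1 : R) F (E u * (1 + cos (u * z))).
  have h := der_add (der_scale (- a^-1) (der_expRN a u)) (der_scale q^-1
    (der_mul (der_expRN a u) (der_add (der_scale z (dsin u)) (der_scale (- a) (dcos u))))).
  apply: is_derive_eq h _; rewrite -/(E u).
  have -> : - a * E u * (z * sin (u * z) + - a * cos (u * z)) +
    E u * (z * (cos (u * z) * z) + - a * (- sin (u * z) * z)) = E u * (q * cos (u * z)).
    by rewrite /q; ring.
  by field; rewrite !gt_eqF.
have cE : continuous E by exact: continuous_expRN.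
have ccos : continuous (fun u : R => cos (u * z)) by exact: der_continuous dcos.
have E0 : E u @[u --> +oo%R] --> (0 : R) by exact: cvg_expRN_scale.
have lF : F u @[u --> +oo%R] --> (0 : R).
  suff Z0 : E u * (z * sin (u * z) + - a * cos (u * z)) @[u --> +oo%R] --> (0 : R).
    have := cvgD (cvgM (cvg_cst (- a^-1)) E0) (cvgM (cvg_cst q^-1) Z0).
    by rewrite !mulr0 addr0; apply.
  apply/cvgrPdist_le => eps e0.
  have C0 : 0 < `|z| + a by rewrite ltr_wpDl.
  have e1 : 0 < eps / (`|z| + a) by rewrite divr_gt0.
  move/cvgrPdist_le : E0 => /(_ _ e1); apply: filterS => u.
  rewrite !sub0r !normrN normrM ler_pdivlMr // => h; apply: le_trans h.
  apply: ler_wpM2l => //; apply: (le_trans (ler_normD _ _)).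
  rewrite !normrM normrN (ger0_norm (ltW a0)); apply: lerD.
    by rewrite ler_piMr // sin_max.
  by rewrite ler_piMr // ?(ltW a0) // cos_max.
have h1 := @hint_FTC (fun u => E u * (1 + cos (u * z))) F 0 _ _ dF lF.
have {}h1 : hint (fun u => E u * (1 + cos (u * z))) (0 - F 0).
  apply: h1.
    move=> x _; apply: mulr_ge0; first exact: expR_ge0.
    by have := cos_geN1 (x * z); lra.
  by move=> x; apply: cvgM; [exact: cE|apply: cvgD; [exact: cvg_cst|exact: ccos]].
have h2 := hintD h1 (hintZ (-1) (hint_exp a0)).
have -> : a / q = 0 - F 0 + -1 * a^-1.
  rewrite /F /E mulr0 mul0r oppr0 expR0 sin0 cos0.
  by field; rewrite !gt_eqF.
apply: hint_ext h2 => u; rewrite /E; ring.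
Qed.

Lemma hint_cauchy : hint (fun u => (1 + u ^+ 2)^-1) (pi / 2).
Proof.
have := @hint_FTC (fun u => (1 + u ^+ 2)^-1) (@atan R) (pi / 2).
rewrite atan0 subr0; apply.
- by move=> x _; rewrite invr_ge0 addr_ge0 // sqr_ge0.
- exact: continuous_oneDsqrV.
- exact: cvgy_atan.
Qed.

Lemma hint_gauss (c : R) : 0 < c -> hint (fun u => expR (- (c * u ^+ 2))) (Num.sqrt (pi / c) / 2).
Proof.
move=> c0; set s := Num.sqrt c.
have s0 : 0 < s by rewrite sqrtr_gt0.
have ss : s ^+ 2 = c by rewrite sqr_sqrtr // ltW.
have dF x : is_derive x (1 : R) (fun y => s * y) s.
  by apply: is_derive_eq (der_scale s (der_id x)) _; rewrite mulr1.
have F1 : (fun y : R => s * y)^`() = fun=> s.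
  by apply/funext => x; rewrite derive1E; have [_ ->] := dF x.
have cF : continuous (fun y : R => s * y) by exact: der_continuous dF.
have e : (\int[mu]_(x in D) (s * expR (- (c * x ^+ 2)))%:E)%E = (Num.sqrt pi / 2)%:E.
  have h := @increasing_ge0_integration_by_substitutiony R (fun y => s * y) (@gauss_fun R) 0.
  rewrite mulr0 integral0y_gauss in h; rewrite h.
  - apply: eq_integral => x _; congr EFin.
    rewrite [RHS]/(_ * _) /= F1 /gauss_fun /= exprMn ss; exact: mulrC.
  - by move=> x y _ _ xy; rewrite ltr_pM2l.
  - by move=> x _; rewrite F1; exact: cvg_cst.
  - by rewrite F1; exact: is_cvg_cst.
  - by rewrite F1; exact: is_cvg_cst.
  - split; first by move=> x _; have [] := dF x.
    by have := cvg_at_right_filter (cF 0).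
  - by apply: gt0_cvgMry => //; exact: cvg_id.
  - by apply: continuous_subspaceT; exact: continuous_gauss_fun.
  - by move=> x _; exact: gauss_fun_ge0.
have cg : continuous (fun x : R => expR (- (c * x ^+ 2))).
  have dg x := der_comp (g := fun x => - c * (x * x)) (is_derive_expR (- c * (x * x)))
     (der_scale (- c) (der_mul (der_id x) (der_id x))).
  have -> : (fun x : R => expR (- (c * x ^+ 2))) = (fun x => expR (- c * (x * x))).
    by apply/funext => x; rewrite mulNr.
  exact: der_continuous dg.
have h : hint (fun x => s * expR (- (c * x ^+ 2))) (Num.sqrt pi / 2).
  apply: hint_of_ereal => //.
    by move=> x _; apply: mulr_ge0; [exact: ltW|exact: expR_ge0].
  by move=> x; apply: cvgM; [exact: cvg_cst|exact: cg].
have := hintZ s^-1 h.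
have -> : s^-1 * (Num.sqrt pi / 2) = Num.sqrt (pi / c) / 2.
  rewrite sqrtrM ?pi_ge0 // sqrtrV ?ltW // -/s; ring.
by apply: hint_ext => u; rewrite mulrA mulVf ?mul1r // gt_eqF.
Qed.

End HalfLineIntegrals.

(** * Smoothed density of the truncated sum near its tilted mean *)

Section Density.
Import Normc.
Variables (R : realType) (w v : nat -> nat -> R).
Hypothesis model : forall p, prime p -> three_point p (w p) (v p).

(** With t = u/sqrt B, half of the exponent absorbs the polynomial and the other half is kept for
    the integration. *)
Lemma linquad_gauss_le (c B a q u : R) : 0 < c -> 0 < B -> 0 <= a -> 0 <= q -> 0 <= u ->
  (a * u + q * u ^+ 2) * expR (- (c / B * u ^+ 2 / 2)) <=
  (a * Num.sqrt B + q * B) * (1 + 4 / c) * expR (- (c / (4 * B) * u ^+ 2)).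
Proof.
move=> c0 B0 a0 q0 u0; set S := Num.sqrt B.
have S0 : 0 < S by rewrite sqrtr_gt0.
have SS : S ^+ 2 = B by rewrite sqr_sqrtr // ltW.
pose t := u / S.
have t0 : 0 <= t by apply: divr_ge0 => //; exact: ltW.
have ut : u = t * S by rewrite /t divfK // gt_eqF.
pose z := c / 4 * t ^+ 2.
have z0 : 0 <= z by apply: mulr_ge0; [apply: divr_ge0 => //; exact: ltW|exact: sqr_ge0].
have -> : c / B * u ^+ 2 / 2 = z + z by rewrite /z ut -SS; field; rewrite gt_eqF.
have -> : c / (4 * B) * u ^+ 2 = z by rewrite /z ut -SS; field; rewrite gt_eqF.
rewrite opprD expRD mulrA; apply: ler_wpM2r; first exact: expR_ge0.
have h1 : (1 + t ^+ 2) * expR (- z) <= 1 + 4 / c.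
  have e1 : expR (- z) <= 1 by rewrite expR_le1 oppr_le0.
  have := pow_expRN_le 1 z0; rewrite expr1 => h.
  rewrite mulrDl mul1r; apply: lerD => //.
  have -> : t ^+ 2 = 4 / c * z by rewrite /z; field; rewrite gt_eqF.
  rewrite -[leLHS]mulrA -[leRHS]mulr1; apply: ler_wpM2l => //.
  by apply: divr_ge0 => //; exact: ltW.
have h2 : a * u + q * u ^+ 2 <= (a * S + q * B) * (1 + t ^+ 2).
  rewrite ut -SS exprMn.
  have : 0 <= (a * S) * (1 + t ^+ 2 - t).
    by apply: mulr_ge0; [apply: mulr_ge0 => //; exact: ltW|nra].
  have : 0 <= q * S ^+ 2 by apply: mulr_ge0 => //; exact: sqr_ge0.
  move: (t ^+ 2) (S ^+ 2) => t2 S2; nra.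
apply: (@le_trans _ _ ((a * S + q * B) * (1 + t ^+ 2) * expR (- z))).
  by apply: ler_wpM2r => //; exact: expR_ge0.
rewrite -mulrA; apply: ler_wpM2l => //.
by apply: addr_ge0; apply: mulr_ge0 => //; exact: ltW.
Qed.

Lemma damped_cos_le (a u th : R) : 0 <= a -> 0 <= u ->
  `|expR (- (a * u)) * cos th - 1| <= a * u + th ^+ 2.
Proof.
move=> a0 u0.
have au : 0 <= a * u by exact: mulr_ge0.
have -> : expR (- (a * u)) * cos th - 1 = (expR (- (a * u)) - 1) * cos th - (1 - cos th) by ring.
apply: (le_trans (ler_normB _ _)); apply: lerD; last exact: normr_1subcos_le.
rewrite normrM.
have h1 : `|expR (- (a * u)) - 1| <= a * u.
  have := expR_ge1Dx (- (a * u)); have : expR (- (a * u)) <= 1 by rewrite expR_le1 oppr_le0.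
  by move=> h2 h3; rewrite ler_norml; apply/andP; split; lra.
by rewrite -[leRHS]mulr1; apply: ler_pM => //; exact: cos_max.
Qed.

Section Fixed.
Variables (C c K k : R) (N : nat).
Hypotheses (C0 : 0 < C) (c0 : 0 < c) (K16 : 16 <= K) (Kk : K <= k).
Let B := k * ln k.
Let S := Num.sqrt B.
Let s := sN w v N k.
Let m := mN w v N k.
Hypothesis s_ge : c / B <= s.
Hypothesis small_u : forall u, 0 <= u <= k ->
  normc (pchar w v N k u - (gaussN w v N k u)%:C%C) <= C * (S / k) * expR (- (c * (u ^+ 2 / B))).
Hypothesis large_u : forall u, k <= u -> 16 * K * u < N%:R ->
  normc (pchar w v N k u - (gaussN w v N k u)%:C%C) <= C / (1 + u ^+ 2).

Let k0 : 0 < k. Proof. by apply: lt_le_trans (le_trans K16 Kk). Qed.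
Let lk1 : 1 <= ln k.
Proof.
have := K16; have := Kk => h1 h2.
rewrite -(@expRK R 1) ler_ln ?posrE ?expR_gt0 //.
apply: (@le_trans _ _ 16); last exact: le_trans h2 h1.
have := @expR_ge1Dx R (- 2^-1); have -> : expR 1 = (expR (- 2^-1)) ^- 2 :> R.
  by rewrite -expRM_natl -expRN; congr expR; field.
move=> h; apply: (@le_trans _ _ ((2^-1)^- 2)); last by rewrite (_ : _ ^- 2 = 4) ?ler_nat //; field.
rewrite lef_pV2 ?posrE ?exprn_gt0 ?expR_gt0 // lerXn2r ?nnegrE ?expR_ge0 ?invr_ge0 //; lra.
Qed.
Let B0 : 0 < B. Proof. by apply: mulr_gt0 => //; apply: lt_le_trans lk1. Qed.
Let S0 : 0 < S. Proof. by rewrite sqrtr_gt0. Qed.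
Let s0 : 0 < s. Proof. by apply: lt_le_trans s_ge; exact: divr_gt0. Qed.

Variables (a x rho : R).
Hypotheses (a0 : 0 < a) (xm : `|x - m| <= rho).
Let E := expR (- (a * N%:R / (32 * K))).

(** An integrable majorant with one term for each error: u <= k; u >= k with the window below N; u
    so large that the window passes N; and the replacement of the damped, shifted cosine by 1. *)
Definition psi u : R := C * (S / k) * expR (- (c / B * u ^+ 2)) + C * (1 + u ^+ 2)^-1
  + 2 * E * expR (- (a / 2 * u))
  + (a * S + rho ^+ 2 * B) * (1 + 4 / c) * expR (- (c / (4 * B) * u ^+ 2)).

Lemma char_weighted_le u : 0 <= u ->
  expR (- (a * u)) * normc (pchar w v N k u - (gaussN w v N k u)%:C%C) <=
  C * (S / k) * expR (- (c / B * u ^+ 2)) + C * (1 + u ^+ 2)^-1 + 2 * E * expR (- (a / 2 * u)).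
Proof.
move=> u0; set b := normc _.
have b0 : 0 <= b by exact: normc_ge0.
have e1 : expR (- (a * u)) <= 1 by rewrite expR_le1 oppr_le0; apply: mulr_ge0 => //; exact: ltW.
have t1 : 0 <= C * (S / k) * expR (- (c / B * u ^+ 2)).
  apply: mulr_ge0; last exact: expR_ge0.
  by apply: mulr_ge0; [exact: ltW|apply: divr_ge0; exact: ltW].
have t2 : 0 <= C * (1 + u ^+ 2)^-1.
  by apply: mulr_ge0; [exact: ltW|rewrite invr_ge0; apply: addr_ge0 => //; exact: sqr_ge0].
have t3 : 0 <= 2 * E * expR (- (a / 2 * u)).
  by apply: mulr_ge0; [apply: mulr_ge0 => //; exact: expR_ge0|exact: expR_ge0].
have eb : expR (- (a * u)) * b <= b by rewrite ler_piMl.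
have [uk|ku] := leP u k.
  have h := small_u (u := u); rewrite u0 uk in h; have {}h := h isT.
  apply: (le_trans eb); apply: (le_trans h).
  rewrite (_ : c * (u ^+ 2 / B) = c / B * u ^+ 2); last by ring.
  by rewrite -addrA lerDl addr_ge0.
have [KN|NK] := ltP (16 * K * u) N%:R.
  have h := large_u (ltW ku) KN.
  apply: (le_trans eb); apply: (le_trans h).
  by rewrite addrAC lerDr addr_ge0.
(* Here u >= N/(16K), so the window is no longer below N. The trivial bound 2 is used, and half of
   the damping e^{-au} is spent on the factor [E], which vanishes as N -> oo. *)
apply: (@le_trans _ _ (2 * E * expR (- (a / 2 * u)))); last by rewrite lerDr addr_ge0.
have b2 : b <= 2.
  apply: (le_trans (normcD_le _ _)); rewrite normcN normc_real.
  have := pchar_le1 model N k u.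
  have : `|gaussN w v N k u| <= 1.
    rewrite ger0_norm ?expR_ge0 // expR_le1 oppr_le0 divr_ge0 // mulr_ge0 ?sqr_ge0 //.
    exact: ltW.
  by move: (normc _) (`| _ |) => p q; lra.
have K0 : 0 < K by apply: lt_le_trans K16.
have : expR (- (a * u)) <= E * expR (- (a / 2 * u)).
  rewrite /E -expRD ler_expR.
  have : a * N%:R / (32 * K) <= a * u / 2.
    rewrite ler_pdivrMr; last by rewrite mulr_gt0.
    have : a * N%:R <= a * (16 * K * u) by apply: ler_wpM2l => //; exact: ltW.
    by move/le_trans; apply; lra.
  lra.
move=> h; rewrite -mulrA mulrC; apply: ler_pM => //; exact: expR_ge0.
Qed.

Lemma density_dist_le u : 0 <= u ->
  `|expR (- (a * u)) * (En w v N (fun y => expR (k * y) * cos (u * y - u * x)) / expR (LN w v N k))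
    - expR (- (s / 2 * u ^+ 2))| <= psi u.
Proof.
move=> u0.
have hF := Fourier_gauss model N k u (u * x); rewrite -/m in hF.
set F := _ / _ in hF *.
have gE : gaussN w v N k u = expR (- (s / 2 * u ^+ 2)).
  by rewrite /gaussN -/s; congr expR; field.
have hb := char_weighted_le u0.
set b := normc _ in hF hb.
rewrite gE in hF; set G := expR (- (s / 2 * u ^+ 2)) in hF *.
have -> : expR (- (a * u)) * F - G =
  expR (- (a * u)) * (F - cos (u * m - u * x) * G) + (expR (- (a * u)) * cos (u * m - u * x) - 1) * G.
  by ring.
apply: (le_trans (ler_normD _ _)); rewrite !normrM (ger0_norm (expR_ge0 (- (a * u)))).
rewrite (ger0_norm (expR_ge0 (- (s / 2 * u ^+ 2)))) -/G /psi; apply: lerD.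
  by apply: le_trans hb; apply: ler_wpM2l => //; exact: expR_ge0.
apply: le_trans (linquad_gauss_le c0 B0 (ltW a0) (sqr_ge0 rho) u0).
apply: ler_pM => //; first exact: expR_ge0.
  apply: (le_trans (damped_cos_le _ (ltW a0) u0)); apply: lerD => //.
  rewrite -mulrBr exprMn mulrC; apply: ler_wpM2r; first exact: sqr_ge0.
  rewrite -(real_normK (num_real (m - x))) lerXn2r ?nnegrE //.
    exact: le_trans xm.
  by rewrite distrC.
rewrite /G ler_expR lerN2 [leRHS]mulrAC ler_pM2r ?invr_gt0 //; apply: ler_wpM2r => //; exact: sqr_ge0.
Qed.

(** The kernel a/(a^2 + z^2) has mass pi, and sqrt(pi/(2s)) is correspondingly pi times the Gaussian
    density 1/sqrt(2 pi s) at its centre. *)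
Lemma density_bound :
  `|En w v N (fun y => expR (k * y) * (a / (a ^+ 2 + (y - x) ^+ 2))) / expR (LN w v N k)
    - Num.sqrt (pi / (2 * s))| <=
  (C * Num.sqrt (pi / c) / 2 + C * (pi / 2) + (1 + 4 / c) * Num.sqrt (pi / c)) *
  (ln k + a * B + rho ^+ 2 * (B * S)) + 4 / a * E.
Proof.
pose I1 := En w v N (fun y => expR (k * y) * (a / (a ^+ 2 + (y - x) ^+ 2))) / expR (LN w v N k).
have h1 : hint (fun u => expR (- (a * u)) *
     (En w v N (fun y => expR (k * y) * cos (u * y - u * x)) / expR (LN w v N k))) I1.
  have := hintZ (expR (LN w v N k))^-1 (@hint_sum R (atoms w v N)
    (fun y u => expR (k * y) * (expR (- (a * u)) * cos (u * (y - x))))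
    (fun y => expR (k * y) * (a / (a ^+ 2 + (y - x) ^+ 2)))
    (fun y => hintZ _ (hint_poisson (y - x) a0))).
  rewrite /I1 mulrC; apply: hint_ext => u.
  suff -> : \sum_(x0 <- atoms w v N)
     x0.1 * (expR (k * x0.2) * (expR (- (a * u)) * cos (u * (x0.2 - x)))) =
     expR (- (a * u)) * En w v N (fun y => expR (k * y) * cos (u * y - u * x)).
    by rewrite mulrC [RHS]mulrA.
  by rewrite -EnZ; apply: eq_bigr => y _; rewrite mulrBr; ring.
have h2 := hint_gauss (divr_gt0 s0 (ltr0Sn R 1)).
have h3 : hint psi (C * (S / k) * (Num.sqrt (pi / (c / B)) / 2) + C * (pi / 2)
   + 2 * E * (a / 2)^-1 + (a * S + rho ^+ 2 * B) * (1 + 4 / c) * (Num.sqrt (pi / (c / (4 * B))) / 2)).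
  apply: hintD; last by apply: hintZ; apply: hint_gauss; rewrite divr_gt0 // mulr_gt0.
  apply: hintD; last by apply: hintZ; apply: hint_exp; rewrite divr_gt0.
  apply: hintD; last by apply: hintZ; exact: hint_cauchy.
  by apply: hintZ; apply: hint_gauss; rewrite divr_gt0.
have := hint_dist h1 h2 h3 density_dist_le.
have -> : Num.sqrt (pi / (s / 2)) / 2 = Num.sqrt (pi / (2 * s)).
  have -> : pi / (s / 2) = 2 ^+ 2 * (pi / (2 * s)) by field; rewrite gt_eqF.
  by rewrite sqrtrM ?sqr_ge0 // sqrtr_sqr ger0_norm //; field.
move/le_trans; apply.
have pic : 0 < pi / c :> R by rewrite divr_gt0 ?pi_gt0.
have -> : Num.sqrt (pi / (c / B)) = Num.sqrt (pi / c) * S.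
  have -> : pi / (c / B) = (pi / c) * B by field; rewrite !gt_eqF.
  by rewrite sqrtrM // ltW.
have -> : Num.sqrt (pi / (c / (4 * B))) = Num.sqrt (pi / c) * (2 * S).
  have -> : pi / (c / (4 * B)) = (pi / c) * (2 ^+ 2 * B) by field; rewrite !gt_eqF.
  by rewrite sqrtrM ?(ltW pic) // [Num.sqrt (2 ^+ 2 * B)]sqrtrM ?sqr_ge0 // sqrtr_sqr ger0_norm.
set q := Num.sqrt (pi / c).
have q0 : 0 <= q by exact: sqrtr_ge0.
have SS : S ^+ 2 = B by rewrite sqr_sqrtr // ltW.
(* The origin of the O(log k): integrating the error for u <= k gives (S/k) S = B/k = ln k. *)
have e1 : C * (S / k) * (q * S / 2) = C * q / 2 * ln k.
  have -> : C * (S / k) * (q * S / 2) = C * q / 2 * (S ^+ 2 / k) by field; rewrite gt_eqF.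
  by rewrite SS /B [k * _ / _]mulrAC divff ?gt_eqF // mul1r.
have e2 : 2 * E / (a / 2) = 4 / a * E by field; rewrite gt_eqF.
have e3 : (a * S + rho ^+ 2 * B) * (1 + 4 / c) * (q * (2 * S) / 2) =
  (1 + 4 / c) * q * (a * B + rho ^+ 2 * (B * S)) by rewrite -SS; field; rewrite gt_eqF.
rewrite e1 e2 e3.
have C' : 0 <= C * q / 2 by rewrite divr_ge0 // mulr_ge0 // ltW.
have P' : 0 <= C * (pi / 2) by rewrite mulr_ge0 ?divr_ge0 ?pi_ge0 // ltW.
have Q' : 0 <= (1 + 4 / c) * q by rewrite mulr_ge0 // addr_ge0 // divr_ge0 // ltW.
have aB : 0 <= a * B by rewrite mulr_ge0 // ltW.
have rB : 0 <= rho ^+ 2 * (B * S) by rewrite mulr_ge0 ?sqr_ge0 // mulr_ge0 // ltW.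
move: (C * q / 2) (C * (pi / 2)) ((1 + 4 / c) * q) (a * B) (rho ^+ 2 * (B * S)) (4 / a * E) C' P' Q' aB rB.
move=> A1 A2 A3 A4 A5 A6 *; have := lk1; nra.
Qed.

End Fixed.

(** The arctangent is a primitive of the Poisson kernel in x, so the mass of an interval follows
    from the pointwise bound by the mean value theorem. *)
Lemma der_En_atan N (h : R -> R) (a x : R) : 0 < a ->
  is_derive x (1 : R) (fun x => En w v N (fun y => h y * atan ((x - y) / a)))
    (En w v N (fun y => h y * (a / (a ^+ 2 + (y - x) ^+ 2)))).
Proof.
move=> a0; rewrite /En; elim: (atoms w v N) => [|z t IH].
  rewrite big_nil; have -> : (fun x => \sum_(x0 <- [::]) x0.1 * (h x0.2 * atan ((x - x0.2) / a))) = fun=> 0.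
    by apply/funext => y; rewrite big_nil.
  exact: der_cst.
have -> : (fun x => \sum_(x0 <- (z :: t)) x0.1 * (h x0.2 * atan ((x - x0.2) / a))) =
   fun x => z.1 * (h z.2 * atan ((x - z.2) / a)) + \sum_(x0 <- t) x0.1 * (h x0.2 * atan ((x - x0.2) / a)).
  by apply/funext => y; rewrite big_cons.
rewrite big_cons; apply: der_add => //.
do 2 apply: der_scale.
have h1 := der_comp (g := fun x => (x + - z.2) * a^-1) (is_derive1_atan ((x - z.2) / a))
   (der_mul (der_add (der_id x) (der_cst (- z.2) x)) (der_cst a^-1 x)).
apply: is_derive_eq h1 _.
have q0 : 0 < a ^+ 2 + (z.2 - x) ^+ 2 by rewrite ltr_pwDl ?exprn_gt0 ?sqr_ge0.
have -> : 1 + ((x - z.2) / a) ^+ 2 = (a ^+ 2 + (z.2 - x) ^+ 2) / a ^+ 2 by field; rewrite gt_eqF.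
by field; rewrite !gt_eqF.
Qed.

Lemma interval_bound : exists C c K : R, [/\ 0 < C, 0 < c, 16 <= K &
  forall k N, K <= k -> 16 * K * k < N%:R ->
  c / (k * ln k) <= sN w v N k /\
  forall a x1 x2 rho : R, 0 < a -> x1 <= x2 ->
    `|x1 - mN w v N k| <= rho -> `|x2 - mN w v N k| <= rho ->
  `|En w v N (fun y => expR (k * y) * (atan ((x2 - y) / a) - atan ((x1 - y) / a))) / expR (LN w v N k)
    - (x2 - x1) * Num.sqrt (pi / (2 * sN w v N k))| <=
  (x2 - x1) * (C * (ln k + a * (k * ln k) + rho ^+ 2 * (k * ln k * Num.sqrt (k * ln k)))
    + 4 / a * expR (- (a * N%:R / (32 * K))))].
Proof.
have [C [c [K [C0 c0 K16 H]]]] := char_bounds model.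
pose C' := C * Num.sqrt (pi / c) / 2 + C * (pi / 2) + (1 + 4 / c) * Num.sqrt (pi / c).
have C'0 : 0 < C'.
  have pic : 0 < Num.sqrt (pi / c) by rewrite sqrtr_gt0 divr_gt0 ?pi_gt0.
  have t1 : 0 < C * Num.sqrt (pi / c) / 2 by rewrite divr_gt0 // mulr_gt0.
  have t2 : 0 < C * (pi / 2) by rewrite mulr_gt0 // divr_gt0 // pi_gt0.
  have t3 : 0 < (1 + 4 / c) * Num.sqrt (pi / c) by rewrite mulr_gt0 // addr_gt0 // divr_gt0.
  by rewrite /C' !addr_gt0.
exists C', c, K; split => // k N Kk KN.
have [H1 H2 H3] := H k N Kk KN; split => // a x1 x2 rho a0 x12 h1 h2.
pose G x := En w v N (fun y => expR (k * y) * atan ((x - y) / a)).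
have [xi hxi e] := mvt_any x1 x2 (fun x => @der_En_atan N (fun y => expR (k * y)) a x a0).
have -> : En w v N (fun y => expR (k * y) * (atan ((x2 - y) / a) - atan ((x1 - y) / a))) = G x2 - G x1.
  by rewrite /G /En -sumrB; apply: eq_bigr => y _; ring.
rewrite e.
have {}hxi : x1 <= xi <= x2.
  case/orP: hxi => // /andP[h3 h4]; apply/andP; split; lra.
have hx : `|xi - mN w v N k| <= rho.
  case/andP: hxi => h3 h4; move: h1 h2; rewrite !ler_norml => /andP[h5 h6] /andP[h7 h8].
  by apply/andP; split; lra.
have D := density_bound C0 c0 K16 Kk H1 H2 H3 a0 hx.
move: D; set A := En _ _ _ _; set L := expR _; set q := Num.sqrt (pi / _) => D.
have -> : A * (x2 - x1) / L - (x2 - x1) * q = (x2 - x1) * (A / L - q) by ring.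
rewrite normrM ger0_norm; last by rewrite subr_ge0.
by apply: ler_wpM2l => //; rewrite subr_ge0.
Qed.

End Density.

(** * Almost sure limits *)

Section Convergence.
Context (d : measure_display) (T : measurableType d) (R : realType) (P : probability T R).

Lemma measurable_EFin_comp (f : T -> R) : measurable_fun setT f -> measurable_fun setT (EFin \o f).
Proof. by move=> mf; exact/measurable_EFinP. Qed.

Lemma prob_integrable_cst (c : R) : P.-integrable setT (EFin \o (fun=> c)).
Proof.
by apply: finite_measure_integrable_cst.
Qed.

Lemma prob_integral_cst (c : R) : (\int[P]_x (cst c%:E x) = c%:E)%E.
Proof. by rewrite integral_cst // -[RHS]mule1; congr (_ * _)%E; exact: probability_setT. Qed.

(** Where f exceeds B one has f <= f^2/B. *)
Lemma prob_bounded_le (f : T -> R) (C : R) : measurable_fun setT f ->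
  (forall x, 0 <= f x) -> (\int[P]_x (f x ^+ 2)%:E <= C%:E)%E ->
  forall B : R, 0 < B ->
  (\int[P]_x (f x)%:E <= \int[P]_x (Num.min (f x) B)%:E + (C / B)%:E)%E.
Proof.
move=> mf f0 fC B B0.
have m1 : measurable_fun setT (fun x => (Num.min (f x) B)%:E).
  by apply: measurable_EFin_comp; apply: measurable_minr.
have m2 : measurable_fun setT (fun x => (f x ^+ 2)%:E).
  by apply: measurable_EFin_comp; apply: measurable_funX.
have h0 x : (0 <= (Num.min (f x) B)%:E)%E by rewrite lee_fin le_min f0 ltW.
have h1 x : (0 <= (f x ^+ 2)%:E)%E by rewrite lee_fin sqr_ge0.
apply: (@le_trans _ _ (\int[P]_x ((Num.min (f x) B)%:E + (B^-1)%:E * (f x ^+ 2)%:E))%E).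
  apply: ge0_le_integral => //.
  - by move=> x _; rewrite lee_fin.
  - exact: measurable_EFin_comp.
  - by apply: emeasurable_funD => //; apply: measurable_funeM.
  move=> x _; rewrite -EFinM -EFinD lee_fin.
  rewrite minElt; case: ifP => fB; first by rewrite lerDl mulr_ge0 ?sqr_ge0 // invr_ge0 ltW.
  move/negbT: fB; rewrite -leNgt => fB.
  have : f x <= B^-1 * f x ^+ 2 by rewrite mulrC ler_pdivlMr // expr2 ler_wpM2l.
  by have := B0; lra.
rewrite ge0_integralD //; last 2 first.
  - by move=> x _; rewrite mule_ge0 // lee_fin invr_ge0 ltW.
  - by apply: measurable_funeM.
rewrite leeD2l // ge0_integralZl_EFin // ?invr_ge0 ?(ltW B0) //.
by rewrite mulrC EFinM lee_wpmul2l // lee_fin invr_ge0 ltW.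
Qed.

Lemma prob_min_cvg (f_ : nat -> T -> R) (f : T -> R) (B : R) : 0 <= B ->
  (forall n, measurable_fun setT (f_ n)) -> measurable_fun setT f ->
  (forall n x, 0 <= f_ n x) ->
  (\forall x \ae P, f_ n x @[n --> \oo] --> f x) ->
  ((\int[P]_x (Num.min (f_ n x) B)%:E)%E @[n --> \oo] --> (\int[P]_x (Num.min (f x) B)%:E)%E).
Proof.
move=> B0 mf_ mf f0 cf.
have := @dominated_convergence d T R P setT measurableT
  (fun n x => (Num.min (f_ n x) B)%:E) (fun x => (Num.min (f x) B)%:E) (fun=> B%:E).
move=> /(_ _ _ _ (prob_integrable_cst B) _) H.
have [] // := H.
- by move=> n; apply: measurable_EFin_comp; apply: measurable_minr.
- by apply: measurable_EFin_comp; apply: measurable_minr.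
- apply: filterS cf => x h _; apply: cvg_EFin; first by apply: nearW.
  apply/cvgrPdist_le => e e0; move/cvgrPdist_le : h => /(_ e e0); apply: filterS => n.
  rewrite /= !ler_norml => /andP[]; move: (f x) (f_ n x) e {e0} => a b e h1 h2.
  by rewrite /Num.min; case: ltP => h3; case: ltP => h4; apply/andP; split; lra.
- apply: filterE => x n _; rewrite gee0_abs lee_fin; last by rewrite le_min f0.
  by rewrite ge_min lexx orbT.
Qed.

(** Bounded second moments give uniform integrability: truncation at B costs at most C/B for every
    n, truncated integrals converge by domination, and B -> oo is taken in the limit function by
    monotone convergence. *)
Lemma prob_cvg_of_sqr_bounded (f_ : nat -> T -> R) (f : T -> R) (C : R) :
  (forall n, measurable_fun setT (f_ n)) -> measurable_fun setT f ->
  (forall n x, 0 <= f_ n x) -> (forall x, 0 <= f x) ->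
  (\forall x \ae P, f_ n x @[n --> \oo] --> f x) ->
  (forall n, (\int[P]_x (f_ n x ^+ 2)%:E <= C%:E)%E) ->
  [/\ (\int[P]_x (f x)%:E < +oo)%E,
      (forall n, (\int[P]_x (f_ n x)%:E < +oo)%E) &
      fine (\int[P]_x (f_ n x)%:E) @[n --> \oo] --> fine (\int[P]_x (f x)%:E)].
Proof.
move=> mf_ mf f0_ f0 cf hC.
have C0 : 0 <= C.
  by rewrite -lee_fin; apply: le_trans (hC 0%N); apply: integral_ge0 => x _; rewrite lee_fin sqr_ge0.
pose I (g : T -> R) (B : R) := fine (\int[P]_x (Num.min (g x) B)%:E)%E.
have Ifin (g : T -> R) B : measurable_fun setT g -> (forall x, 0 <= g x) -> 0 <= B ->
    (\int[P]_x (Num.min (g x) B)%:E)%E = (I g B)%:E /\ I g B <= B.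
  move=> mg g0 B0.
  have h0 x : 0 <= Num.min (g x) B by rewrite le_min g0.
  have le : (\int[P]_x (Num.min (g x) B)%:E <= B%:E)%E.
    apply: (@le_trans _ _ (\int[P]_x (cst B%:E x))%E).
      apply: ge0_le_integral => //; first by move=> x _; rewrite lee_fin.
        by apply: measurable_EFin_comp; apply: measurable_minr.
      by move=> x _; rewrite lee_fin ge_min lexx orbT.
    by rewrite prob_integral_cst.
  have ge : (0 <= \int[P]_x (Num.min (g x) B)%:E)%E by apply: integral_ge0 => x _; rewrite lee_fin.
  have fn : (\int[P]_x (Num.min (g x) B)%:E)%E \is a fin_num.
    by rewrite ge0_fin_numE //; exact: le_lt_trans le (ltry _).
  by rewrite /I fineK //; split => //; rewrite -lee_fin fineK.
have f_le n B : 0 < B -> (\int[P]_x (f_ n x)%:E <= (I (f_ n) B + C / B)%:E)%E.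
  move=> B0; rewrite EFinD -(Ifin _ _ (mf_ n) (f0_ n) (ltW B0)).1.
  exact: prob_bounded_le.
have f_fin n : (\int[P]_x (f_ n x)%:E < +oo)%E.
  by apply: le_lt_trans (f_le n 1 ltr01) _; exact: ltry.
pose J n := fine (\int[P]_x (f_ n x)%:E)%E.
have JE n : (\int[P]_x (f_ n x)%:E)%E = (J n)%:E.
  rewrite /J fineK // ge0_fin_numE //.
  by apply: integral_ge0 => x _; rewrite lee_fin.
have J_le n B : 0 < B -> J n <= I (f_ n) B + C / B.
  by move=> B0; rewrite -lee_fin -JE; exact: f_le.
have Imono (g : T -> R) B B' : measurable_fun setT g -> (forall x, 0 <= g x) -> 0 <= B -> B <= B' ->
    I g B <= I g B'.
  move=> mg g0 B0 BB'.
  have B'0 := le_trans B0 BB'.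
  rewrite -lee_fin -(Ifin g B mg g0 B0).1 -(Ifin g B' mg g0 B'0).1.
  apply: ge0_le_integral => //.
  - by move=> x _; rewrite lee_fin le_min g0.
  - by apply: measurable_EFin_comp; apply: measurable_minr.
  - by apply: measurable_EFin_comp; apply: measurable_minr.
  - by move=> x _; rewrite lee_fin le_min !ge_min lexx BB' orbT.
have I_le_J n B : 0 <= B -> I (f_ n) B <= J n.
  move=> B0; rewrite -lee_fin -JE -(Ifin _ _ (mf_ n) (f0_ n) B0).1.
  apply: ge0_le_integral => //.
  - by move=> x _; rewrite lee_fin le_min f0_.
  - by apply: measurable_EFin_comp; apply: measurable_minr.
  - exact: measurable_EFin_comp.
  - by move=> x _; rewrite lee_fin ge_min lexx.
have Icvg B : 0 <= B -> I (f_ n) B @[n --> \oo] --> I f B.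
  move=> B0; have := prob_min_cvg B0 mf_ mf f0_ cf.
  rewrite (Ifin f B mf f0 B0).1 => /fine_cvgP [_]; apply.
have If_le B : 0 <= B -> I f B <= 1 + C.
  move=> B0; rewrite -(cvg_lim _ (Icvg B B0)) //; apply: limr_le.
    by apply/cvg_ex; eexists; exact: Icvg.
  apply: nearW => n; apply: (le_trans (I_le_J n B B0)).
  apply: (le_trans (J_le n 1 ltr01)); rewrite divr1 lerD2r.
  exact: (Ifin _ _ (mf_ n) (f0_ n) ler01).2.
have mono : (\int[P]_x (Num.min (f x) n%:R)%:E)%E @[n --> \oo] --> (\int[P]_x (f x)%:E)%E.
  have := @cvg_monotone_convergence d T R P setT measurableT (fun n x => (Num.min (f x) n%:R)%:E).
  have lE x : limn (fun n => (Num.min (f x) n%:R)%:E) = (f x)%:E.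
    apply: cvg_lim => //; apply: cvg_near_cst.
    exists (Num.truncn (f x)).+1 => // n /= hn.
    congr EFin; apply/min_idPl; apply: ltW; apply: lt_le_trans (truncnS_gt (f x)) _.
    by rewrite ler_nat.
  have -> : (\int[P]_x (f x)%:E)%E = (\int[P]_x limn (fun n => (Num.min (f x) n%:R)%:E))%E.
    by apply: eq_integral => x _; rewrite lE.
  apply.
  - by move=> n; apply: measurable_EFin_comp; apply: measurable_minr.
  - by move=> n x _; rewrite lee_fin le_min f0 /=.
  - by move=> x _ n m nm; rewrite lee_fin le_min !ge_min lexx ler_nat nm orbT.
have f_fin' : (\int[P]_x (f x)%:E < +oo)%E.
  apply: (@le_lt_trans _ _ (1 + C)%:E); last exact: ltry.
  rewrite -(cvg_lim _ mono) //; apply: lime_le; first by apply/cvg_ex; eexists; exact: mono.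
  by apply: nearW => n; rewrite (Ifin f n%:R mf f0 (ler0n _ _)).1 lee_fin If_le.
pose L := fine (\int[P]_x (f x)%:E)%E.
have LE : (\int[P]_x (f x)%:E)%E = L%:E.
  rewrite /L fineK // ge0_fin_numE //.
  by apply: integral_ge0 => x _; rewrite lee_fin.
have monoR : I f n%:R @[n --> \oo] --> L.
  by move: mono; rewrite LE => /fine_cvgP [_]; apply.
have If_le_L B : 0 <= B -> I f B <= L.
  move=> B0; rewrite -lee_fin -LE -(Ifin _ _ mf f0 B0).1.
  apply: ge0_le_integral => //.
  - by move=> x _; rewrite lee_fin le_min f0.
  - by apply: measurable_EFin_comp; apply: measurable_minr.
  - exact: measurable_EFin_comp.
  - by move=> x _; rewrite lee_fin ge_min lexx.
split => //; rewrite -/L; apply/cvgrPdist_le => eps e0.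
have e3 : 0 < eps / 3 by rewrite divr_gt0.
have [B [B0 hB1 hB2]] : exists B : R, [/\ 0 < B, C / B <= eps / 3 & L - I f B <= eps / 3].
  move/cvgrPdist_le : monoR => /(_ _ e3) [n0 _ hn0].
  pose n1 := maxn n0 (Num.truncn (C / (eps / 3))).+1.
  have n1p : 0 < n1%:R :> R by rewrite ltr0n /n1 leq_max orbT.
  exists n1%:R; split => //.
    rewrite ler_pdivrMr // mulrC -ler_pdivrMr //; apply: ltW.
    by apply: lt_le_trans (truncnS_gt _) _; rewrite ler_nat /n1 leq_maxr.
  by have := hn0 n1 (leq_maxl _ _); apply: le_trans; exact: ler_norm.
have /cvgrPdist_le /(_ _ e3) := Icvg B (ltW B0).
apply: filterS => n; rewrite ler_norml => /andP[h1 h2].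
have h3 := J_le n B B0; have h4 := I_le_J n B (ltW B0); have h5 := If_le_L B (ltW B0).
rewrite -/(J n) ler_norml; apply/andP; split; lra.
Qed.

(** The sum of the |D_k| has finite expectation, hence is finite almost surely, and absolute
    convergence follows. *)
Lemma ae_cvg_series (D_ : nat -> T -> R) (c : nat -> R) (C : R) :
  (forall k, measurable_fun setT (D_ k)) ->
  (forall k, (\int[P]_x (`|D_ k x|)%:E <= (c k)%:E)%E) ->
  (forall n, \sum_(0 <= k < n) c k <= C) ->
  \forall x \ae P, cvgn (series (fun k => D_ k x)).
Proof.
move=> mD hc hC.
have m1 k : measurable_fun setT (fun x => (`|D_ k x|)%:E).
  by apply: measurable_EFin_comp; apply: measurableT_comp.
have h0 k x : (0 <= (`|D_ k x|)%:E)%E by rewrite lee_fin.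
have e := @integral_nneseries d T R P setT measurableT (fun k x => (`|D_ k x|)%:E) m1 (fun k x _ => h0 k x).
pose S x := (\sum_(0 <= k <oo) (`|D_ k x|)%:E)%E.
have S0 x : (0 <= S x)%E by apply: nneseries_ge0 => k _ _.
have mS : measurable_fun setT S by apply: ge0_emeasurable_sum.
have Sint : P.-integrable setT S.
  apply/integrableP; split => //.
  under eq_integral do rewrite gee0_abs //.
  rewrite e; apply: (@le_lt_trans _ _ C%:E); last exact: ltry.
  apply: lime_le; first by apply: is_cvg_nneseries => k _ _; apply: integral_ge0.
  apply: nearW => n; apply: (@le_trans _ _ (\sum_(0 <= k < n) (c k)%:E)%E).
    by apply: lee_sum => k _; exact: hc.
  by rewrite sumEFin lee_fin.
have := integrable_ae measurableT Sint; apply: filterS => x /(_ I) hx.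
apply: normed_cvg; apply: nondecreasing_is_cvgn.
  by apply/nondecreasing_seqP => n; rewrite /series /= [leRHS]big_nat_recr //= lerDl.
exists (fine (S x)) => _ [n _ <-].
rewrite -lee_fin fineK // /series /= -sumEFin.
by apply: (nneseries_lim_ge n) => k _ _.
Qed.

End Convergence.

Section RealLimits.
Context {R : realType}.

(** The limit 0 at t = 0 is the reason for the value 1/2 in [hstep]. *)
Lemma atan_scale_cvg (t : R) : atan (n.+1%:R * t) @[n --> \oo] --> pi / 2 * Num.sg t.
Proof.
have pos (s : R) : 0 < s -> atan (n.+1%:R * s) @[n --> \oo] --> pi / 2.
  move=> s0; apply: (@cvg_comp _ _ _ (fun n => n.+1%:R * s) (@atan R) _ (pinfty_nbhs R)); last exact: cvgy_atan.
  apply/cvgryPge => A; exists (Num.truncn (A / s)) => // n /= hn.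
  rewrite -ler_pdivrMr //; apply: ltW; apply: lt_le_trans (truncnS_gt (A / s)) _.
  by rewrite ler_nat ltnS.
case: (ltgtP t 0) => [t0|t0|->].
- rewrite ltr0_sg // mulrN1.
  have -> : (fun n : nat => atan (n.+1%:R * t)) = (fun n : nat => - atan (n.+1%:R * (- t))).
    by apply/funext => n; rewrite mulrN atanN opprK.
  by apply: cvgN; apply: pos; rewrite oppr_gt0.
- by rewrite gtr0_sg // mulr1; exact: pos.
- rewrite sgr0 mulr0.
  have -> : (fun n : nat => atan (n.+1%:R * (0 : R))) = fun=> 0 by apply/funext => n; rewrite mulr0 atan0.
  exact: cvg_cst.
Qed.

Lemma cvg_expRN_natmul (a : R) : 0 < a -> expR (- (a * n%:R)) @[n --> \oo] --> (0 : R).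
Proof.
move=> a0; apply/cvgrPdist_le => e e0; exists (Num.truncn (a^-1 * e^-1)).+1 => // n /= hn.
rewrite sub0r normrN ger0_norm ?expR_ge0 // expRN -[leRHS]invrK lef_pV2 ?posrE ?expR_gt0 ?invr_gt0 //.
have h : e^-1 <= a * n%:R.
  rewrite -ler_pdivrMl //; apply: ltW; apply: lt_le_trans (truncnS_gt _) _.
  by rewrite ler_nat.
by apply: (le_trans h); apply: le_trans (expR_ge1Dx _); rewrite lerDr.
Qed.

End RealLimits.

(** * The tail of Y *)

Section Tail.
Context (d : measure_display) (T : measurableType d) (R : realType) (P : probability T R).
Variables (w v : nat -> nat -> R).
Hypothesis model : forall p, prime p -> three_point p (w p) (v p).
Variables (Yn : nat -> T -> R) (Y : T -> R).
Hypothesis mYn : forall N, measurable_fun setT (Yn N).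
Hypothesis mY : measurable_fun setT Y.
Hypothesis cY : \forall x \ae P, Yn N x @[N --> \oo] --> Y x.
Hypothesis law : forall N (h : R -> R), measurable_fun setT h -> (forall y, 0 <= h y) ->
  (\int[P]_x (h (Yn N x))%:E = (En w v N h)%:E)%E.

Lemma LN_bounded r : exists C, forall N, expR (LN w v N r) <= C.
Proof.
exists (expR ((8 * `|r| + 16 * r ^+ 2) * 9)) => N; rewrite ler_expR.
apply: (le_trans (ler_norm _)); rewrite /LN; apply: (le_trans (ler_norm_psum _ _)).
have c0 : 0 <= 8 * `|r| + 16 * r ^+ 2 by rewrite addr_ge0 // mulr_ge0 // sqr_ge0.
apply: (@le_trans _ _ (psum N (fun p => (8 * `|r| + 16 * r ^+ 2) * (p%:R ^+ 2)^-1))).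
  by apply: ler_psum => p pp; exact: (logE_le model r pp).
by rewrite psumZ ler_wpM2l // psum_inv_sqr_le.
Qed.

(** The second moment is at most B^2 E e^{2kY_N}, bounded in N because log-moments are sums of terms
    O(1/p^2). *)
Lemma weighted_cvg k (h : R -> R) B : continuous h -> (forall y, 0 <= h y <= B) ->
  (\int[P]_x (expR (k * Y x) * h (Y x))%:E < +oo)%E /\
  En w v N (fun y => expR (k * y) * h y) @[N --> \oo] -->
    fine (\int[P]_x (expR (k * Y x) * h (Y x))%:E)%E.
Proof.
move=> ch hB.
have mh : measurable_fun setT h by exact: continuous_measurable_fun.
have me (r : R) : measurable_fun setT (fun y : R => expR (r * y)).
  by apply: measurableT_comp => //; apply: measurable_funM.
have mf : measurable_fun setT (fun y => expR (k * y) * h y) by exact: measurable_funM.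
have f0 y : 0 <= expR (k * y) * h y by rewrite mulr_ge0 ?expR_ge0 //; case/andP: (hB y).
have B0 : 0 <= B by have /andP[] := hB 0; exact: le_trans.
have [C hC] := LN_bounded (2 * k).
have c x : Yn N x @[N --> \oo] --> Y x ->
    expR (k * Yn N x) * h (Yn N x) @[N --> \oo] --> expR (k * Y x) * h (Y x).
  move=> cx; apply: cvgM; last exact: (cvg_comp _ _ cx (ch _)).
  have ce : {for k * Y x, continuous (@expR R)} by exact: continuous_expR.
  apply: (@cvg_comp _ _ _ (fun N => k * Yn N x) (@expR R) _ (nbhs (k * Y x)) _ _ ce).
  by apply: cvgM => //; exact: cvg_cst.
have [] := @prob_cvg_of_sqr_bounded d T R P (fun N x => expR (k * Yn N x) * h (Yn N x))
  (fun x => expR (k * Y x) * h (Y x)) (B ^+ 2 * C).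
- by move=> N; exact: (measurableT_comp mf (mYn N)).
- exact: (measurableT_comp mf mY).
- by move=> N x; exact: f0.
- by move=> x; exact: f0.
- by apply: filterS cY => x; exact: c.
- move=> N; apply: (@le_trans _ _ (\int[P]_x (B ^+ 2 * expR ((2 * k) * Yn N x))%:E)%E).
    apply: ge0_le_integral => //.
    + by move=> x _; rewrite lee_fin sqr_ge0.
    + by apply: measurable_EFin_comp; apply: measurable_funX; exact: (measurableT_comp mf (mYn N)).
    + by apply: measurable_EFin_comp; apply: measurable_funM => //; exact: (measurableT_comp (me _) (mYn N)).
    move=> x _; rewrite lee_fin exprMn mulrC.
    have -> : 2 * k * Yn N x = k * Yn N x + k * Yn N x by ring.
    rewrite expRD -expr2 ler_wpM2r ?exprn_ge0 ?expR_ge0 //.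
    by rewrite ler_sqr ?nnegrE //; case/andP: (hB (Yn N x)).
  rewrite (@law N (fun y => B ^+ 2 * expR (2 * k * y))).
  - by rewrite lee_fin EnZ (En_exp model) ler_wpM2l ?sqr_ge0.
  - exact: measurable_funM.
  - by move=> y; rewrite mulr_ge0 ?sqr_ge0 ?expR_ge0.
move=> h1 h2 h3; split => //.
have -> : (fun N => En w v N (fun y => expR (k * y) * h y)) =
  (fun N => fine (\int[P]_x (expR (k * Yn N x) * h (Yn N x))%:E)%E); last exact: h3.
by apply/funext => N; rewrite (@law N (fun y => expR (k * y) * h y)).
Qed.

Lemma expR_integral k : (\int[P]_x (expR (k * Y x))%:E = (expR (Linf w v k))%:E)%E.
Proof.
have [] := @weighted_cvg k (fun=> 1) 1 (fun=> cvg_cst _) (fun=> _).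
  by rewrite ler01 lexx.
under eq_integral do rewrite mulr1.
move=> hfin hc.
have hL : En w v N (fun y => expR (k * y) * 1) @[N --> \oo] --> expR (Linf w v k).
  have -> : (fun N => En w v N (fun y => expR (k * y) * 1)) = (fun N => expR (LN w v N k)).
    by apply/funext => N; rewrite -(En_exp model); apply: eq_En => y; rewrite mulr1.
  have ce : {for Linf w v k, continuous (@expR R)} by exact: continuous_expR.
  exact: (cvg_comp _ _ (@LN_cvg _ _ _ model k) ce).
rewrite -(cvg_unique _ hc hL) // fineK // ge0_fin_numE //.
by apply: integral_ge0 => x _; rewrite lee_fin expR_ge0.
Qed.

Lemma expR_integrable k : P.-integrable setT (EFin \o (fun x => expR (k * Y x))).
Proof.
apply/integrableP; split.
  by apply: measurable_EFin_comp; apply: measurableT_comp => //; apply: measurable_funM.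
under eq_integral do rewrite /= ger0_norm ?expR_ge0 //.
by rewrite expR_integral; exact: ltry.
Qed.

Lemma tilted_integrable k (g : T -> R) B : measurable_fun setT g -> (forall x, `|g x| <= B) ->
  P.-integrable setT (EFin \o (fun x => expR (k * Y x) * g x)).
Proof.
move=> mg gB.
have hi : P.-integrable setT (EFin \o (fun x => B * expR (k * Y x))).
  apply: eq_integrable (integrableZl measurableT B (expR_integrable k)) => // x _.
apply: (le_integrable measurableT _ _ hi).
  apply: measurable_EFin_comp; apply: measurable_funM => //.
  by apply: measurableT_comp => //; apply: measurable_funM.
move=> x _; rewrite lee_fin normrM (ger0_norm (expR_ge0 _)) mulrC.
have B0 : 0 <= B := le_trans (normr_ge0 _) (gB x).
by rewrite [leRHS]ger0_norm ?mulr_ge0 ?expR_ge0 // ler_wpM2r ?expR_ge0.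
Qed.

(* The indicator of [y > x], with the symmetric value 1/2 at [y = x]. *)
Definition hstep (x y : R) : R := (1 - Num.sg (x - y)) / 2.

Lemma hstep_lt x y : y < x -> hstep x y = 0.
Proof. by move=> h; rewrite /hstep gtr0_sg ?subr_gt0 // subrr mul0r. Qed.

Lemma hstep_gt x y : x < y -> hstep x y = 1.
Proof. by move=> h; rewrite /hstep ltr0_sg ?subr_lt0 // opprK divff. Qed.

Lemma hstep_eq x : hstep x x = 1 / 2.
Proof. by rewrite /hstep subrr sgr0 subr0. Qed.

Lemma hstep_bound x y : 0 <= hstep x y <= 1.
Proof.
by case: (ltgtP x y) => [/hstep_gt->|/hstep_lt->|->]; rewrite ?hstep_eq; apply/andP; split; lra.
Qed.

Lemma hstep_le x1 x2 y : x1 <= x2 -> hstep x2 y <= hstep x1 y.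
Proof.
move=> x12; case: (ltgtP x1 y) => [h|h|e].
- by rewrite (hstep_gt h); case/andP: (hstep_bound x2 y).
- by rewrite (hstep_lt (lt_le_trans h x12)); case/andP: (hstep_bound x1 y).
- rewrite -{}e; move: x12; rewrite le_eqVlt => /predU1P[->//|h].
  by rewrite (hstep_lt h); case/andP: (hstep_bound x1 x1).
Qed.

Lemma hstep_measurable x : measurable_fun setT (fun z => hstep x (Y z)).
Proof.
apply: measurable_funM => //; apply: measurable_funB => //.
have -> : (fun z => Num.sg (x - Y z)) = (fun z => (2 / pi) * (pi / 2 * Num.sg (x - Y z))).
  have aux (p s : R) : p != 0 -> s = 2 / p * (p / 2 * s) by move=> p0; field.
  by apply/funext => z; apply: aux; rewrite gt_eqF ?pi_gt0.
apply: measurable_funM => //.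
apply: (@measurable_fun_cvg _ _ _ setT (fun n z => atan (n.+1%:R * (x - Y z)))).
  move=> n; apply: measurableT_comp; first exact: (continuous_measurable_fun (@continuous_atan R)).
  by apply: measurable_funM => //; apply: measurable_funB.
by move=> z _; exact: atan_scale_cvg.
Qed.

Lemma smooth_interval : exists C K : R, [/\ 0 < C, 16 <= K & forall k, K <= k ->
  0 < Sinf w v k /\ forall a x1 x2 rho, 0 < a -> x1 <= x2 ->
  `|x1 - Minf w v k| <= rho -> `|x2 - Minf w v k| <= rho ->
  `|fine (\int[P]_x (expR (k * Y x) * (atan ((x2 - Y x) / a) - atan ((x1 - Y x) / a)))%:E)
      / expR (Linf w v k) - (x2 - x1) * Num.sqrt (pi / (2 * Sinf w v k))| <=
  (x2 - x1) * (C * (ln k + a * (k * ln k) + rho ^+ 2 * (k * ln k * Num.sqrt (k * ln k))))].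
Proof.
have [C [c [K [C0 c0 K16 H]]]] := interval_bound model.
exists C, K; split => // k Kk.
have k16 := le_trans K16 Kk.
have k0 : 0 < k by apply: lt_le_trans k16.
have lk : 0 < ln k by apply: ln_gt0; apply: lt_le_trans k16; rewrite ltr1n.
have near : \forall N \near \oo, 16 * K * k < N%:R.
  exists (Num.truncn (16 * K * k)).+1 => // N /= hN.
  by apply: lt_le_trans (truncnS_gt _) _; rewrite ler_nat.
have S0 : 0 < Sinf w v k.
  apply: (@lt_le_trans _ _ (c / (k * ln k))); first by rewrite divr_gt0 // mulr_gt0.
  apply: (cvgr_to_ge (@sN_cvg _ _ _ model k)).
  by apply: filterS near => N /(H k N Kk) [].
split => // a x1 x2 rho a0 x12 h1 h2.
set h := fun y => atan ((x2 - y) / a) - atan ((x1 - y) / a).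
have ch : continuous h.
  have ca x : continuous (fun y : R => atan ((x - y) / a)).
    move=> y; apply: (@cvg_comp _ _ _ (fun y => (x - y) / a) (@atan R) _ (nbhs ((x - y) / a))); last exact: continuous_atan.
    by apply: cvgM; [apply: cvgB; [exact: cvg_cst|exact: cvg_id]|exact: cvg_cst].
  by move=> y; apply: cvgB; exact: ca.
have hB y : 0 <= h y <= pi.
  rewrite subr_ge0 le_atan /=; last by rewrite ler_pM2r ?invr_gt0 // lerD2r.
  by have := atan_ltpi2 ((x2 - y) / a); have := atan_gtNpi2 ((x1 - y) / a); rewrite /h; lra.
have [_ cE] := @weighted_cvg k h pi ch hB.
have cexp : expR (LN w v N k) @[N --> \oo] --> expR (Linf w v k).
  have ce : {for Linf w v k, continuous (@expR R)} by exact: continuous_expR.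
  exact: (cvg_comp _ _ (@LN_cvg _ _ _ model k) ce).
have csq : Num.sqrt (pi / (2 * sN w v N k)) @[N --> \oo] --> Num.sqrt (pi / (2 * Sinf w v k)).
  apply: (@cvg_comp _ _ _ (fun N => pi / (2 * sN w v N k)) (@Num.sqrt R) _ (nbhs (pi / (2 * Sinf w v k)))); last exact: sqrt_continuous.
  apply: cvgM; first exact: cvg_cst.
  apply: cvgV; first by rewrite gt_eqF // mulr_gt0.
  by apply: cvgM; [exact: cvg_cst|exact: (@sN_cvg _ _ _ model k)].
(* The interval is placed near [Minf], whereas the bound for N is centred at [mN]. Widening rho by
   their distance costs nothing in the limit. *)
have cR : (x2 - x1) * (C * (ln k + a * (k * ln k) + (rho + `|mN w v N k - Minf w v k|) ^+ 2
      * (k * ln k * Num.sqrt (k * ln k))) + 4 / a * expR (- (a * N%:R / (32 * K)))) @[N --> \oo] -->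
    (x2 - x1) * (C * (ln k + a * (k * ln k) + (rho + 0) ^+ 2
      * (k * ln k * Num.sqrt (k * ln k))) + 4 / a * 0).
  have c1 : rho + `|mN w v N k - Minf w v k| @[N --> \oo] --> rho + 0.
    apply: cvgD; first exact: cvg_cst.
    rewrite -[X in _ --> X](normr0 R); apply: cvg_norm.
    rewrite -[X in _ --> X](subrr (Minf w v k)).
    by apply: cvgB; [exact: (@mN_cvg _ _ _ model k)|exact: cvg_cst].
  have c2 : expR (- (a * N%:R / (32 * K))) @[N --> \oo] --> (0 : R).
    have aK : 0 < a / (32 * K) by rewrite divr_gt0 // mulr_gt0 // (lt_le_trans _ K16).
    have -> : (fun N : nat => expR (- (a * N%:R / (32 * K)))) =
      (fun N : nat => expR (- (a / (32 * K) * N%:R))) by apply/funext => N; rewrite mulrAC.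
    exact: cvg_expRN_natmul.
  apply: cvgM; first exact: cvg_cst.
  apply: cvgD; last by apply: cvgM => //; exact: cvg_cst.
  apply: cvgM; first exact: cvg_cst.
  apply: cvgD; first exact: cvg_cst.
  by apply: cvgM; [apply: cvgM|exact: cvg_cst].
move: cR; rewrite addr0 mulr0 addr0 => cR.
apply: (@ler_cvg_to _ _ _ _ _ _ _ _ (cvg_norm (cvgB (cvgM cE (cvgV _ cexp)) (cvgM (cvg_cst _) csq))) cR).
  by rewrite gt_eqF // expR_gt0.
apply: filterS near => N hN.
have [_] := H k N Kk hN; apply => //.
  have -> : x1 - mN w v N k = (x1 - Minf w v k) - (mN w v N k - Minf w v k) by ring.
  by apply: (le_trans (ler_normB _ _)); rewrite lerD2r.
have -> : x2 - mN w v N k = (x2 - Minf w v k) - (mN w v N k - Minf w v k) by ring.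
by apply: (le_trans (ler_normB _ _)); rewrite lerD2r.
Qed.

(** Take a = 1/(n+1) in [smooth_interval]. The arctangent difference tends to pi times the
    difference of steps, dominated by pi e^{kY}, and the term a k ln k disappears. *)
Lemma step_interval : exists C K : R, [/\ 0 < C, 16 <= K & forall k, K <= k ->
  0 < Sinf w v k /\ forall x1 x2 rho, x1 <= x2 ->
  `|x1 - Minf w v k| <= rho -> `|x2 - Minf w v k| <= rho ->
  `|(\int[P]_x (expR (k * Y x) * (pi * (hstep x1 (Y x) - hstep x2 (Y x)))))
      / expR (Linf w v k) - (x2 - x1) * Num.sqrt (pi / (2 * Sinf w v k))| <=
  (x2 - x1) * (C * (ln k + rho ^+ 2 * (k * ln k * Num.sqrt (k * ln k))))].
Proof.
have [C [K [C0 K16 H]]] := smooth_interval.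
exists C, K; split => // k Kk; have [S0 {}H] := H k Kk; split => // x1 x2 rho x12 h1 h2.
pose f_ (n : nat) x := expR (k * Y x) * (atan ((x2 - Y x) / n.+1%:R^-1) - atan ((x1 - Y x) / n.+1%:R^-1)).
pose f x := expR (k * Y x) * (pi * (hstep x1 (Y x) - hstep x2 (Y x))).
have me : measurable_fun setT (fun x => expR (k * Y x)).
  by apply: measurableT_comp => //; apply: measurable_funM.
have ma (n : nat) x : measurable_fun setT (fun z => atan ((x - Y z) / n.+1%:R^-1)).
  apply: measurableT_comp; first exact: (continuous_measurable_fun (@continuous_atan R)).
  by apply: measurable_funM => //; apply: measurable_funB.
have mf_ n : measurable_fun setT (f_ n) by apply: measurable_funM => //; exact: measurable_funB.
have mf : measurable_fun setT f.
  apply: measurable_funM => //; apply: measurable_funM => //.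
  by apply: measurable_funB; exact: hstep_measurable.
have cf x : f_ n x @[n --> \oo] --> f x.
  apply: cvgM; first exact: cvg_cst.
  have -> : pi * (hstep x1 (Y x) - hstep x2 (Y x)) =
      pi / 2 * Num.sg (x2 - Y x) - pi / 2 * Num.sg (x1 - Y x) by rewrite /hstep; field.
  have e t : (fun n : nat => atan (t / n.+1%:R^-1)) = (fun n : nat => atan (n.+1%:R * t)) :> (nat -> R).
    by apply/funext => n; rewrite invrK mulrC.
  by apply: cvgB; rewrite e; exact: atan_scale_cvg.
have gi : P.-integrable setT (EFin \o (fun x => expR (k * Y x) * pi)).
  by apply: (@tilted_integrable k (fun=> pi) pi) => // x; rewrite ger0_norm // pi_ge0.
have [] := @dominated_convergence d T R P setT measurableT (fun n => EFin \o f_ n) (EFin \o f)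
  (EFin \o (fun x => expR (k * Y x) * pi)).
- by move=> n; exact: measurable_EFin_comp.
- exact: measurable_EFin_comp.
- apply: filterE => x _; apply: cvg_EFin; first exact: nearW.
  exact: cf.
- exact: gi.
- apply: filterE => x n _; rewrite lee_fin normrM (ger0_norm (expR_ge0 _)) ler_wpM2l ?expR_ge0 //.
  move: (atan_ltpi2 ((x2 - Y x) / n.+1%:R^-1)) (atan_gtNpi2 ((x2 - Y x) / n.+1%:R^-1)).
  move: (atan_ltpi2 ((x1 - Y x) / n.+1%:R^-1)) (atan_gtNpi2 ((x1 - Y x) / n.+1%:R^-1)) => *.
  by rewrite ler_norml; apply/andP; split; lra.
move=> fi _ /= cI.
have cI' : fine (\int[P]_x (f_ n x)%:E) @[n --> \oo] --> \int[P]_x f x.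
  have ff := integrable_fin_num measurableT fi.
  move: cI; rewrite -(fineK ff) => /fine_cvgP [_]; exact.
have cR : (x2 - x1) * (C * (ln k + n.+1%:R^-1 * (k * ln k) + rho ^+ 2 * (k * ln k * Num.sqrt (k * ln k))))
    @[n --> \oo] -->
  (x2 - x1) * (C * (ln k + 0 * (k * ln k) + rho ^+ 2 * (k * ln k * Num.sqrt (k * ln k)))).
  apply: cvgM; first exact: cvg_cst.
  apply: cvgM; first exact: cvg_cst.
  apply: cvgD; last exact: cvg_cst.
  apply: cvgD; first exact: cvg_cst.
  by apply: cvgM; [exact: cvg_harmonic|exact: cvg_cst].
move: cR; rewrite mul0r addr0 => cR.
apply: (@ler_cvg_to _ _ _ _ _ _ _ _ (cvg_norm (cvgB (cvgM cI' (cvg_cst _)) (cvg_cst _))) cR).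
by apply: nearW => n; apply: H => //; rewrite invr_gt0.
Qed.

Section FixedTilt.
Variables (k D E rho : R).
Let M := expR (Linf w v k).
Let m := Minf w v k.
Hypothesis k0 : 0 < k.
Hypothesis D0 : 0 <= D.
Hypothesis E0 : 0 <= E.
Hypothesis HI : forall x1 x2, x1 <= x2 -> `|x1 - m| <= rho -> `|x2 - m| <= rho ->
  `|(\int[P]_x (expR (k * Y x) * (pi * (hstep x1 (Y x) - hstep x2 (Y x))))) / M - (x2 - x1) * D|
    <= (x2 - x1) * E.

Let I x := \int[P]_z hstep x (Y z).
Let W x1 x2 := \int[P]_z (expR (k * Y z) * (hstep x1 (Y z) - hstep x2 (Y z))).

Lemma hstep_integrable x : P.-integrable setT (EFin \o (fun z => hstep x (Y z))).
Proof.
have := @tilted_integrable 0 (fun z => hstep x (Y z)) 1 (hstep_measurable x).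
have -> : (EFin \o (fun z => expR (0 * Y z) * hstep x (Y z))) = (EFin \o (fun z => hstep x (Y z))).
  by apply/funext => z /=; rewrite mul0r expR0 mul1r.
by apply=> z; case/andP: (hstep_bound x (Y z)) => h1 h2; rewrite ger0_norm.
Qed.

Lemma hstepB_integrable x1 x2 :
  P.-integrable setT (EFin \o (fun z => expR (k * Y z) * (hstep x1 (Y z) - hstep x2 (Y z)))).
Proof.
apply: (@tilted_integrable k _ 1); first by apply: measurable_funB; exact: hstep_measurable.
move=> z; case/andP: (hstep_bound x1 (Y z)) => h1 h2; case/andP: (hstep_bound x2 (Y z)) => h3 h4.
by rewrite ler_norml; apply/andP; split; lra.
Qed.

Lemma tilted_mass_bounds x1 x2 : x1 <= x2 -> `|x1 - m| <= rho -> `|x2 - m| <= rho ->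
  `|W x1 x2 - M * (x2 - x1) * (D / pi)| <= M * (x2 - x1) * (E / pi).
Proof.
move=> x12 h1 h2; have := HI x12 h1 h2.
have -> : \int[P]_x (expR (k * Y x) * (pi * (hstep x1 (Y x) - hstep x2 (Y x)))) = pi * W x1 x2.
  rewrite /W -RintegralZl //; last exact: hstepB_integrable.
  by apply: eq_Rintegral => z _; ring.
have M0 : 0 < M by exact: expR_gt0.
have p0 : 0 < pi :> R by exact: pi_gt0.
have Mp : 0 < M / pi by rewrite divr_gt0.
have -> : W x1 x2 - M * (x2 - x1) * (D / pi) = (M / pi) * (pi * W x1 x2 / M - (x2 - x1) * D).
  have aux (a b c p s : R) : p != 0 -> s != 0 -> a - s * b * (c / p) = (s / p) * (p * a / s - b * c).
    by move=> p1 s1; field; rewrite p1 s1.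
  by apply: aux; rewrite gt_eqF.
have -> : M * (x2 - x1) * (E / pi) = (M / pi) * ((x2 - x1) * E) by ring.
by rewrite normrM (ger0_norm (ltW Mp)) ler_pM2l.
Qed.

Lemma tail_mass_diff x1 x2 : x1 <= x2 ->
  expR (- (k * x2)) * W x1 x2 <= I x1 - I x2 <= expR (- (k * x1)) * W x1 x2.
Proof.
move=> x12.
have -> : I x1 - I x2 = \int[P]_z (hstep x1 (Y z) - hstep x2 (Y z)).
  by rewrite RintegralB //; exact: hstep_integrable.
have hd : P.-integrable setT (EFin \o (fun z => hstep x1 (Y z) - hstep x2 (Y z))).
  apply: eq_integrable (integrableB measurableT (hstep_integrable x1) (hstep_integrable x2)) => //.
have hW c : P.-integrable setT (EFin \o (fun z => c * (expR (k * Y z) * (hstep x1 (Y z) - hstep x2 (Y z))))).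
  by apply: eq_integrable (integrableZl measurableT c (hstepB_integrable x1 x2)) => //.
rewrite /W -!RintegralZl //; try exact: hstepB_integrable.
have key y : expR (- (k * x2)) * (expR (k * y) * (hstep x1 y - hstep x2 y)) <= hstep x1 y - hstep x2 y /\
    hstep x1 y - hstep x2 y <= expR (- (k * x1)) * (expR (k * y) * (hstep x1 y - hstep x2 y)).
  rewrite !mulrA -!expRD.
  have h0 : 0 <= hstep x1 y - hstep x2 y by rewrite subr_ge0 hstep_le.
  have [y1|y1] := ltP y x1.
    by rewrite !hstep_lt ?(lt_le_trans y1) // subrr !mulr0.
  have [y2|y2] := ltP x2 y.
    by rewrite !hstep_gt ?(le_lt_trans x12) // subrr !mulr0.
  split.
    rewrite -[leRHS]mul1r ler_wpM2r // -[leRHS]expR0 ler_expR.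
    by rewrite addrC -mulrBr pmulr_rle0 // subr_le0.
  rewrite -[leLHS]mul1r ler_wpM2r // -[leLHS]expR0 ler_expR.
  by rewrite addrC -mulrBr pmulr_rge0 // subr_ge0.
by apply/andP; split; apply: le_Rintegral => // z _; case: (key (Y z)).
Qed.

Lemma tail_mass_bounds x : 0 <= I x <= expR (- (k * x)) * M.
Proof.
apply/andP; split.
  by apply: Rintegral_ge0 => z _; case/andP: (hstep_bound x (Y z)).
have -> : expR (- (k * x)) * M = \int[P]_z (expR (- (k * x)) * expR (k * Y z)).
  rewrite RintegralZl //; last exact: expR_integrable.
  by rewrite /Rintegral expR_integral.
apply: le_Rintegral => //.
- exact: hstep_integrable.
- by apply: eq_integrable (integrableZl measurableT _ (expR_integrable k)) => //.
move=> z _; rewrite -expRD.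
have [h|h] := ltP (Y z) x; first by rewrite hstep_lt // expR_ge0.
case/andP: (hstep_bound x (Y z)) => _ h2; apply: (le_trans h2).
by rewrite -[leLHS]expR0 ler_expR addrC -mulrBr pmulr_rge0 // subr_ge0.
Qed.

(* Cut (m, oo) at the points m + j e/k: on each piece e^{-ky} varies by a factor e^{-e}, and
   the pieces form a geometric series. *)
Lemma tail_binned (e : R) (J : nat) : 0 < e -> e < 1 -> J%:R * (e / k) <= rho ->
  `|I m - M * expR (- (k * m)) / k * (D / pi)| <=
  M * expR (- (k * m)) / k * (e * (D / pi) + expR (- e) ^+ J * (D / pi) + 2 * (E / pi) + k * expR (- e) ^+ J).
Proof.
move=> e0 e1 Jrho.
set q := expR (- e); set eta := e / k; pose x (j : nat) := m + j%:R * eta.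
have eta0 : 0 < eta by rewrite divr_gt0.
have q0 : 0 < q by exact: expR_gt0.
have q1 : q < 1 by rewrite -expR0 ltr_expR oppr_lt0.
have M0 : 0 < M by exact: expR_gt0.
have p0 : 0 < pi :> R by exact: pi_gt0.
have xq j : expR (- (k * x j)) = expR (- (k * m)) * q ^+ j.
  rewrite /q -expRM_natl -expRD; congr expR; rewrite /x /eta.
  by field; rewrite gt_eqF.
have xS j : x j <= x j.+1 by rewrite lerD2l ler_wpM2r ?ler_nat // ltW.
have xr j : (j <= J)%N -> `|x j - m| <= rho.
  move=> jJ; rewrite /x addrAC subrr add0r ger0_norm; last by rewrite mulr_ge0 // ltW.
  by apply: le_trans Jrho; rewrite ler_wpM2r ?ler_nat // ltW.
have xd j : x j.+1 - x j = eta by rewrite /x -natr1; ring.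
set Dp := D / pi; set Ep := E / pi.
have Dp0 : 0 <= Dp by rewrite divr_ge0 // ltW.
have Ep0 : 0 <= Ep by rewrite divr_ge0 // ltW.
have Wb j : (j < J)%N -> M * eta * (Dp - Ep) <= W (x j) (x j.+1) <= M * eta * (Dp + Ep).
  move=> jJ; have := tilted_mass_bounds (xS j) (xr j (ltnW jJ)) (xr j.+1 jJ); rewrite xd -/Dp -/Ep.
  rewrite ler_norml => /andP[h1 h2]; rewrite [_ * (Dp - Ep)]mulrBr [_ * (Dp + Ep)]mulrDr; apply/andP; split; lra.
(* Here g is the geometric sum of q^j over j < n. The upper bound evaluates e^{-kx} at left
   endpoints, the lower one at right endpoints, whence its extra q. *)
have [g [g0 gq Ub Lb]] : exists g : R, [/\ 0 <= g, (1 - q) * g = 1 - q ^+ J,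
    I m <= expR (- (k * m)) * (M * eta * (Dp + Ep)) * g + I (x J) &
    expR (- (k * m)) * (M * eta * (Dp - Ep)) * (q * g) + I (x J) <= I m].
  move: (leqnn J); move: {1 3 4 5}J => n; elim: n => [_|n IH nJ].
    exists 0; rewrite mulr0 expr0 subrr !mulr0 !add0r /x mul0r addr0; split => //.
  have [g [g0 gq Ub Lb]] := IH (ltnW nJ).
  have /andP[d1 d2] := tail_mass_diff (xS n); have /andP[w1 w2] := Wb n nJ.
  have A0 : 0 < expR (- (k * m)) * q ^+ n by rewrite mulr_gt0 ?expR_gt0 // exprn_gt0.
  exists (g + q ^+ n); split.
  - by rewrite addr_ge0 // exprn_ge0 // ltW.
  - by rewrite mulrDr gq exprS; ring.
  - rewrite xq in d2; move: w2; rewrite -(ler_pM2l A0) => w2.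
    have -> : expR (- (k * m)) * (M * eta * (Dp + Ep)) * (g + q ^+ n) =
      expR (- (k * m)) * (M * eta * (Dp + Ep)) * g + expR (- (k * m)) * q ^+ n * (M * eta * (Dp + Ep)) by ring.
    lra.
  - rewrite xq in d1.
    have A1 : 0 < expR (- (k * m)) * q ^+ n.+1 by rewrite mulr_gt0 ?expR_gt0 // exprn_gt0.
    move: w1; rewrite -(ler_pM2l A1) => w1.
    have -> : expR (- (k * m)) * (M * eta * (Dp - Ep)) * (q * (g + q ^+ n)) =
      expR (- (k * m)) * (M * eta * (Dp - Ep)) * (q * g) + expR (- (k * m)) * q ^+ n.+1 * (M * eta * (Dp - Ep)).
      by rewrite exprS; ring.
    lra.
have /andP[IJ0 IJ1] := tail_mass_bounds (x J); rewrite xq in IJ1.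
set G := M * expR (- (k * m)) / k.
have G0 : 0 < G by rewrite divr_gt0 // mulr_gt0 // expR_gt0.
have MG : expR (- (k * m)) * M = k * G by rewrite /G; field; rewrite gt_eqF.
have qJ0 : 0 < q ^+ J by exact: exprn_gt0.
have qJ1 : q ^+ J <= 1 by rewrite exprn_ile1 // ltW.
have q1' : 0 < 1 - q by rewrite subr_gt0.
have gE : g = (1 - q ^+ J) / (1 - q) by apply: (mulfI (lt0r_neq0 q1')); rewrite gq mulrC divfK // gt_eqF.
have qe : q * expR e = 1 by rewrite /q -expRD addNr expR0.
have ee : 1 + e <= expR e by exact: expR_ge1Dx.
have eq_ : q <= 1 / (1 + e).
  rewrite ler_pdivlMr ?addr_gt0 //; apply: (@le_trans _ _ (q * expR e)); last by rewrite qe.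
  by rewrite ler_pM2l.
have qge : 1 - e <= q by have := expR_ge1Dx (- e).
(* From e/(1 - q) <= 1 + e and 1 - e <= e q/(1 - q) <= 1: up to relative errors e and q^J the
   geometric sum is 1/e, which turns the bin width e/k into 1/k. *)
have eg1 : e * g <= 1 + e.
  have : e * g * (1 - q) <= (1 + e) * (1 - q).
    rewrite -mulrA [g * _]mulrC gq.
    have : e / (1 + e) <= 1 - q.
      have -> : e / (1 + e) = 1 - 1 / (1 + e) by field; rewrite gt_eqF // addr_gt0.
      by rewrite lerD2l lerN2.
    rewrite ler_pdivrMr ?addr_gt0 // => h.
    have : e * (1 - q ^+ J) <= e by rewrite ger_pMr // lerBlDr lerDl ltW.
    lra.
  by rewrite ler_pM2r.
have eqg_le : e * (q * g) <= 1.
  have : e * (q * g) * (1 - q) <= 1 * (1 - q).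
    have -> : e * (q * g) * (1 - q) = e * q * ((1 - q) * g) by ring.
    rewrite gq mul1r.
    have h1 : e * q <= 1 - q.
      have : (1 + e) * q <= expR e * q by rewrite ler_pM2r.
      by rewrite [expR e * q]mulrC qe; lra.
    have : e * q * (1 - q ^+ J) <= e * q.
      by rewrite ger_pMr ?mulr_gt0 // lerBlDr lerDl ltW.
    lra.
  by rewrite ler_pM2r.
have eqg_ge : 1 - e - q ^+ J <= e * (q * g).
  have h1 : (1 - e) * (1 - q) <= e * q by lra.
  have h2 : 0 <= (1 - q ^+ J) by rewrite subr_ge0.
  have : (1 - e) * (1 - q ^+ J) * (1 - q) <= e * (q * g) * (1 - q).
    have -> : e * (q * g) * (1 - q) = e * q * ((1 - q) * g) by ring.
    have -> : (1 - e) * (1 - q ^+ J) * (1 - q) = (1 - e) * (1 - q) * (1 - q ^+ J) by ring.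
    by rewrite gq ler_wpM2r.
  rewrite ler_pM2r // => h3; apply: le_trans h3; nra.
have keta : k * eta = e by rewrite /eta mulrC divfK // gt_eqF.
have U' : I m <= G * ((Dp + Ep) * (e * g)) + G * (k * q ^+ J).
  apply: (le_trans Ub); apply: lerD.
    rewrite [X in X <= _](_ : _ = (expR (- (k * m)) * M) * (eta * ((Dp + Ep) * g))); last by ring.
    rewrite MG [X in X <= _](_ : _ = G * ((Dp + Ep) * ((k * eta) * g))); last by ring.
    by rewrite keta.
  apply: (le_trans IJ1); rewrite [X in X <= _](_ : _ = (expR (- (k * m)) * M) * q ^+ J); last by ring.
  by rewrite MG [k * G]mulrC -mulrA.
have L' : G * ((Dp - Ep) * (e * (q * g))) <= I m.
  apply: le_trans Lb; rewrite -[leLHS]addr0; apply: lerD => //.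
  rewrite [X in _ <= X](_ : _ = (expR (- (k * m)) * M) * (eta * ((Dp - Ep) * (q * g)))); last by ring.
  rewrite MG [X in _ <= X](_ : _ = G * ((Dp - Ep) * ((k * eta) * (q * g)))); last by ring.
  by rewrite keta.
move: (e * g) (e * (q * g)) (q ^+ J) eg1 eqg_le eqg_ge qJ0 qJ1 U' L' => a b r ha hb1 hb2 r0 r1 U' L'.
rewrite ler_norml; apply/andP; split.
  have h : G * (Dp - e * Dp - r * Dp - 2 * Ep) <= G * ((Dp - Ep) * b).
    rewrite ler_pM2l //.
    have : (1 - e - r) * Dp <= b * Dp by rewrite ler_wpM2r.
    have : b * Ep <= 1 * Ep by rewrite ler_wpM2r.
    lra.
  have h2 : 0 <= G * (k * r) by apply: mulr_ge0; [|apply: mulr_ge0]; apply: ltW.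
  lra.
have h : G * ((Dp + Ep) * a) <= G * ((Dp + Ep) * (1 + e)).
  by rewrite ler_pM2l // ler_wpM2l // addr_ge0.
have h1 : G * (e * Ep) <= G * Ep by rewrite ler_pM2l // ler_piMl // ltW.
have h2 : 0 <= G * (r * Dp) by apply: mulr_ge0; [|apply: mulr_ge0] => //; apply: ltW.
lra.
Qed.

End FixedTilt.

(** This keeps the term rho^2 k ln k sqrt(k ln k) of the interval estimate O(ln k) when rho = 3 ln
    k/k. It follows from (ln k)^5 <= 5! k. *)
Lemma log_pow5_le (k : R) : 1 <= k -> ln k ^+ 2 * Num.sqrt (k * ln k) <= 11 * k.
Proof.
move=> k1; have k0 : 0 < k by exact: lt_le_trans k1.
have l0 : 0 <= ln k by exact: ln_ge0.
rewrite -ler_sqr ?nnegrE ?mulr_ge0 ?sqr_ge0 ?sqrtr_ge0 // ?(ltW k0) //.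
rewrite exprMn sqr_sqrtr ?mulr_ge0 // ?(ltW k0) //.
have := @pow_expRN_le R 5 (ln k) l0; rewrite expRN lnK ?posrE // ler_pdivrMr //.
have -> : 5`!%:R = 120 :> R by [].
move=> h; have : ln k ^+ 5 * k <= 120 * k * k by rewrite ler_pM2r.
have -> : (ln k ^+ 2) ^+ 2 * (k * ln k) = ln k ^+ 5 * k by ring.
have : 0 <= k ^+ 2 by exact: sqr_ge0.
lra.
Qed.

Lemma Sinf_upper : exists2 U : R, 0 < U & forall k, 4 <= k -> Sinf w v k <= U / (k * ln k).
Proof.
exists 2688; first by rewrite ltr0n.
move=> k k4; apply: (cvgr_to_le (@sN_cvg _ _ _ model k)).
by apply: nearW => N; exact: (sN_upper model).
Qed.

Lemma tail_hstep : exists C K : R, [/\ 0 < C, 16 <= K & forall k, K <= k ->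
  0 < Sinf w v k /\
  let main := expR (Linf w v k) * expR (- (k * Minf w v k)) / (k * Num.sqrt (2 * pi * Sinf w v k)) in
  `|\int[P]_x hstep (Minf w v k) (Y x) - main| <= C * main * Num.sqrt (ln k / k)].
Proof.
have [C [K [C0 K16 H]]] := step_interval.
have [U U0 HU] := Sinf_upper.
pose A : R := Num.sqrt (2 * pi * U).
have p0 : 0 < pi :> R by exact: pi_gt0.
have A0 : 0 < A by rewrite sqrtr_gt0 !mulr_gt0.
exists (2 + 200 * C * A + A), K; split => //.
  by rewrite !addr_gt0 ?mulr_gt0.
move=> k Kk; have [S0 {}H] := H k Kk; split => // main.
have k16 : 16 <= k by exact: le_trans Kk.
have k0 : 0 < k by apply: lt_le_trans k16.
have k1 : 1 <= k by lra.
have k4 : 4 <= k by lra.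
have L1 : 1 <= ln k.
  rewrite -[leLHS](expRK 1) ler_ln ?posrE ?expR_gt0 //.
  have h1 : 1 / 2 <= expR (- (1 / 2)) :> R by have := @expR_ge1Dx R (- (1 / 2)); lra.
  have h2 : expR (1 / 2) <= 2 :> R.
    rewrite -[1 / 2 in leLHS]opprK expRN -[leRHS]invrK lef_pV2 ?posrE ?expR_gt0 ?invr_gt0 //; lra.
  have -> : 1 = 1 / 2 + 1 / 2 :> R by field.
  rewrite expRD; have := expR_gt0 (1 / 2 : R); nra.
have Lk : ln k < k by exact: ln_sublinear.
have pw := log_pow5_le k1.
have {}HU := HU k k4.
have lnkE : expR (ln k) = k by rewrite lnK ?posrE.
rewrite /main; move: (ln k) lnkE L1 Lk pw HU H => L lnkE L1 Lk pw HU H {main}.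
set S := Sinf w v k in S0 HU H *.
have L0 : 0 < L by lra.
have B0 : 0 < k * L by rewrite mulr_gt0.
set u := Num.sqrt (k * L) in pw H.
have u0 : 0 < u by rewrite sqrtr_gt0.
set e := Num.sqrt (L / k).
have e0 : 0 < e by rewrite sqrtr_gt0 divr_gt0.
have e1 : e < 1 by rewrite -[ltRHS]sqrtr1 ltr_sqrt // ltr_pdivrMr // mul1r.
have eu : e * u = L.
  rewrite /e /u -sqrtrM ?divr_ge0 ?(ltW L0) ?(ltW k0) //.
  have -> : L / k * (k * L) = L ^+ 2 by field; rewrite gt_eqF.
  by rewrite sqrtr_sqr ger0_norm // ltW.
have ek : 1 / k <= e.
  rewrite -[leLHS]ger0_norm ?divr_ge0 ?(ltW k0) // -sqrtr_sqr ler_sqrt ?divr_ge0 ?(ltW L0) ?(ltW k0) //.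
  rewrite expr_div_n expr1n expr2 -(mulr1 (1 / _)) ler_pdivlMr // mulr1.
  have -> : 1 / (k * k) * k = k^-1 by field; rewrite gt_eqF.
  by apply: le_trans L1; rewrite invf_le1.
(* The J bins of width e/k cover a length between 2 ln k/k and 3 ln k/k. Then q^J <= k^{-2}, so that
   the crude bound for the tail beyond the bins, which loses a factor k, is still of relative size
   O(e). *)
pose J := (Num.truncn (2 * L / e)).+1.
have J1 : 2 * L <= J%:R * e.
  by rewrite -ler_pdivrMr //; apply: ltW; exact: truncnS_gt.
have J2 : J%:R * e <= 3 * L.
  have h : (Num.truncn (2 * L / e))%:R <= 2 * L / e.
    by rewrite truncn_le divr_ge0 ?mulr_ge0 // ltW.
  move: h; rewrite ler_pdivlMr // => h.
  rewrite /J -natr1 mulrDl mul1r; lra.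
set rho := 3 * L / k.
have Jr : J%:R * (e / k) <= rho by rewrite mulrA /rho ler_pM2r // invr_gt0.
set D := Num.sqrt (pi / (2 * S)).
set E := C * (L + rho ^+ 2 * (k * L * u)).
have D0 : 0 <= D by exact: sqrtr_ge0.
have E0 : 0 <= E.
  apply: mulr_ge0; first exact: ltW.
  apply: addr_ge0; first exact: ltW.
  by apply: mulr_ge0; [exact: sqr_ge0|apply: mulr_ge0; exact: ltW].
have := @tail_binned k D E rho k0 D0 E0 (fun x1 x2 => @H x1 x2 rho) e J e0 e1 Jr.
set s := Num.sqrt (2 * pi * S).
have s0 : 0 < s by rewrite sqrtr_gt0 !mulr_gt0.
have Ds : D / pi = s^-1.
  have -> : D = pi / s.
    rewrite /D; have -> : pi / (2 * S) = (pi / s) ^+ 2.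
      rewrite expr_div_n /s sqr_sqrtr ?mulr_ge0 ?(ltW p0) ?(ltW S0) //.
      by move: (pi) p0 => q q0; field; rewrite !gt_eqF.
    by rewrite sqrtr_sqr ger0_norm // divr_ge0 // ltW.
  by rewrite mulrAC divff ?mul1r // gt_eqF.
(* The upper bound for the variance makes sqrt(k L) = O(1/s). Since e u = L, an error O(L) is then e
   times the factor 1/s of the main term. *)
have As : u <= A * s^-1.
  rewrite ler_pdivlMr // /u /s /A -sqrtrM ?(ltW B0) // ler_sqrt ?mulr_ge0 ?(ltW p0) ?(ltW U0) //.
  move: HU; rewrite ler_pdivlMr // => HU.
  have := ler_wpM2l (ltW p0) HU; lra.
rewrite Ds.
set G := expR (Linf w v k) * expR (- (k * Minf w v k)) / k.
have G0 : 0 < G by rewrite divr_gt0 // mulr_gt0 // expR_gt0.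
have -> : expR (Linf w v k) * expR (- (k * Minf w v k)) / (k * s) = G * s^-1.
  by rewrite /G invfM mulrA.
move=> h; apply: (le_trans h).
have qJ : expR (- e) ^+ J <= k^-1 * k^-1.
  rewrite -expRM_natl -invfM -{1 2}lnkE -expRD -expRN ler_expR; lra.
have ki : k^-1 <= e by rewrite -[k^-1]mul1r.
have ki1 : k^-1 <= 1 by rewrite invf_le1.
have ki0 : 0 < k^-1 by rewrite invr_gt0.
have s'0 : 0 < s^-1 by rewrite invr_gt0.
have q1 : expR (- e) ^+ J <= e.
  apply: (le_trans qJ); apply: le_trans ki; rewrite ger_pMr //.
have q2 : k * expR (- e) ^+ J <= 1.
  apply: (@le_trans _ _ (k * (k^-1 * k^-1))); first by rewrite ler_pM2l.
  by rewrite mulrA divff ?mul1r // gt_eqF.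
have eL : L <= A * (e * s^-1).
  have := ler_wpM2l (ltW e0) As; rewrite eu; lra.
have EL : E <= C * (100 * L).
  rewrite /E ler_pM2l // /rho.
  have -> : (3 * L / k) ^+ 2 * (k * L * u) = 9 * L * (L ^+ 2 * u / k) by field; rewrite gt_eqF.
  have h2 : L ^+ 2 * u / k <= 11 by rewrite ler_pdivrMr.
  have := ler_wpM2l (ltW L0) h2; lra.
have pi1 : 1 <= pi :> R by have := @pi_ge2 R; lra.
have Epi : 2 * (E / pi) <= 200 * C * A * (e * s^-1).
  have h1 : E / pi <= E by rewrite ler_pdivrMr // ler_peMr.
  have h2 : C * (100 * L) <= C * (100 * (A * (e * s^-1))) by rewrite ler_pM2l //; lra.
  lra.
have qs : expR (- e) ^+ J * s^-1 <= e * s^-1 by rewrite ler_pM2r.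
rewrite [X in _ <= X](_ : _ = G * ((2 + 200 * C * A + A) * (e * s^-1))); last by ring.
rewrite ler_pM2l //; lra.
Qed.

(* The atom at [m] is bounded by the tilted mass of [(m - t, m + t)], which is O(t). *)
Lemma no_atom_at_mean : exists2 K : R, 16 <= K & forall k, K <= k ->
  P [set x | Y x = Minf w v k] = 0%E.
Proof.
have [C [K [C0 K16 H]]] := step_interval.
exists K => // k Kk; have [S0 {}H] := H k Kk.
set m := Minf w v k in H *; set M := expR (Linf w v k) in H.
set D := Num.sqrt _ in H.
set F := ln k + 1 ^+ 2 * (k * ln k * Num.sqrt (k * ln k)).
have mA : measurable [set x | Y x = m].
  by have := mY measurableT (measurable_set1 m); rewrite setTI.
set p := fine (P [set x | Y x = m]).
have pE : P [set x | Y x = m] = p%:E by rewrite fineK // fin_num_measure.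
have p0 : 0 <= p by rewrite fine_ge0.
have M0 : 0 < M by exact: expR_gt0.
have pi0 : 0 < pi :> R by exact: pi_gt0.
suff p_le t : 0 < t -> t <= 1 -> expR (k * m) * pi * p <= t * (2 * (M * (D + C * F))).
  suff : p <= 0 by move=> h; rewrite pE; congr EFin; apply/eqP; rewrite eq_le h.
  rewrite leNgt; apply/negP => pp.
  have A0 : 0 < expR (k * m) * pi * p by rewrite !mulr_gt0 // expR_gt0.
  set Q := 2 * (M * (D + C * F)) in p_le; set a := expR (k * m) * pi * p in p_le A0.
  have Q0 : 0 < Q by have := p_le 1 ltr01 (lexx 1); lra.
  have [h|h] := leP (a / (2 * Q)) 1.
    have t0 : 0 < a / (2 * Q) by rewrite divr_gt0 // mulr_gt0.
    have := p_le _ t0 h; have -> : a / (2 * Q) * Q = a / 2 by field; rewrite gt_eqF.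
    lra.
  have Q2 : 0 < 2 * Q by lra.
  move: h; rewrite (ltr_pdivlMr _ _ Q2) => h.
  by have := p_le 1 ltr01 (lexx 1); lra.
move=> t0 t1.
have h1 : `|(m - t) - m| <= 1 by rewrite addrAC subrr add0r normrN ger0_norm // ltW.
have h2 : `|(m + t) - m| <= 1 by rewrite addrAC subrr add0r ger0_norm // ltW.
have mt : m - t <= m + t by lra.
have := H (m - t) (m + t) 1 mt h1 h2; rewrite -/F.
have -> : m + t - (m - t) = 2 * t by ring.
set I := \int[P]_x _ => /(le_trans (ler_norm _)); rewrite lerBlDr => hI.
have {}hI : I <= t * (2 * (M * (D + C * F))).
  move: hI; rewrite ler_pdivrMr //; lra.
apply: le_trans hI.
have -> : expR (k * m) * pi * p = \int[P]_x (expR (k * m) * pi * \1_[set x | Y x = m] x).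
  rewrite RintegralZl //; last exact: integrable_indic.
  congr (_ * _); rewrite /Rintegral /p; congr fine.
  by rewrite integral_indic // setIT.
apply: le_Rintegral => //.
- by apply: eq_integrable (integrableZl measurableT (expR (k * m) * pi) (integrable_indic P mA)).
- apply: (@tilted_integrable k (fun x => pi * (hstep (m - t) (Y x) - hstep (m + t) (Y x))) pi).
    by apply: measurable_funM => //; apply: measurable_funB; exact: hstep_measurable.
  move=> x; have h3 := hstep_le (Y x) mt.
  case/andP: (hstep_bound (m - t) (Y x)) => a1 a2; case/andP: (hstep_bound (m + t) (Y x)) => a3 a4.
  rewrite ger0_norm; last by rewrite mulr_ge0 ?(ltW pi0) // subr_ge0.
  by rewrite ler_piMr ?(ltW pi0) //; lra.
move=> x _; rewrite indicE; case: (boolP (x \in _)) => [|_].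
  rewrite inE /= => ->; rewrite (@hstep_gt (m - t) m); last by lra.
  by rewrite (@hstep_lt (m + t) m) ?subr0 ?mulr1 //; lra.
rewrite mulr0 mulr_ge0 ?expR_ge0 // mulr_ge0 ?(ltW pi0) // subr_ge0.
exact: hstep_le.
Qed.

Lemma tail_asymptotic : exists C K : R, [/\ 0 < C, 16 <= K & forall k, K <= k ->
  0 < Sinf w v k /\
  let main := expR (Linf w v k) * expR (- (k * Minf w v k)) / (k * Num.sqrt (2 * pi * Sinf w v k)) in
  `|fine (P [set x | Minf w v k < Y x]) - main| <= C * main * Num.sqrt (ln k / k)].
Proof.
have [C [K [C0 K16 H]]] := tail_hstep.
have [K' _ H'] := no_atom_at_mean.
exists C, (Num.max K K'); split => //; first by rewrite le_max K16.
move=> k; rewrite ge_max => /andP[Kk K'k]; have [S0 {}H] := H k Kk; split => // main.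
suff -> : fine (P [set x | Minf w v k < Y x]) = \int[P]_x hstep (Minf w v k) (Y x) by exact: H.
set m := Minf w v k.
have mA : measurable [set x | Y x = m].
  by have := mY measurableT (measurable_set1 m); rewrite setTI.
have mB : measurable [set x | m < Y x].
  have -> : [set x | m < Y x] = setT `&` Y @^-1` `]m, +oo[.
    by rewrite setTI; apply/seteqP; split => x /=; rewrite in_itv /= andbT.
  exact: (mY measurableT).
have -> : \int[P]_x hstep m (Y x) = \int[P]_x (\1_[set x | m < Y x] x + 1 / 2 * \1_[set x | Y x = m] x).
  apply: eq_Rintegral => x _; rewrite !indicE.
  have -> : (x \in [set x | m < Y x]) = (m < Y x) by apply/idP/idP; rewrite inE.
  have -> : (x \in [set x | Y x = m]) = (Y x == m) by apply/idP/idP; rewrite inE => /eqP.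
  case: (ltgtP m (Y x)) => [h|h|->].
  - by rewrite hstep_gt // mulr0 addr0.
  - by rewrite hstep_lt // mulr0 addr0.
  - by rewrite hstep_eq mulr1 add0r.
have i1 := integrable_indic P mB.
have i2 := integrable_indic P mA.
rewrite RintegralD //; last by apply: eq_integrable (integrableZl measurableT (1 / 2) i2).
rewrite RintegralZl // /Rintegral !integral_indic // !setIT.
have e0 : P [set x | Y x = m] = 0%E := H' k K'k.
by rewrite [X in 1 / 2 * fine X]e0 mulr0 addr0.
Qed.

End Tail.

(** * The random Euler product *)

Section CubeRoots.
Variable R : realType.

Lemma sin_2pi3_gt0 : 0 < sin (2 * pi / 3) :> R.
Proof. by have p0 := @pi_gt0 R; apply: sin_gt0_pi; apply/andP; split; lra. Qed.

(** With c = cos x, the equation cos(3x) = 1 reads (c - 1)(2c + 1)^2 = 0, and sin x > 0 excludes c =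
    1. *)
Lemma cos_2pi3 : cos (2 * pi / 3) = - (1 / 2) :> R.
Proof.
set x : R := 2 * pi / 3.
have h3 : cos (x + x + x) = 1 :> R.
  have -> : x + x + x = pi *+ 2 by rewrite /x -mulr_natl; field.
  exact: cos2pi.
have s0 : 0 < sin x := sin_2pi3_gt0.
have cs : cos x ^+ 2 + sin x ^+ 2 = 1 by exact: cos2Dsin2.
move: h3; rewrite !cosD !sinD; move: (cos x) (sin x) s0 cs => c s s0 cs h.
have e : (c - 1) * (2 * c + 1) ^+ 2 = 0.
  have : c * c * c - 3 * c * s ^+ 2 = 1 by apply: etrans h; ring.
  have -> : s ^+ 2 = 1 - c ^+ 2 by rewrite -cs; ring.
  move=> e; have -> : (c - 1) * (2 * c + 1) ^+ 2 = (c * c * c - 3 * c * (1 - c ^+ 2)) - 1 by ring.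
  by rewrite e subrr.
have c1 : c - 1 != 0.
  apply/eqP => c1; have s2 : 0 < s ^+ 2 by exact: exprn_gt0.
  have c2 : c = 1 by lra.
  by move: cs; rewrite c2; lra.
move/eqP: e; rewrite mulf_eq0 (negbTE c1) /= expf_eq0 /= => /eqP; lra.
Qed.

Lemma omega3_sqr : omega3 R ^+ 2 = Complex (- (1 / 2)) (- sin (2 * pi / 3)).
Proof.
have cs : cos (2 * pi / 3) ^+ 2 + sin (2 * pi / 3) ^+ 2 = 1 :> R by exact: cos2Dsin2.
rewrite expr2 /omega3; move: cs; rewrite cos_2pi3; move: (sin _) => s cs.
simpc; congr Complex; last by field.
lra.
Qed.

Definition cube_vals : seq R[i] := [:: 1; omega3 R; omega3 R ^+ 2; 0].

Lemma cube_vals_uniq : uniq cube_vals.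
Proof.
have s0 := sin_2pi3_gt0.
rewrite /cube_vals omega3_sqr /omega3 /= !inE !eq_complex /= !negb_or !negb_and.
set s := sin _ in s0 *.
have n1 : s != 0 by rewrite gt_eqF.
have n2 : - s != 0 by rewrite oppr_eq0.
have n3 : s != - s by rewrite -subr_eq0 opprK gt_eqF // addr_gt0.
have n4 : 0 != s by rewrite eq_sym.
have n5 : 0 != - s by rewrite eq_sym.
by rewrite n1 n2 n3 n4 n5 oner_eq0 !orbT.
Qed.

End CubeRoots.

Section Law.
Context (d : measure_display) (T : measurableType d) (R : realType) (P : probability T R).
Variable X : nat -> T -> R[i].
Hypothesis ml : model_law P X.
Hypothesis mi : model_indep P X.

(** The probability of each cube root of unity. The value 0 then has mass 1 - 3 alpha, which
    vanishes in the first case, so both kinds of primes are treated as one four-valued law. *)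
Definition alpha (p : nat) : R :=
  if (p == 3)%N || (p %% 3 == 2)%N then 3%:R^-1 else p%:R / (3%:R * (p%:R + 2%:R)).

Lemma X_measurable p z : prime p -> measurable (X p @^-1` [set z]).
Proof. by move=> /ml [h _]. Qed.

Lemma X_in p x : prime p -> X p x \in cube_vals R.
Proof.
move=> /ml [_]; case: ifP => _ [h _]; have := h x; rewrite !inE.
  by case/or3P => ->; rewrite ?orbT.
by case/or4P => ->; rewrite ?orbT.
Qed.

Definition xweight (p : nat) (c : R[i]) : R := if c == 0 then 1 - 3 * alpha p else alpha p.

Lemma omega3_neq0 : omega3 R != 0.
Proof. by have := cube_vals_uniq R; rewrite /= !inE !negb_or -!andbA => /and5P[_ _ _ _ /andP[]]. Qed.

Lemma PX p c : prime p -> c \in cube_vals R -> P (X p @^-1` [set c]) = (xweight p c)%:E.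
Proof.
move=> pp cin; have p0 := @primeR_gt0 R p pp; have p2 : 0 < p%:R + 2 :> R by rewrite addr_gt0.
have o0 := omega3_neq0; have o20 : omega3 R ^+ 2 != 0 by rewrite expf_neq0.
have [_] := ml pp; rewrite /xweight /alpha; case: ifP => _ [hin hP].
- have h0 := hP 0%N isT; have h1 := hP 1%N isT; have h2 := hP 2%N isT.
  move: cin; rewrite !inE => /or4P[] /eqP ->.
  + by rewrite oner_eq0 -h0 expr0.
  + by rewrite (negbTE o0) -h1 expr1.
  + by rewrite (negbTE o20) -h2.
  + rewrite eqxx mulfV // subrr.
    suff -> : X p @^-1` [set 0] = set0 by rewrite measure0.
    apply/seteqP; split => // x /= e; have := hin x; rewrite e !inE => /or3P[] h.
    * by rewrite eq_sym oner_eq0 in h.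
    * by rewrite eq_sym (negbTE o0) in h.
    * by rewrite eq_sym (negbTE o20) in h.
- case: hP => hz hP; have h0 := hP 0%N isT; have h1 := hP 1%N isT; have h2 := hP 2%N isT.
  move: cin; rewrite !inE => /or4P[] /eqP ->.
  + by rewrite oner_eq0 -h0 expr0.
  + by rewrite (negbTE o0) -h1 expr1.
  + by rewrite (negbTE o20) -h2.
  + by rewrite eqxx hz; congr EFin; field; rewrite gt_eqF.
Qed.

Definition cyl (t : seq nat) (z : nat -> R[i]) : set T :=
  \bigcap_(p in [set p | p \in t]) (X p @^-1` [set z p]).

Lemma cyl_measurable t z : all prime t -> measurable (cyl t z).
Proof.
move=> /allP ap; apply: fin_bigcap_measurable; first exact: finite_seq.
by move=> p /= pt; apply: X_measurable; exact: ap.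
Qed.

Lemma P_cyl_cons N t z : prime N -> N \notin t -> uniq t -> all prime t ->
  P (cyl (N :: t) z) = (P (X N @^-1` [set z N]) * P (cyl t z))%E.
Proof.
move=> pN Nt ut ap; rewrite /cyl !mi //=; last 2 first.
- by rewrite Nt.
- by rewrite pN.
by rewrite big_cons.
Qed.

Variables (lam : nat -> R[i] -> R) (w v : nat -> nat -> R).
Hypothesis lamH : forall p (H : R -> R), prime p ->
  \sum_(c <- cube_vals R) xweight p c * H (lam p c) =
  w p 0%N * H (v p 0%N) + w p 1%N * H (v p 1%N) + w p 2%N * H (v p 2%N).

Definition YN N x : R := psum N (fun p => lam p (X p x)).

Lemma lamX_measurable p : prime p -> measurable_fun setT (fun x => lam p (X p x)).
Proof.
move=> pp.
have -> : (fun x => lam p (X p x)) =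
    (fun x => \sum_(c <- cube_vals R) lam p c * \1_(X p @^-1` [set c]) x).
  apply/funext => x; rewrite (bigD1_seq (X p x)) ?X_in ?cube_vals_uniq //=.
  rewrite indicE mem_set //= mulr1 big1 ?addr0 // => c cx.
  rewrite indicE memNset ?mulr0 // => /= e; move: cx; by rewrite e eqxx.
apply: measurable_sum => c; apply: measurable_funM => //.
by apply: measurable_indic; exact: X_measurable.
Qed.

Lemma YN_measurable N : measurable_fun setT (YN N).
Proof.
elim: N => [|N IH].
  have -> : YN 0 = fun=> 0 by apply/funext => x; rewrite /YN psum0.
  exact: measurable_cst.
have -> : YN N.+1 = fun x => YN N x + (if prime N then lam N (X N x) else 0).
  by apply/funext => x; rewrite /YN psumS.
apply: measurable_funD => //; case pN: (prime N); last exact: measurable_cst.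
exact: lamX_measurable.
Qed.

(* Restricting to a cylinder over primes >= N is what makes the induction on N use
   independence. *)
Lemma YN_law_cyl N t z (h : R -> R) : uniq t -> all prime t -> all (leq N) t ->
  measurable_fun setT h -> (forall y, 0 <= h y) ->
  (\int[P]_(x in cyl t z) (h (YN N x))%:E = (En w v N h)%:E * P (cyl t z))%E.
Proof.
elim: N t z h => [|N IH] t z h ut ap aN mh h0.
  rewrite En0 -integral_cst //; last exact: cyl_measurable.
  by apply: eq_integral => x _; rewrite /YN psum0.
have aN' : all (leq N) t by apply: sub_all aN => q /ltnW.
have [pN|npN] := boolP (prime N); last first.
  rewrite EnS (negbTE npN) -IH //; apply: eq_integral => x _.
  by rewrite /YN psumS (negbTE npN) addr0.
have Nt : N \notin t by apply/negP => /(allP aN); rewrite ltnn.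
pose z' c := fun q => if q == N then c else z q.
have cylE c : cyl (N :: t) (z' c) = (X N @^-1` [set c]) `&` cyl t z.
  apply/seteqP; split => x.
    move=> hx; split; first by have := hx N; rewrite /= /z' eqxx inE eqxx; apply.
    move=> q /= qt; have := hx q; rewrite /= /z' inE qt orbT => /(_ isT).
    by case: eqP => // e; move: Nt; rewrite -e qt.
  move=> [hc hx] q /=; rewrite inE /z'; case: eqP => [-> _//|_ /= qt]; exact: hx.
have Dsplit : cyl t z = \big[setU/set0]_(c <- cube_vals R) ((X N @^-1` [set c]) `&` cyl t z).
  apply/seteqP; split => x.
    move=> hx; rewrite (bigD1_seq (X N x)) ?X_in ?cube_vals_uniq //=; by left; split.
  rewrite -bigcup_seq => -[c _ []] //.
have mD : measurable (cyl t z) by exact: cyl_measurable.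
have mf : measurable_fun setT (fun x => (h (YN N.+1 x))%:E).
  by apply: measurable_EFin_comp; apply: measurableT_comp => //; exact: YN_measurable.
rewrite [in LHS]Dsplit ge0_integral_bigsetU; last first.
- by move=> x _; rewrite lee_fin.
- exact: (measurable_funS measurableT).
- apply/trivIsetP => c c' _ _ cc'; rewrite -subset0 => x [[/= e _] [/= e' _]].
  by move: cc'; rewrite -e -e' eqxx.
- exact: cube_vals_uniq.
- by move=> c; apply: measurableI => //; exact: X_measurable.
have step c : c \in cube_vals R ->
  (\int[P]_(x in X N @^-1` [set c] `&` cyl t z) (h (YN N.+1 x))%:E =
   (xweight N c * En w v N (fun y => h (y + lam N c)))%:E * P (cyl t z))%E.
  move=> cin.
  have -> : (\int[P]_(x in X N @^-1` [set c] `&` cyl t z) (h (YN N.+1 x))%:E =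
     \int[P]_(x in cyl (N :: t) (z' c)) ((fun y => h (y + lam N c)) (YN N x))%:E)%E.
    rewrite cylE; apply: eq_integral => x; rewrite inE => -[/= e _].
    by rewrite /YN psumS pN e.
  apply: (etrans (IH (N :: t) (z' c) (fun y => h (y + lam N c)) _ _ _ _ _)) => //=.
  - by rewrite Nt.
  - by rewrite pN.
  - by rewrite leqnn.
  - by apply: measurableT_comp => //; apply: measurable_funD.
  have zN : z' c N = c by rewrite /z' eqxx.
  rewrite P_cyl_cons // zN PX //.
  have -> : cyl t (z' c) = cyl t z.
    apply: eq_bigcapr => q /= qt; rewrite /z'; case: eqP => // e.
    by move: Nt; rewrite -e qt.
  by rewrite muleA -EFinM mulrC.
rewrite (eq_big_seq _ step).
have [r ->] : exists r, P (cyl t z) = r%:E.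
  by exists (fine (P (cyl t z))); rewrite fineK // fin_num_measure.
under eq_bigr do rewrite -EFinM.
rewrite sumEFin -mulr_suml EFinM; congr (_%:E * _)%E; rewrite EnS pN.
exact: (lamH (fun u => En w v N (fun y => h (y + u))) pN).
Qed.

Lemma YN_law N (h : R -> R) : measurable_fun setT h -> (forall y, 0 <= h y) ->
  (\int[P]_x (h (YN N x))%:E = (En w v N h)%:E)%E.
Proof.
move=> mh h0; have := @YN_law_cyl N [::] (fun=> 0) h isT isT isT mh h0.
have -> : cyl [::] (fun=> 0) = setT by apply/seteqP; split => // x _ q.
by move=> ->; rewrite -[RHS]mule1; congr (_ * _)%E; exact: probability_setT.
Qed.

End Law.

(** * Almost sure convergence of the sum over all primes *)

Section BlockLaw.
Variables (R : realType) (w v : nat -> nat -> R).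
Hypothesis model : forall p, prime p -> three_point p (w p) (v p).

(** Annulling the values below a while keeping the weights makes a block of the sum a full sum of
    the same form. *)
Definition vfrom (a p i : nat) : R := if (a <= p)%N then v p i else 0.

Lemma En_exp_from a N r : En w (vfrom a) N (fun y => expR (r * y)) =
  expR (psum N (fun p => if (a <= p)%N then logE w v p r else 0)).
Proof.
elim: N => [|N IH]; first by rewrite En0 psum0 mulr0.
rewrite EnS psumS; case: ifP => pN; last by rewrite addr0.
have h i : En w (vfrom a) N (fun y => expR (r * (y + vfrom a N i))) =
    expR (r * vfrom a N i) * En w (vfrom a) N (fun y => expR (r * y)).
  by rewrite -EnZ; apply: eq_En => y; rewrite mulrDr expRD mulrC.
rewrite (h 0%N) (h 1%N) (h 2%N) IH !mulrA -mulrDl -mulrDl expRD mulrC; congr (_ * _).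
rewrite /vfrom; case: ifP => aN.
  rewrite /logE lnK ?posrE ?(emomE_gt0 model) //.
  by rewrite /emom sum3 !expr0 !mulr1.
by rewrite !mulr0 expR0 !mulr1 (tp_w_sum (model pN)).
Qed.

Lemma En_exp_from_le a N r : (1 < a)%N ->
  En w (vfrom a) N (fun y => expR (r * y)) <= expR ((8 * `|r| + 16 * r ^+ 2) * (a%:R - 1)^-1).
Proof.
move=> a1; rewrite En_exp_from ler_expR.
have c0 : 0 <= 8 * `|r| + 16 * r ^+ 2 by rewrite addr_ge0 // mulr_ge0 // sqr_ge0.
apply: (@le_trans _ _ (psum N (fun p => (8 * `|r| + 16 * r ^+ 2) *
    (if (a <= p)%N then (p%:R ^+ 2)^-1 else 0)))).
  apply: ler_psum => p pp; case: ifP => _; last by rewrite mulr0.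
  exact: le_trans (ler_norm _) (logE_le model r pp).
rewrite psumZ ler_wpM2l //.
apply: (le_trans (psum_le_sum _ _)).
  by move=> n; case: ifP => // _; rewrite invr_ge0 exprn_ge0.
have a1' : 1 < a%:R :> R by rewrite ltr1n.
have h2 n : 0 <= (if (a <= n)%N then (n%:R ^+ 2)^-1 else 0 : R).
  by case: ifP => // _; rewrite invr_ge0 exprn_ge0.
apply: (@le_trans _ _ (\sum_(0 <= n < a + N) (if (a <= n)%N then (n%:R ^+ 2)^-1 else 0 : R))).
  by rewrite [leRHS](@big_cat_nat _ _ _ N) ?leq_addl //= lerDl sumr_ge0.
rewrite (@big_cat_nat _ _ _ a) ?leq_addr //=.
rewrite big_nat big1 ?add0r; last by move=> i /andP[_ ia]; rewrite leqNgt ia.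
rewrite -{1}[a]add0n big_addn addKn.
under eq_bigr do rewrite leq_addl natrD addrC.
exact: sum_inv_sqr_shift.
Qed.

End BlockLaw.

Section AeConvergence.
Context (d : measure_display) (T : measurableType d) (R : realType) (P : probability T R).
Variable X : nat -> T -> R[i].
Hypothesis ml : model_law P X.
Hypothesis mi : model_indep P X.
Variables (lam : nat -> R[i] -> R) (w v : nat -> nat -> R).
Hypothesis model : forall p, prime p -> three_point p (w p) (v p).
Hypothesis lamH : forall p (H : R -> R), prime p ->
  \sum_(c <- cube_vals R) xweight p c * H (lam p c) =
  w p 0%N * H (v p 0%N) + w p 1%N * H (v p 1%N) + w p 2%N * H (v p 2%N).
Hypothesis lam_le : forall p c, prime p -> c \in cube_vals R -> `|lam p c| <= 4 / p%:R.

Definition lamfrom (a p : nat) (c : R[i]) : R := if (a <= p)%N then lam p c else 0.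

Lemma lamfromH a p (H : R -> R) : prime p ->
  \sum_(c <- cube_vals R) xweight p c * H (lamfrom a p c) =
  w p 0%N * H (vfrom v a p 0%N) + w p 1%N * H (vfrom v a p 1%N) + w p 2%N * H (vfrom v a p 2%N).
Proof.
move=> pp; rewrite /lamfrom /vfrom; case: ifP => _; first exact: lamH.
have := lamH (fun=> H 0) pp; exact.
Qed.

Lemma YN_diff a b x : (a <= b)%N -> YN X lam b x - YN X lam a x = YN X (lamfrom a) b x.
Proof. by move=> ab; rewrite /YN psum_diff. Qed.

(** From |y| <= (e^{ty} + e^{-ty})/t. The block has variance O(1/a), so t of order sqrt a keeps the
    exponential moments bounded and gives an L^1 norm O(1/sqrt a). *)
Lemma block_L1 a b (t : R) : (1 < a)%N -> (a <= b)%N -> 0 < t ->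
  (\int[P]_x (`|YN X lam b x - YN X lam a x|)%:E <=
   (2 / t * expR ((8 * t + 16 * t ^+ 2) * (a%:R - 1)^-1))%:E)%E.
Proof.
move=> a1 ab t0.
have mY := YN_measurable ml (lamfrom a) b.
have me (r : R) : measurable_fun setT (fun y : R => expR (r * y)).
  by apply: measurableT_comp => //; apply: measurable_funM.
have e (r : R) : (\int[P]_x (expR (r * YN X (lamfrom a) b x))%:E <=
    (expR ((8 * `|r| + 16 * r ^+ 2) * (a%:R - 1)^-1))%:E)%E.
  rewrite (YN_law ml mi (@lamfromH a) b (me r)); last by move=> y; exact: expR_ge0.
  by rewrite lee_fin; exact: En_exp_from_le.
have me' (r : R) : measurable_fun setT (fun x => (expR (r * YN X (lamfrom a) b x))%:E).
  by apply: measurable_EFin_comp; exact: (measurableT_comp (me r) mY).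
apply: (@le_trans _ _ (\int[P]_x ((t^-1)%:E * ((expR (t * YN X (lamfrom a) b x))%:E +
    (expR (- t * YN X (lamfrom a) b x))%:E)))%E).
  apply: ge0_le_integral => //.
  - apply: measurable_EFin_comp; apply: measurableT_comp => //.
    by apply: measurable_funB; exact: (YN_measurable ml).
  - by apply: measurable_funeM; apply: emeasurable_funD.
  move=> x _; rewrite YN_diff // -EFinD -EFinM lee_fin ler_pdivlMl //.
  move: (YN X _ b x) => y.
  have h1 := expR_ge1Dx (t * y); have h2 := expR_ge1Dx (- t * y).
  have h3 := expR_ge0 (t * y); have h4 := expR_ge0 (- t * y).
  by have [yy|yy] := lerP 0 y; [rewrite ger0_norm|rewrite ltr0_norm] => //; lra.
rewrite ge0_integralZl_EFin //; last 3 first.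
- by move=> x _; rewrite adde_ge0 // lee_fin expR_ge0.
- exact: emeasurable_funD.
- by rewrite invr_ge0 ltW.
rewrite ge0_integralD //.
set E := expR _.
have -> : (2 / t * E)%:E = ((t^-1)%:E * (E%:E + E%:E))%E.
  by rewrite -EFinD -EFinM; congr EFin; ring.
apply: lee_wpmul2l; first by rewrite lee_fin invr_ge0 ltW.
have e1 := e t; have e2 := e (- t); move: e1 e2; rewrite normrN sqrrN (ger0_norm (ltW t0)) => e1 e2.
exact: leeD.
Qed.

Lemma YN_gap a m x : (0 < a)%N -> `|YN X lam (a + m) x - YN X lam a x| <= m%:R * (4 / a%:R).
Proof.
move=> a0; have a0' : 0 < a%:R :> R by rewrite ltr0n.
elim: m => [|m IH]; first by rewrite addn0 subrr normr0 mul0r.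
rewrite addnS /YN psumS -/(YN X lam (a + m) x) -/(YN X lam a x) addrAC -natr1 mulrDl mul1r.
apply: (le_trans (ler_normD _ _)); apply: lerD => //.
case: ifP => pp; last by rewrite normr0 divr_ge0.
apply: (le_trans (lam_le pp (X_in ml x pp))); rewrite ler_pM2l // lef_pV2 ?posrE //.
  by rewrite ler_nat leq_addr.
by rewrite ltr0n addn_gt0 a0.
Qed.

Lemma fourth_power_bracket (n0 N : nat) : (n0.+2 ^ 4 <= N)%N ->
  exists n, [/\ (n0 <= n)%N, (n.+2 ^ 4 <= N)%N & (N < n.+3 ^ 4)%N].
Proof.
elim: N => [|N IH]; first by rewrite leqn0 expn_eq0.
rewrite leq_eqVlt => /predU1P[<-|].
  by exists n0; split => //; rewrite ltn_exp2r.
rewrite ltnS => /IH [n [h1 h2 h3]].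
have [h|h] := ltnP N.+1 (n.+3 ^ 4); first by exists n; split => //; exact: leqW.
have e : N.+1 = (n.+3 ^ 4)%N by apply/eqP; rewrite eqn_leq h3.
by exists n.+1; rewrite e; split => //; [exact: leqW|rewrite ltn_exp2r].
Qed.

(** For a = y^4 and t = y^2 the exponent stays below 48, and the block norms O(1/y^2) are summable.
    Between y^4 and (y+1)^4 there are at most 15 y^3 integers, with terms at most 4/y^4, so the sum
    moves by at most 60/y. *)
Lemma YN_ae_cvg : \forall x \ae P, cvgn (fun N => YN X lam N x).
Proof.
pose D k x := YN X lam (k.+3 ^ 4) x - YN X lam (k.+2 ^ 4) x.
have mono k : (k.+2 ^ 4 <= k.+3 ^ 4)%N by rewrite leq_exp2r.
have hD k : (\int[P]_x (`|D k x|)%:E <= ((2 * expR 48) * ((2 + k%:R) ^+ 2)^-1)%:E)%E.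
  have y2 : 2 <= 2 + k%:R :> R by rewrite lerDl.
  have t0 : 0 < (2 + k%:R) ^+ 2 :> R by apply: exprn_gt0; lra.
  apply: (le_trans (block_L1 _ (mono k) t0)).
    by rewrite -[ltnLHS](exp1n 4) ltn_exp2r.
  rewrite lee_fin mulrAC ler_pM2r ?invr_gt0 // ler_pM2l // ler_expR.
  have -> : (k.+2 ^ 4)%:R = (2 + k%:R) ^+ 4 :> R.
    by rewrite natrX; congr (_ ^+ _); rewrite -natr1 -natr1; ring.
  set y := 2 + k%:R in y2 t0 *.
  have y4 : 16 <= y ^+ 4.
    have : 4 <= y ^+ 2 by nra.
    have -> : y ^+ 4 = (y ^+ 2) ^+ 2 by ring.
    nra.
  have y1 : 1 <= y ^+ 2 by nra.
  rewrite ler_pdivrMr; last by lra.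
  have -> : (y ^+ 2) ^+ 2 = y ^+ 4 by ring.
  have : y ^+ 2 <= y ^+ 4.
    have -> : y ^+ 4 = y ^+ 2 * y ^+ 2 by ring.
    by rewrite ler_peMr // ltW.
  lra.
have := @ae_cvg_series d T R P D (fun k => (2 * expR 48) * ((2 + k%:R) ^+ 2)^-1) (2 * expR 48).
move=> /(_ _ hD) H.
have {}H : \forall x \ae P, cvgn (series (fun k => D k x)).
  apply: H.
    by move=> k; apply: measurable_funB; exact: (YN_measurable ml).
  move=> n; rewrite -mulr_sumr ler_piMr ?mulr_ge0 ?expR_ge0 //.
  apply: (le_trans (sum_inv_sqr_shift _ _)); first by rewrite ltr1n.
  have -> : 2 - 1 = 1 :> R by ring.
  by rewrite invr1.
apply: filterS H => x /cvg_ex [l hl].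
have sE n : series (fun k => D k x) n = YN X lam (n.+2 ^ 4) x - YN X lam (2 ^ 4) x.
  by rewrite /series /= /D (telescope_sumr (fun k => YN X lam (k.+2 ^ 4) x)).
apply/cvg_ex; exists (l + YN X lam (2 ^ 4) x).
apply/cvgrPdist_le => e e0.
have e2 : 0 < e / 2 by rewrite divr_gt0.
move/cvgrPdist_le : hl => /(_ _ e2) [n1 _ hn1].
pose n0 := maxn n1 (Num.truncn (60 / (e / 2))).
exists (n0.+2 ^ 4)%N => // N /= /fourth_power_bracket [n [n0n h1 h2]].
have n1n : (n1 <= n)%N by apply: leq_trans n0n; exact: leq_maxl.
have := hn1 n n1n; rewrite sE => g1.
have a0 : (0 < n.+2 ^ 4)%N by rewrite expn_gt0.
have g2 := YN_gap (N - n.+2 ^ 4) x a0; rewrite subnKC // in g2.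
have g3 : (N - n.+2 ^ 4)%:R * (4 / (n.+2 ^ 4)%:R) <= e / 2 :> R.
  have y2 : 2 <= n.+2%:R :> R by rewrite ler_nat.
  set y := n.+2%:R in y2.
  have y0 : 0 < y by lra.
  have d1 : (N - n.+2 ^ 4)%:R <= 15 * y ^+ 3 :> R.
    rewrite natrB // lerBlDr natrX -/y.
    apply: (@le_trans _ _ ((y + 1) ^+ 4)).
      rewrite /y natr1 -natrX ler_nat; exact: ltnW.
    have y13 : 1 <= y by lra.
    have a1 : y ^+ 2 <= y ^+ 3 by rewrite ler_eXn2l //; lra.
    have a2 : y <= y ^+ 3 by rewrite -{1}[y]expr1 ler_eXn2l //; lra.
    have a3 : 1 <= y ^+ 3 by rewrite -(expr0 y) ler_eXn2l //; lra.
    have -> : (y + 1) ^+ 4 = y ^+ 4 + 4 * y ^+ 3 + 6 * y ^+ 2 + 4 * y + 1 by ring.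
    lra.
  apply: (@le_trans _ _ (15 * y ^+ 3 * (4 / y ^+ 4))).
    by rewrite natrX -/y ler_wpM2r // divr_ge0 // exprn_ge0 // ltW.
  have -> : 15 * y ^+ 3 * (4 / y ^+ 4) = 60 / y by field; rewrite gt_eqF.
  rewrite ler_pdivrMr // mulrC -ler_pdivrMr //; apply: ltW.
  apply: (lt_le_trans (truncnS_gt _)); rewrite ler_nat ltnS.
  by apply: leqW; apply: leq_trans n0n; exact: leq_maxr.
have -> : l + YN X lam (2 ^ 4) x - YN X lam N x =
  (l - (YN X lam (n.+2 ^ 4) x - YN X lam (2 ^ 4) x)) - (YN X lam N x - YN X lam (n.+2 ^ 4) x) by ring.
apply: (le_trans (ler_normB _ _)); have g4 := le_trans g2 g3; lra.
Qed.

End AeConvergence.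

Section MeasurableLimit.
Context (d : measure_display) (T : measurableType d) (R : realType).

(** Cauchy's criterion with countable quantifiers, so that the set of convergence is measurable. *)
Lemma cvgn_cauchyP (u : nat -> R) : cvgn u <->
  forall n : nat, exists m : nat, forall i j, (m <= i)%N -> (m <= j)%N -> `|u i - u j| <= n.+1%:R^-1.
Proof.
split.
  move=> /cvg_ex [l hl] n.
  have e0 : 0 < n.+1%:R^-1 / 2 :> R by rewrite divr_gt0 ?invr_gt0.
  move/cvgrPdist_le : hl => /(_ _ e0) [m _ hm]; exists m => i j mi mj.
  have := hm i mi; have := hm j mj => h1 h2.
  have -> : u i - u j = (l - u j) - (l - u i) by ring.
  apply: (le_trans (ler_normB _ _)); move: (n.+1%:R^-1) h1 h2 {e0 hm} => e h1 h2.
  by have := lerD h1 h2; rewrite -splitr.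
move=> h; apply: cauchy_cvg; apply: cauchy_exP => e e0.
have [m hm] := h (Num.truncn (e^-1)).
exists (u m); exists m => // i /= mi.
rewrite -ball_normE /=; apply: (le_lt_trans (hm _ _ (leqnn m) mi)).
rewrite -[ltRHS]invrK ltf_pV2 ?posrE ?invr_gt0 //.
exact: truncnS_gt.
Qed.

(** Where the sequence diverges [limn] is the default [point]; the function is therefore glued from
    the set of convergence and its complement. *)
Lemma measurable_limn (f : nat -> T -> R) : (forall n, measurable_fun setT (f n)) ->
  measurable_fun setT (fun x => limn (fun n => f n x)).
Proof.
move=> mf.
pose E := [set x | cvgn (fun n => f n x)].
have mE : measurable E.
  have -> : E = \bigcap_n \bigcup_m \bigcap_(i in [set i | (m <= i)%N])
      \bigcap_(j in [set j | (m <= j)%N]) [set x | `|f i x - f j x| <= n.+1%:R^-1].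
    apply/seteqP; split => x /=.
      by move=> /cvgn_cauchyP h n _; have [m hm] := h n; exists m => // i /= mi j /= mj; exact: hm.
    by move=> h; apply/cvgn_cauchyP => n; have [m _ hm] := h n I; exists m => i j mi mj; exact: hm.
  apply: bigcapT_measurable => n; apply: bigcupT_measurable => m.
  apply: bigcap_measurable => [|i _]; first by exists m => /=.
  apply: bigcap_measurable => [|j _]; first by exists m => /=.
  have mg : measurable_fun setT (fun x => `|f i x - f j x|).
    by apply: measurableT_comp => //; exact: measurable_funB.
  have -> : [set x | `|f i x - f j x| <= n.+1%:R^-1] =
    setT `&` (fun x => `|f i x - f j x|) @^-1` `]-oo, n.+1%:R^-1].
    by rewrite setTI; apply/seteqP; split => x /=; rewrite in_itv.
  exact: mg.
rewrite -(setUv E); apply/measurable_funU => //; first exact: measurableC.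
split.
  apply: (@measurable_fun_cvg _ _ _ E f) => [n|x hx]; last exact: hx.
  exact: (measurable_funS measurableT).
apply: (@eq_measurable_fun _ _ _ _ _ (fun=> point)); last exact: measurable_cst.
by move=> x; rewrite inE => hx; rewrite dvgP.
Qed.

End MeasurableLimit.

(** * Logarithms of the Euler factors *)

Section EulerFactor.
Variable R : realType.
Implicit Types (p : nat) (c : R[i]).

Definition factor_sqr p c : R :=
  complex.Re (1 - c / (p%:R)%:C%C) ^+ 2 + complex.Im (1 - c / (p%:R)%:C%C) ^+ 2.

Definition lamL p c : R := - ln (factor_sqr p c).

(** The value of 2 log |1 - X(p)/p|^-1 at X(p) = 1; at both primitive cube roots it is [- valw p],
    since |1 - omega/p|^2 = 1 + 1/p + 1/p^2. *)
Definition val1 p : R := - 2 * ln (1 - p%:R^-1).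
Definition valw p : R := ln (1 + p%:R^-1 + p%:R^-1 ^+ 2).

Lemma invp_bounds p : prime p -> 0 < p%:R^-1 :> R /\ p%:R^-1 <= 1 / 2 :> R.
Proof.
move=> pp; split; first by rewrite invr_gt0 primeR_gt0.
by rewrite mul1r lef_pV2 ?posrE ?primeR_gt0 // ler_nat prime_gt1.
Qed.

Lemma divC_real (a b x : R) : x != 0 ->
  (Complex a b) / (x%:C)%C = Complex (a / x) (b / x).
Proof.
move=> x0.
have -> : ((x%:C)%C)^-1 = (x^-1)%:C%C by rewrite fmorphV.
by rewrite /=; simpc.
Qed.

Lemma factor_sqr1 p : prime p -> factor_sqr p 1 = (1 - p%:R^-1) ^+ 2.
Proof.
move=> pp; have p0 : p%:R != 0 :> R by rewrite gt_eqF // primeR_gt0.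
rewrite /factor_sqr (_ : 1 = Complex 1 0) // divC_real //.
by rewrite /= !mul0r subrr expr0n addr0 mul1r.
Qed.

Lemma factor_sqr0 p : factor_sqr p 0 = 1.
Proof. by rewrite /factor_sqr mul0r subr0 /= expr1n expr0n addr0. Qed.

Lemma factor_sqrw p c : prime p -> (c == omega3 R) || (c == omega3 R ^+ 2) ->
  factor_sqr p c = 1 + p%:R^-1 + p%:R^-1 ^+ 2.
Proof.
move=> pp; have p0 : p%:R != 0 :> R by rewrite gt_eqF // primeR_gt0.
have cs : cos (2 * pi / 3) ^+ 2 + sin (2 * pi / 3) ^+ 2 = 1 :> R by exact: cos2Dsin2.
move: cs; rewrite omega3_sqr /omega3 cos_2pi3; move: (sin _) => s cs.
have s2 : s ^+ 2 = 3 / 4 by move: cs; lra.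
case/orP => /eqP ->; rewrite /factor_sqr divC_real //=; move: (p%:R^-1) => x.
- have -> : (1 - - (1 / 2) * x) ^+ 2 + (0 - s * x) ^+ 2 = 1 + x + x ^+ 2 / 4 + s ^+ 2 * x ^+ 2 by field.
  by rewrite s2; field.
- have -> : (1 - - (1 / 2) * x) ^+ 2 + (0 - - s * x) ^+ 2 = 1 + x + x ^+ 2 / 4 + s ^+ 2 * x ^+ 2 by field.
  by rewrite s2; field.
Qed.

Lemma lamL1 p : prime p -> lamL p 1 = val1 p.
Proof.
move=> pp; have [x0 x1] := invp_bounds pp.
rewrite /lamL factor_sqr1 // lnXn; last by rewrite subr_gt0; lra.
by rewrite /val1 mulNr mulr_natl.
Qed.

Lemma lamL0 p : lamL p 0 = 0.
Proof. by rewrite /lamL factor_sqr0 ln1 oppr0. Qed.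

Lemma lamLw p c : prime p -> (c == omega3 R) || (c == omega3 R ^+ 2) -> lamL p c = - valw p.
Proof. by move=> pp h; rewrite /lamL factor_sqrw. Qed.

Lemma ln_ge_frac (y : R) : 0 < y -> 1 - y^-1 <= ln y.
Proof.
move=> y0; have h : -1 < y^-1 - 1 by rewrite ltrBrDl subrr invr_gt0.
have := le_ln1Dx h; rewrite addrC subrK lnV ?posrE //; lra.
Qed.

Lemma val1_bounds p : prime p -> 2 * p%:R^-1 <= val1 p <= 4 * p%:R^-1.
Proof.
move=> pp; have [x0 x1] := invp_bounds pp; rewrite /val1; move: (p%:R^-1) x0 x1 => x x0 x1.
have x2 : 0 < 1 - x by lra.
have h1 : ln (1 - x) <= - x by have := @le_ln1Dx R (- x); apply; lra.
have h2 := ln_ge_frac x2.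
have h3 : (1 - x)^-1 <= 1 + 2 * x by rewrite -[leLHS]mul1r ler_pdivrMr //; nra.
apply/andP; split; lra.
Qed.

Lemma valw_bounds p : prime p -> p%:R^-1 / 2 <= valw p <= 2 * p%:R^-1.
Proof.
move=> pp; have [x0 x1] := invp_bounds pp; rewrite /valw; move: (p%:R^-1) x0 x1 => x x0 x1.
have y0 : 0 < 1 + x + x ^+ 2 by nra.
have h1 := ln_ge_frac y0.
have h2 : ln (1 + x + x ^+ 2) <= x + x ^+ 2.
  by have := @le_ln1Dx R (x + x ^+ 2); rewrite addrA; apply; nra.
have h3 : (1 + x + x ^+ 2)^-1 <= 1 - x / 2 by rewrite -[leLHS]mul1r ler_pdivrMr //; nra.
apply/andP; split; nra.
Qed.

(** The factorization (1 - x)(1 + x + x^2) = 1 - x^3 gives -2 ln(1 - x^3). This cancellation is the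
    origin of [tp_mean]. *)
Lemma val1_valw p : prime p -> 0 <= val1 p - 2 * valw p <= 4 * p%:R^-1 ^+ 2.
Proof.
move=> pp; have [x0 x1] := invp_bounds pp; rewrite /valw /val1; move: (p%:R^-1) x0 x1 => x x0 x1.
have y0 : 0 < 1 + x + x ^+ 2 by nra.
have x2 : 0 < 1 - x by lra.
have -> : - 2 * ln (1 - x) - 2 * ln (1 + x + x ^+ 2) = - 2 * ln (1 - x ^+ 3).
  have -> : 1 - x ^+ 3 = (1 - x) * (1 + x + x ^+ 2) by ring.
  by rewrite lnM ?posrE //; ring.
have z0 : 0 < x ^+ 3 by exact: exprn_gt0.
have z1 : x ^+ 3 <= x ^+ 2 / 2.
  have -> : x ^+ 3 = x ^+ 2 * x by ring.
  by have := sqr_ge0 x; nra.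
have z2 : x ^+ 2 <= 1 / 4 by nra.
have h1 : ln (1 - x ^+ 3) <= - x ^+ 3 by have := @le_ln1Dx R (- x ^+ 3); apply; lra.
have w0 : 0 < 1 - x ^+ 3 by lra.
have h2 := ln_ge_frac w0.
have h3 : (1 - x ^+ 3)^-1 <= 1 + 2 * x ^+ 3.
  by rewrite -[leLHS]mul1r ler_pdivrMr //; move: (x ^+ 3) z0 z1 w0 => z; nra.
apply/andP; split; lra.
Qed.

Lemma alpha_bounds p : prime p -> 1 / 4 <= alpha R p <= 1 / 3.
Proof.
move=> pp; rewrite /alpha; case: ifP => [_|h]; first by apply/andP; split; lra.
(* The remaining primes are 1 mod 3, and p >= 6 is exactly the condition p/(3(p+2)) >= 1/4. *)
have p6 : (6 <= p)%N.
  by move: pp h; do 7 (case: p => // p).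
have p6' : 6 <= p%:R :> R by rewrite (ler_nat _ 6).
move: (p%:R) p6' => q q6.
have q0 : 0 < 3 * (q + 2) by lra.
by rewrite ler_pdivlMr // ler_pdivrMr //; apply/andP; split; lra.
Qed.

(* Local law of 2 log |1 - X(p)/p|^-1 in [wP], [vP], and of its negative in [wM], [vM], sorted
   so that the largest value comes first. *)
Definition wP p (i : nat) : R :=
  if i == 0%N then alpha R p else if i == 1%N then 2 * alpha R p else if i == 2%N then 1 - 3 * alpha R p else 0.
Definition vP p (i : nat) : R := if i == 0%N then val1 p else if i == 1%N then - valw p else 0.

Definition wM p (i : nat) : R :=
  if i == 0%N then 2 * alpha R p else if i == 1%N then alpha R p else if i == 2%N then 1 - 3 * alpha R p else 0.
Definition vM p (i : nat) : R := if i == 0%N then valw p else if i == 1%N then - val1 p else 0.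

Lemma modelP p : prime p -> three_point p (wP p) (vP p).
Proof.
move=> pp; have [x0 x1] := invp_bounds pp.
have /andP[a1 a2] := alpha_bounds pp; have /andP[b1 b2] := val1_bounds pp.
have /andP[c1 c2] := valw_bounds pp; have /andP[e1 e2] := val1_valw pp.
split => [i|i||i|i|||||]; rewrite /wP /vP /= ?mulr1 ?mul1r.
- by case: i => [|[|[|i]]] /=; lra.
- by case: i => [|[|[|i]]] /=; lra.
- by ring.
- by rewrite ler_norml; case: i => [|[|i]] /=; apply/andP; split; lra.
- by case: i => [|[|i]] /=; lra.
- lra.
- lra.
- lra.
- by rewrite invfM; lra.
- rewrite mulr0 addr0 -exprVn.
  have -> : alpha R p * val1 p + 2 * alpha R p * - valw p = alpha R p * (val1 p - 2 * valw p) by ring.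
  rewrite ger0_norm; last by rewrite mulr_ge0 //; lra.
  move: (val1 p - _) (p%:R^-1 ^+ 2) (alpha R p) a1 a2 e1 e2 => *; nra.
Qed.

Lemma modelM p : prime p -> three_point p (wM p) (vM p).
Proof.
move=> pp; have [x0 x1] := invp_bounds pp.
have /andP[a1 a2] := alpha_bounds pp; have /andP[b1 b2] := val1_bounds pp.
have /andP[c1 c2] := valw_bounds pp; have /andP[e1 e2] := val1_valw pp.
split => [i|i||i|i|||||]; rewrite /wM /vM /= ?mulr1 ?mul1r.
- by case: i => [|[|[|i]]] /=; lra.
- by case: i => [|[|[|i]]] /=; lra.
- by ring.
- by rewrite ler_norml; case: i => [|[|i]] /=; apply/andP; split; lra.
- by case: i => [|[|i]] /=; lra.
- lra.
- lra.
- lra.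
- by rewrite invfM; lra.
- rewrite mulr0 addr0 -exprVn.
  have -> : 2 * alpha R p * valw p + alpha R p * - val1 p = - (alpha R p * (val1 p - 2 * valw p)) by ring.
  rewrite normrN ger0_norm; last by rewrite mulr_ge0 //; lra.
  move: (val1 p - _) (p%:R^-1 ^+ 2) (alpha R p) a1 a2 e1 e2 => *; nra.
Qed.

Lemma cube_sum p (F : R[i] -> R) : \sum_(c <- cube_vals R) xweight p c * F c =
  alpha R p * F 1 + alpha R p * F (omega3 R) + alpha R p * F (omega3 R ^+ 2) + (1 - 3 * alpha R p) * F 0.
Proof.
have o0 : omega3 R != 0 by exact: omega3_neq0.
rewrite /cube_vals !big_cons big_nil /xweight oner_eq0 (negbTE o0) expf_eq0 /= (negbTE o0) eqxx.
by ring.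
Qed.

Lemma lamP_law p (H : R -> R) : prime p ->
  \sum_(c <- cube_vals R) xweight p c * H (lamL p c) =
  wP p 0%N * H (vP p 0%N) + wP p 1%N * H (vP p 1%N) + wP p 2%N * H (vP p 2%N).
Proof.
move=> pp; rewrite (cube_sum p (fun c => H (lamL p c))) lamL1 // lamL0.
rewrite !(lamLw pp) ?eqxx ?orbT // /wP /vP /=; ring.
Qed.

Lemma lamM_law p (H : R -> R) : prime p ->
  \sum_(c <- cube_vals R) xweight p c * H (- lamL p c) =
  wM p 0%N * H (vM p 0%N) + wM p 1%N * H (vM p 1%N) + wM p 2%N * H (vM p 2%N).
Proof.
move=> pp; rewrite (cube_sum p (fun c => H (- lamL p c))) lamL1 // lamL0.
rewrite !(lamLw pp) ?eqxx ?orbT // opprK oppr0 /wM /vM /=; ring.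
Qed.

Lemma lamL_le p c : prime p -> c \in cube_vals R -> `|lamL p c| <= 4 / p%:R.
Proof.
move=> pp; have [x0 x1] := invp_bounds pp.
have /andP[b1 b2] := val1_bounds pp; have /andP[c1 c2] := valw_bounds pp.
rewrite !inE => /or4P[/eqP->|h|h|/eqP->].
- by rewrite lamL1 // ger0_norm //; lra.
- by rewrite lamLw ?h // normrN ger0_norm //; lra.
- by rewrite lamLw ?h ?orbT // normrN ger0_norm //; lra.
- by rewrite lamL0 normr0; lra.
Qed.

Lemma factor_sqr_gt0 p c : prime p -> c \in cube_vals R -> 0 < factor_sqr p c.
Proof.
move=> pp; have [x0 x1] := invp_bounds pp.
rewrite !inE => /or4P[/eqP->|h|h|/eqP->].
- by rewrite factor_sqr1 // exprn_gt0 // subr_gt0; lra.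
- by rewrite factor_sqrw ?h //; nra.
- by rewrite factor_sqrw ?h ?orbT //; nra.
- by rewrite factor_sqr0.
Qed.

End EulerFactor.

(** * The saddle point and the two tails *)

Section Saddle.
Variables (R : realType) (w v : nat -> nat -> R).
Hypothesis model : forall p, prime p -> three_point p (w p) (v p).

Lemma Minf_continuous : continuous (Minf w v).
Proof. exact: (der_continuous (der_Minf model)). Qed.

(** Existence is by the intermediate value theorem, [Minf] being unbounded. The conclusion K <= k is
    what brings the solution into the range of the tail asymptotics. *)
Lemma unique_saddle (K B : R) : 0 < K -> Minf w v K <= B ->
  (exists! k, 0 < k /\ Minf w v k = B) /\ forall k, 0 < k -> Minf w v k = B -> K <= k.
Proof.
move=> K0 KB; split; last first.
  move=> k k0 e; rewrite leNgt; apply/negP => /(Minf_increasing model); rewrite e; lra.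
have [r r0 rB] := Minf_unbounded model B.
have [rK|Kr] := ltP r K.
  have := Minf_increasing model rK; lra.
have cM : {within `[K, r], continuous (Minf w v)} by exact: continuous_subspaceT Minf_continuous.
have hB : Num.min (Minf w v K) (Minf w v r) <= B <= Num.max (Minf w v K) (Minf w v r).
  by rewrite ge_min le_max KB rB orbT.
have [k kin kB] := IVT Kr cM hB.
move: kin; rewrite in_itv /= => /andP[Kk _].
have k0 : 0 < k by lra.
exists k; split => // k' [k'0 k'B].
apply/eqP; rewrite eq_le !leNgt; apply/andP; split; apply/negP => /(Minf_increasing model); lra.
Qed.

End Saddle.

Lemma zeta3_gt0 (R : realType) : 0 < zeta3 R.
Proof.
pose u n : R := \sum_(1 <= k < n.+1) ((k%:R : R) ^+ 3)^-1.
have uS n : u n.+1 = u n + (n.+1%:R ^+ 3)^-1 by rewrite /u big_nat_recr.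
(* A telescoping majorant: without convergence [limn] would say nothing about the sign. *)
have u_le n : u n <= 3 - 2 * n.+1%:R^-1.
  elim: n => [|n IH]; first by rewrite /u big_geq // invr1; lra.
  rewrite uS; have n1 : 1 <= n.+1%:R :> R by rewrite ler1n.
  move: IH n1; rewrite -[n.+2%:R]natr1; move: (u n) (n.+1%:R) => a y IH y1.
  have h : (y ^+ 3)^-1 <= 2 * y^-1 - 2 * (y + 1)^-1.
    have -> : 2 * y^-1 - 2 * (y + 1)^-1 = 2 / (y * (y + 1)) by field; rewrite !gt_eqF //; lra.
    apply: invr_le_div; [by apply: exprn_gt0; lra|by nra|].
    have -> : 2 * y ^+ 3 = y * (2 * y ^+ 2) by ring.
    by rewrite ler_pM2l; nra.
  lra.
have un : nondecreasing_seq u.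
  by apply/nondecreasing_seqP => n; rewrite uS lerDl invr_ge0 exprn_ge0.
have uc : cvgn u.
  apply: nondecreasing_is_cvgn => //; exists 3 => _ [n _ <-]; apply: (le_trans (u_le n)).
  by rewrite gerBl mulr_ge0 // invr_ge0.
have : u 1%N <= zeta3 R by exact: nondecreasing_cvgn_le.
by rewrite /u big_nat1 expr1n invr1; lra.
Qed.

Section Assembly.
Import Normc.
Context (d : measure_display) (T : measurableType d) (R : realType) (P : probability T R).
Variable X : nat -> T -> R[i].
Hypothesis ml : model_law P X.
Hypothesis mi : model_indep P X.

Let Yn := YN X (@lamL R).
Let Ym := YN X (fun p c => - @lamL R p c).

Lemma YmE N x : Ym N x = - Yn N x.
Proof.
rewrite /Ym /Yn /YN -[RHS]mulN1r -psumZ.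
by apply: eq_psum => p _; rewrite mulN1r.
Qed.

Lemma cabsE (z : R[i]) : cabs z = normc z. Proof. by case: z. Qed.

Lemma normc_factor p x : prime p ->
  normc ((1 - X p x / (p%:R)%:C%C)^-1) = expR (lamL p (X p x) / 2).
Proof.
move=> pp; have q0 := factor_sqr_gt0 pp (X_in ml x pp).
set z := 1 - _.
have nz : normc z = Num.sqrt (factor_sqr p (X p x)).
  by rewrite -cabsE /cabs.
have nz0 : 0 < normc z by rewrite nz sqrtr_gt0.
have z0 : z != 0 by apply/eqP => e; move: nz0; rewrite e normc0 ltxx.
have : normc z * normc z^-1 = 1 by rewrite -normcM mulfV // normc_one.
move=> h; have -> : normc z^-1 = (normc z)^-1.
  by apply: (mulfI (lt0r_neq0 nz0)); rewrite h mulfV // gt_eqF.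
rewrite nz /lamL mulNr expRN; congr (_^-1).
rewrite -[X in Num.sqrt X]lnK ?posrE //.
set l := ln _; have -> : expR l = expR (l / 2) ^+ 2.
  by rewrite expr2 -expRD -splitr.
by rewrite sqrtr_sqr ger0_norm // expR_ge0.
Qed.

Lemma cabs_Lpart N x : cabs (Lpart X N x) = expR (Yn N x / 2).
Proof.
rewrite cabsE /Lpart -(big_mkord prime (fun p => (1 - X p x / (p%:R)%:C%C)^-1)).
rewrite -/(pprod N (fun p => (1 - X p x / (p%:R)%:C%C)^-1)) /Yn /YN.
elim: N => [|N IH]; first by rewrite pprod0 psum0 mul0r expR0 normc_one.
rewrite pprodS psumS normcM IH mulrDl expRD; congr (_ * _).
by case: ifP => pN; [exact: normc_factor|rewrite mul0r expR0 normc_one].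
Qed.

Lemma absL_measurable : measurable_fun setT (absL X).
Proof.
apply: measurable_limn => N.
have -> : (fun x => cabs (Lpart X N x)) = (fun x => expR (Yn N x / 2)).
  by apply/funext => x; exact: cabs_Lpart.
apply: measurableT_comp => //; apply: measurable_funM => //.
exact: (YN_measurable ml).
Qed.

Let Y x := 2 * ln (absL X x).

Lemma Y_measurable : measurable_fun setT Y.
Proof.
apply: measurable_funM => //; apply: measurableT_comp => //; exact: absL_measurable.
Qed.

Lemma absL_ae : \forall x \ae P, Yn N x @[N --> \oo] --> Y x /\ absL X x = expR (Y x / 2).
Proof.
apply: filterS (YN_ae_cvg ml mi (@modelP R) (@lamP_law R) (@lamL_le R)) => x /cvg_ex [l hl].
have e : absL X x = expR (l / 2).
  apply: cvg_lim => //.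
  have -> : (fun N => cabs (Lpart X N x)) = (fun N => expR (Yn N x / 2)).
    by apply/funext => N; exact: cabs_Lpart.
  have ce : {for l / 2, continuous (@expR R)} by exact: continuous_expR.
  apply: (@cvg_comp _ _ _ (fun N => Yn N x / 2) (@expR R) _ (nbhs (l / 2)) _ _ ce).
  by apply: cvgM; [exact: hl|exact: cvg_cst].
have Yl : Y x = l by rewrite /Y e expRK mulrC divfK.
by rewrite Yl.
Qed.

Lemma cYn : \forall x \ae P, Yn N x @[N --> \oo] --> Y x.
Proof. by apply: filterS absL_ae => x []. Qed.

Lemma cYm : \forall x \ae P, Ym N x @[N --> \oo] --> - Y x.
Proof.
apply: filterS cYn => x h.
have -> : (fun N => Ym N x) = (fun N => - Yn N x) by apply/funext => N; exact: YmE.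
exact: cvgN.
Qed.

Lemma mYn N : measurable_fun setT (Yn N). Proof. exact: (YN_measurable ml). Qed.
Lemma mYm N : measurable_fun setT (Ym N). Proof. exact: (YN_measurable ml). Qed.
Lemma NY_measurable : measurable_fun setT (fun x => - Y x).
Proof. by apply: measurableT_comp => //; exact: Y_measurable. Qed.

(** Only almost surely is [absL] known to be positive and equal to e^{Y/2}, because of the default
    value of [limn]; hence a comparison of integrands almost everywhere. *)
Lemma moment_integral r : moment P X r = fine (\int[P]_x (expR (r * Y x))%:E)%E.
Proof.
rewrite /moment; congr fine; apply: ae_eq_integral => //.
- apply: measurable_EFin_comp; exact: (measurableT_comp (@measurable_powR R (2 * r)) absL_measurable).
- by apply: measurable_EFin_comp; apply: measurableT_comp => //; apply: measurable_funM => //; exact: Y_measurable.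
apply: filterS absL_ae => x [_ e] _; congr EFin.
have -> : absL X x `^ (2 * r) = expR (2 * r * ln (absL X x)).
  by rewrite /powR gt_eqF // e expR_gt0.
by congr expR; rewrite /Y; ring.
Qed.

Lemma momentP r : moment P X r = expR (Linf (@wP R) (@vP R) r).
Proof.
rewrite moment_integral.
by rewrite (expR_integral (@modelP R) mYn Y_measurable cYn (YN_law ml mi (@lamP_law R))).
Qed.

Lemma momentM r : moment P X (- r) = expR (Linf (@wM R) (@vM R) r).
Proof.
rewrite moment_integral.
rewrite -[RHS]/(fine (expR (Linf (@wM R) (@vM R) r))%:E).
rewrite -(expR_integral (@modelM R) mYm NY_measurable cYm (YN_law ml mi (@lamM_law R))).
by congr fine; apply: eq_integral => x _; rewrite mulNr mulrN.
Qed.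

Lemma calL_E : calL P X = Linf (@wP R) (@vP R).
Proof. by apply/funext => r; rewrite /calL momentP expRK. Qed.

Lemma calLt_E : calLt P X = Linf (@wM R) (@vM R).
Proof. by apply/funext => r; rewrite /calLt momentM expRK. Qed.

Lemma derive1_Linf (w v : nat -> nat -> R) (model : forall p, prime p -> three_point p (w p) (v p)) :
  derive1 (Linf w v) = Minf w v.
Proof. by apply/funext => r; rewrite derive1E; exact: (@derive_val _ _ _ _ _ _ _ (der_Linf model r)). Qed.

Lemma derive1_Minf (w v : nat -> nat -> R) (model : forall p, prime p -> three_point p (w p) (v p)) :
  derive1 (Minf w v) = Sinf w v.
Proof. by apply/funext => r; rewrite derive1E; exact: (@derive_val _ _ _ _ _ _ _ (der_Minf model r)). Qed.

Lemma prob_ae_eq (A B : set T) : measurable A -> measurable B ->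
  (\forall x \ae P, A x <-> B x) -> P A = P B.
Proof.
move=> mA mB h.
have e : (\int[P]_x (\1_A x)%:E = \int[P]_x (\1_B x)%:E)%E.
  apply: ae_eq_integral => //; try by apply: measurable_EFin_comp; exact: measurable_indic.
  apply: filterS h => x h _; congr EFin; rewrite !indicE; congr (_%:R); congr nat_of_bool.
  by apply/idP/idP; rewrite !inE => /h.
by move: e; rewrite !integral_indic // !setIT.
Qed.

(** The sign of [main] is recorded so that the constant can later be enlarged to one common to both
    tails. *)
Lemma Phi_asymptotic : exists C tau0 : R, [/\ 0 < C, 0 < tau0 & forall tau : R, tau0 <= tau ->
    (exists! k : R, 0 < k /\ derive1 (calL P X) k = 2 * (ln tau + euler_gamma R)) /\
     forall k : R, 0 < k -> derive1 (calL P X) k = 2 * (ln tau + euler_gamma R) ->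
       let main := moment P X k * (expR (euler_gamma R) * tau) `^ (- (2 * k))
                   / (k * Num.sqrt (2 * pi * derive1 (derive1 (calL P X)) k)) in
       0 <= main /\ `|Phi P X tau - main| <= C * main * Num.sqrt (ln k / k)].
Proof.
have [C [K [C0 K16 H]]] := tail_asymptotic (@modelP R) mYn Y_measurable cYn (YN_law ml mi (@lamP_law R)).
rewrite calL_E (derive1_Linf (@modelP R)) (derive1_Minf (@modelP R)).
(* At [t0] the saddle equation is solved by K itself, so tau >= t0 puts the saddle at or beyond
   K. *)
set g := euler_gamma R; pose t0 := expR (Minf (@wP R) (@vP R) K / 2 - g).
exists C, t0; split => //; first exact: expR_gt0.
move=> tau ht.
have tau0 : 0 < tau by apply: lt_le_trans ht; exact: expR_gt0.
have hl : Minf (@wP R) (@vP R) K <= 2 * (ln tau + g).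
  have : ln t0 <= ln tau by rewrite ler_ln ?posrE ?expR_gt0.
  rewrite /t0 expRK; lra.
have K0 : 0 < K by lra.
have [hu hk] := unique_saddle (@modelP R) K0 hl; split => // k k0 kE.
have [S0 {}H] := H k (hk k k0 kE).
(* The saddle equation turns the threshold for |L| into e^{m/2}, that is, into Y > m at the tilted
   mean m. *)
have base : expR g * tau = expR (Minf (@wP R) (@vP R) k / 2).
  by rewrite kE -{1}[tau]lnK ?posrE // -expRD; congr expR; field.
have powE : (expR g * tau) `^ (- (2 * k)) = expR (- (k * Minf (@wP R) (@vP R) k)).
  by rewrite base /powR gt_eqF ?expR_gt0 // expRK; congr expR; field.
move=> main; have mainE : main = expR (Linf (@wP R) (@vP R) k) * expR (- (k * Minf (@wP R) (@vP R) k)) /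
    (k * Num.sqrt (2 * pi * Sinf (@wP R) (@vP R) k)) by rewrite /main momentP powE.
split.
  by rewrite mainE divr_ge0 ?mulr_ge0 ?expR_ge0 ?sqrtr_ge0 // ltW.
rewrite mainE.
have -> : Phi P X tau = fine (P [set x | Minf (@wP R) (@vP R) k < Y x]); last exact: H.
rewrite /Phi -/g base; congr fine; apply: prob_ae_eq.
- have -> : [set x | expR (Minf (@wP R) (@vP R) k / 2) < absL X x] =
    setT `&` absL X @^-1` `]expR (Minf (@wP R) (@vP R) k / 2), +oo[.
    by rewrite setTI; apply/seteqP; split => x /=; rewrite in_itv /= andbT.
  exact: (absL_measurable measurableT).
- have -> : [set x | Minf (@wP R) (@vP R) k < Y x] = setT `&` Y @^-1` `]Minf (@wP R) (@vP R) k, +oo[.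
    by rewrite setTI; apply/seteqP; split => x /=; rewrite in_itv /= andbT.
  exact: (Y_measurable measurableT).
apply: filterS absL_ae => x [_ e] /=; rewrite e ltr_expR.
by split; lra.
Qed.

Lemma Psi_asymptotic : exists C tau0 : R, [/\ 0 < C, 0 < tau0 & forall tau : R, tau0 <= tau ->
    (exists! k : R, 0 < k /\
        derive1 (calLt P X) k = 2 * ln tau + euler_gamma R - ln (zeta3 R)) /\
     forall k : R, 0 < k ->
       derive1 (calLt P X) k = 2 * ln tau + euler_gamma R - ln (zeta3 R) ->
       let main := moment P X (- k) * (zeta3 R) `^ k
                   / (k * Num.sqrt (2 * pi * derive1 (derive1 (calLt P X)) k)
                      * (expR (euler_gamma R) * tau ^+ 2) `^ k) in
       0 <= main /\ `|Psi P X tau - main| <= C * main * Num.sqrt (ln k / k)].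
Proof.
have [C [K [C0 K16 H]]] := tail_asymptotic (@modelM R) mYm NY_measurable cYm (YN_law ml mi (@lamM_law R)).
rewrite calLt_E (derive1_Linf (@modelM R)) (derive1_Minf (@modelM R)).
have z0 := zeta3_gt0 R; set z := zeta3 R in z0 *.
set g := euler_gamma R; pose t0 := expR ((Minf (@wM R) (@vM R) K - g + ln z) / 2).
exists C, t0; split => //; first exact: expR_gt0.
move=> tau ht.
have tau0 : 0 < tau by apply: lt_le_trans ht; exact: expR_gt0.
have hl : Minf (@wM R) (@vM R) K <= 2 * ln tau + g - ln z.
  have : ln t0 <= ln tau by rewrite ler_ln ?posrE ?expR_gt0.
  rewrite /t0 expRK; lra.
have K0 : 0 < K by lra.
have [hu hk] := unique_saddle (@modelM R) K0 hl; split => // k k0 kE.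
have [S0 {}H] := H k (hk k k0 kE).
have tE : tau = expR (ln tau) by rewrite lnK ?posrE.
have zE : z = expR (ln z) by rewrite lnK ?posrE.
(* Here the saddle equation turns the threshold into e^{-m/2}, so that |L| small means -Y > m. *)
have base : Num.sqrt (z / expR g) * tau^-1 = expR (- Minf (@wM R) (@vM R) k / 2).
  have -> : z / expR g = expR ((ln z - g) / 2) ^+ 2.
    by rewrite expr2 -expRD {1}zE -expRN -expRD; congr expR; field.
  by rewrite sqrtr_sqr ger0_norm ?expR_ge0 // {1}tE -expRN -expRD kE; congr expR; field.
have powE : z `^ k / (expR g * tau ^+ 2) `^ k = expR (- (k * Minf (@wM R) (@vM R) k)).
  have -> : expR g * tau ^+ 2 = expR (g + 2 * ln tau).
    by rewrite {1}tE expr2 -!expRD; congr expR; ring.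
  rewrite /powR !gt_eqF ?expR_gt0 // expRK -expRN -expRD kE; congr expR; ring.
move=> main; have mainE : main = expR (Linf (@wM R) (@vM R) k) * expR (- (k * Minf (@wM R) (@vM R) k)) /
    (k * Num.sqrt (2 * pi * Sinf (@wM R) (@vM R) k)).
  by rewrite /main momentM -powE invfM; ring.
split.
  by rewrite mainE divr_ge0 ?mulr_ge0 ?expR_ge0 ?sqrtr_ge0 // ltW.
rewrite mainE.
have -> : Psi P X tau = fine (P [set x | Minf (@wM R) (@vM R) k < - Y x]); last exact: H.
rewrite /Psi -/g -/z base; congr fine; apply: prob_ae_eq.
- have -> : [set x | absL X x < expR (- Minf (@wM R) (@vM R) k / 2)] =
    setT `&` absL X @^-1` `]-oo, expR (- Minf (@wM R) (@vM R) k / 2)[.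
    by rewrite setTI; apply/seteqP; split => x /=; rewrite in_itv /=.
  exact: (absL_measurable measurableT).
- have -> : [set x | Minf (@wM R) (@vM R) k < - Y x] =
    setT `&` (fun x => - Y x) @^-1` `]Minf (@wM R) (@vM R) k, +oo[.
    by rewrite setTI; apply/seteqP; split => x /=; rewrite in_itv /= andbT.
  exact: (NY_measurable measurableT).
apply: filterS absL_ae => x [_ e] /=; rewrite e ltr_expR.
by split; lra.
Qed.

End Assembly.

Theorem theorem4p1 (R : realType) (d : measure_display) (T : measurableType d)
    (P : probability T R) (X : nat -> T -> R[i]) :
  model_law P X -> model_indep P X ->
  exists (C tau0 : R), 0 < tau0 /\ forall tau : R, tau0 <= tau ->
    ((exists! k : R, 0 < k /\ derive1 (calL P X) k = 2 * (ln tau + euler_gamma R)) /\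
     forall k : R, 0 < k -> derive1 (calL P X) k = 2 * (ln tau + euler_gamma R) ->
       let main := moment P X k * (expR (euler_gamma R) * tau) `^ (- (2 * k))
                   / (k * Num.sqrt (2 * pi * derive1 (derive1 (calL P X)) k)) in
       `|Phi P X tau - main| <= C * main * Num.sqrt (ln k / k))
    /\
    ((exists! k : R, 0 < k /\
        derive1 (calLt P X) k = 2 * ln tau + euler_gamma R - ln (zeta3 R)) /\
     forall k : R, 0 < k ->
       derive1 (calLt P X) k = 2 * ln tau + euler_gamma R - ln (zeta3 R) ->
       let main := moment P X (- k) * (zeta3 R) `^ k
                   / (k * Num.sqrt (2 * pi * derive1 (derive1 (calLt P X)) k)
                      * (expR (euler_gamma R) * tau ^+ 2) `^ k) in
       `|Psi P X tau - main| <= C * main * Num.sqrt (ln k / k)).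
Proof.
move=> ml mi.
have [C1 [t1 [C10 t10 H1]]] := Phi_asymptotic ml mi.
have [C2 [t2 [C20 t20 H2]]] := Psi_asymptotic ml mi.
exists (Num.max C1 C2), (Num.max t1 t2); split; first by rewrite lt_max t10.
move=> tau; rewrite ge_max => /andP[ht1 ht2].
have [u1 h1] := H1 tau ht1; have [u2 h2] := H2 tau ht2.
split; split => // k k0 kE; cbv zeta.
- have [m0 h] := h1 k k0 kE; apply: (le_trans h).
  by rewrite ler_wpM2r ?sqrtr_ge0 // ler_wpM2r // le_max lexx.
- have [m0 h] := h2 k k0 kE; apply: (le_trans h).
  by rewrite ler_wpM2r ?sqrtr_ge0 // ler_wpM2r // le_max lexx orbT.
Qed.
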